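(* Let $T$ be a countable Dedekind domain such that $T/J$ is finite for every nonzero proper ideal $J\subset T$, equipped with the discrete $\sigma$-algebra. Let $\mathcal{I}$ be the set of all nonzero ideals $I$ of $T$ such that $T/I$ is an elementary abelian group, and let $\epsilon=(\epsilon_I)_{I\in\mathcal{I}}\in\mathbb{R}_{>0}^{\mathcal{I}}$. Let $P=\{\mathfrak{p}_1,\dots,\mathfrak{p}_k\}$ be a finite set of nonzero prime ideals of $T$ and let $T_{\mathfrak{p}_i}=\varprojlim_m T/\mathfrak{p}_i^m$. Let $N$ be a finite $T$-module annihilated by a product of powers of elements of $P$. Let $u$ be a positive integer and, for each $n$, let $M(n)$ be an $\epsilon$-balanced $n\times(n+u)$ random matrix with entries in $T$. Then \[\lim_{n\to\infty}\mathbb{P}\left(\mathrm{cok}(M(n))\otimes \prod_{i=1}^kT_{\mathfrak{p}_i}\simeq N\right)=\frac{1}{|\mathrm{Aut}(N)||N|^u}\prod_{i=1}^k\prod_{j=1}^\infty \left(1-|T/\mathfrak{p}_i|^{-u-j}\right).\]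
   Context: An abelian group is elementary abelian if it is isomorphic to $(\mathbb{Z}/p\mathbb{Z})^m$ for some prime $p$ and integer $m>0$. If $V$ is an $\mathbb{F}_p$-vector space, a random variable $y$ in $V$ is $\epsilon'$-balanced (for a real $\epsilon'>0$) if $\mathbb{P}(y\in H)\leq 1-\epsilon'$ for every proper affine $\mathbb{F}_p$-subspace $H\subset V$ (a set $a+H'$ with $H'\subsetneq V$ an $\mathbb{F}_p$-subspace). A random variable $y$ valued in $T$ is $\epsilon$-balanced if for every $I\in\mathcal{I}$ the image of $y$ in $T/I$ (an $\mathbb{F}_p$-vector space for the appropriate $p$) is $\epsilon_I$-balanced. A random matrix with entries in $T$ is $\epsilon$-balanced if its entries are independent and each is $\epsilon$-balanced. For a matrix $M$ with $n$ rows and $n+u$ columns, $\mathrm{cok}(M)=T^n/M(T^{n+u})$. *)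

(* Defs.v *)
From HB Require Import structures.
From mathcomp Require Import all_boot all_order all_algebra.
From mathcomp Require Import all_classical all_reals all_analysis.

Set Implicit Arguments.
Unset Strict Implicit.
Unset Printing Implicit Defensive.

Import Order.TTheory GRing.Theory Num.Theory.
Local Open Scope classical_set_scope.
Local Open Scope ring_scope.

Section Ideals.
Context {T : comNzRingType}.

Definition is_idl (I : set T) : Prop :=
  [/\ I 0, (forall x y, I x -> I y -> I (x + y)) &
      (forall a x, I x -> I (a * x))].

Definition nonzero_idl (I : set T) : Prop := exists x, I x /\ x != 0.

Definition proper_idl (I : set T) : Prop := is_idl I /\ ~ I 1.

Definition prime_idl (I : set T) : Prop :=
  proper_idl I /\ (forall a b, I (a * b) -> I a \/ I b).

Definition maximal_idl (I : set T) : Prop :=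
  proper_idl I /\
  (forall J, is_idl J -> I `<=` J -> J = I \/ J = setT).

Definition ideal_gen (s : seq T) : set T :=
  [set x | exists c : 'I_(size s) -> T, x = \sum_(i < size s) c i * s`_i].

Definition ideal_mul (I J : set T) : set T :=
  [set x | exists s : seq (T * T),
     (forall ab, ab \in s -> I ab.1 /\ J ab.2) /\
     x = \sum_(ab <- s) ab.1 * ab.2].

Fixpoint ideal_pow (I : set T) (m : nat) : set T :=
  if m is m'.+1 then ideal_mul I (ideal_pow I m') else setT.

Definition ideal_prod (k : nat) (f : 'I_k -> set T) : set T :=
  foldr ideal_mul setT [seq f i | i <- enum 'I_k].

Definition finite_quotient (J : set T) : Prop :=
  exists s : seq T, forall x, exists2 y, y \in s & J (x - y).

Definition quotient_card (J : set T) (q : nat) : Prop :=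
  exists s : seq T, [/\ size s = q,
    (forall x, exists2 y, y \in s & J (x - y)) &
    (forall a b : 'I_(size s), J (s`_a - s`_b) -> a = b)].

(* T/I is isomorphic (as an abelian group) to ('Z/p)^m, witnessed by an
   additive surjection f : T -> 'F_p^m with kernel I *)
Definition elem_quot_data (I : set T) (p m : nat)
    (f : T -> 'rV['F_p]_m) : Prop :=
  [/\ prime p, (0 < m)%N,
      (forall x y, f (x + y) = f x + f y),
      (forall v, exists x, f x = v) &
      (forall x, f x = 0 <-> I x)].

Definition calI (I : set T) : Prop :=
  [/\ is_idl I, nonzero_idl I &
      exists p m (f : T -> 'rV['F_p]_m), elem_quot_data I f].

End Ideals.

Definition noetherian (T : comNzRingType) : Prop :=
  forall I : set T, is_idl I -> exists s : seq T, I = ideal_gen s.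

Definition integrally_closed (T : idomainType) : Prop :=
  forall a b : T, b != 0 ->
    (exists (d : nat) (c : 'I_d -> T),
        a ^+ d + \sum_(i < d) c i * a ^+ i * b ^+ (d - i) = 0) ->
    exists t, a = t * b.

Definition dedekind_domain (T : idomainType) : Prop :=
  [/\ noetherian T, integrally_closed T &
      forall P : set T, prime_idl P -> nonzero_idl P -> maximal_idl P].

Section Balanced.
Context {R : realType} {d : measure_display} {Omega : measurableType d}.
Context {T : comNzRingType}.

(* y : Omega -> T is eps-balanced: for every I in calI, the image of y in
   T/I ~ 'F_p^m lies in a given proper affine subspace a + <U> with
   probability at most 1 - eps I *)
Definition balanced_rv (P : probability Omega R) (eps : set T -> R)
    (y : Omega -> T) : Prop :=
  forall (I : set T), calI I ->
  forall (p m : nat) (f : T -> 'rV['F_p]_m), elem_quot_data I f ->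
  forall (a : 'rV['F_p]_m) (U : 'M['F_p]_m), (\rank U < m)%N ->
    (P [set w | ((f (y w) - a)%R <= U)%MS] <= ((1 - eps I)%R)%:E)%E.

End Balanced.

(* cok(M) (x)_T prod_i T_{p_i}  ~=  N, via the universal property of    *)
(* the tensor product.                                                 *)
(* T_p = lim_m T/p^m is modeled by sequences b : nat -> T with          *)
(* b (m+1) - b m in p^m, modulo b ~ b' iff b m - b' m in p^m for all m; *)
(* prod_{i<k} T_{p_i} by families b : 'I_k -> nat -> T.                 *)
Section Tensor.
Context {T : comNzRingType}.
Context {k : nat}.
Variable (p : 'I_k -> set T).

Definition compat_seq (b : 'I_k -> nat -> T) : Prop :=
  forall i m, ideal_pow (p i) m (b i m.+1 - b i m).

Definition equiv_seq (b b' : 'I_k -> nat -> T) : Prop :=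
  forall i m, ideal_pow (p i) m (b i m - b' i m).

Definition scale_add_seq (a : T) (b b' : 'I_k -> nat -> T) :
  'I_k -> nat -> T := fun i m => a * b i m + b' i m.

(* g is a T-bilinear map cok(M) x prod_i T_{p_i} -> Q, given as a map on
   representatives *)
Definition cok_bilinear (n u : nat) (M : 'M[T]_(n, n + u)) (Q : lmodType T)
    (g : 'cV[T]_n -> ('I_k -> nat -> T) -> Q) : Prop :=
  [/\ (forall b, compat_seq b -> forall a v v',
         g (a *: v + v') b = a *: g v b + g v' b),
      (forall v a b b', compat_seq b -> compat_seq b' ->
         g v (scale_add_seq a b b') = a *: g v b + g v b'),
      (forall v b b', compat_seq b -> compat_seq b' -> equiv_seq b b' ->
         g v b = g v b') &
      (forall w b, compat_seq b -> g (M *m w) b = 0)].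

Definition is_linear_map (N Q : lmodType T) (h : N -> Q) : Prop :=
  forall a x y, h (a *: x + y) = a *: h x + h y.

Definition cok_tensor_iso (n u : nat) (M : 'M[T]_(n, n + u))
    (N : lmodType T) : Prop :=
  exists beta : 'cV[T]_n -> ('I_k -> nat -> T) -> N,
    cok_bilinear M beta /\
    forall (Q : lmodType T) (g : 'cV[T]_n -> ('I_k -> nat -> T) -> Q),
      cok_bilinear M g ->
      exists h : N -> Q,
        [/\ is_linear_map h,
            (forall v b, compat_seq b -> g v b = h (beta v b)) &
            (forall h' : N -> Q, is_linear_map h' ->
               (forall v b, compat_seq b -> g v b = h' (beta v b)) ->
               h' =1 h)].

End Tensor.

Definition card_aut (T : nzRingType) (N : finLmodType T) : nat :=
  #|[set f : {ffun N -> N} |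
      `[< bijective f /\ forall (a : T) (x y : N),
                           f (a *: x + y) = a *: f x + f y >]]|.

Definition euler_prod (R : realType) (q u : nat) : R :=
  limn (fun J => \prod_(1 <= j < J.+1) (1 - ((q%:R : R) ^+ (u + j))^-1)).

(* Main.v *)
(** Let [J] be the intersection of the [p_i^(e_i + 1)], where [N] is killed by the [p_i^(e_i)],
    and let [A = T / J], a finite ring. By Nakayama's lemma (determinant trick), the tensor
    product of [cok M] with the [T_(p_i)] is isomorphic to [N] if and only if the cokernel of
    [M mod J] is: the spare exponent in [J] is what detects a cokernel larger than [N].

    Over [A], the probability that [cok M] is isomorphic to [N] is [1 / |Aut N|] times the sum,
    over the surjections [F : A^n -> N], of the probability that [im M = ker F]. By Nakayama
    again, [im M = ker F] means that the columns of [M] lie in [ker F] and that, for each [i],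
    the matrix [Theta_i M] of their classes in [ker F / pi_i ker F] has rank [n] over the residue
    field with [q_i] elements. The indicator of rank [n] is approximated by Newton interpolation
    by a polynomial in [q_i^(corank)], and [q_i^(corank)] counts the vectors [v] with
    [v (Theta_i M) = 0]; so, up to a small error, everything is a linear combination of
    indicators [all columns of M lie in W], where [W] has bounded index in [A^n].

    For such [W] a single balanced column [x] lies in [W] with probability close to [|W| / |D|],
    where [D] contains [W] and all but boundedly many unit vectors, and is generated by them even
    after deleting a few: averaging the indicator of [W] over one coordinate at a time increases
    the set where the average is not minimal, hence contracts its oscillation geometrically. If
    [D <> A^n], one more factor [1 - eps] is gained, and such [W] are few, so that summing over
    all [W] the balanced and the uniform probabilities have asymptotically the same moments.
    For uniform [M] the ranks modulo the different primes are independent, which gives the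
    product of the [1 - q_i^-(u + j)], and almost all [F : A^n -> N] are surjective. *)

Require Import Defs.
From HB Require Import structures.
From mathcomp Require Import all_boot all_order all_algebra.
From mathcomp Require Import generic_quotient ring_quotient.
From mathcomp Require Import boolp ring lra zify.

Set Implicit Arguments.
Unset Strict Implicit.
Unset Printing Implicit Defensive.

Import Order.TTheory GRing.Theory Num.Theory.
Local Open Scope ring_scope.

(** * Mixing of balanced columns *)

(** The obstacle is that column probabilities are controlled only for [W] of index at most a fixed
    [B], with constants such as [2 ^ (#|A| ^ B)]; an interpolation whose degree grows with [n] is
    out of reach. Truncation at a fixed order [t] is legitimate because the truncation error is
    dominated pointwise by [newton_tail], a polynomial in the same quantity [q_i^(corank)], hence
    again a combination of indicators of bounded index. Its mean can therefore be moved to the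
    uniform law, where it is a factorial moment: the mean number of ordered independent families of
    a given size in the left kernel is at most 1, and the coefficient in front tends to 0 with [t].
    The sum over the roughly [|N|^n] maps [F] stays under control because every [W] in use lies in
    [ker F], and a given [W] lies in at most [|N|^B] kernels. The factor [|N|^-u] is what [|N|^n]
    surjections of weight [|N|^-(n + u)] leave. Local rings are replaced by pairs [pi], [s] with
    [pi] in [p], [s] outside [p] and [s p] inside [pi T]; completions by compatible sequences. *)

Definition submod (A : comNzRingType) (E : finLmodType A) (W : {set E}) : Prop :=
  [/\ 0 \in W, (forall x y, x \in W -> y \in W -> x + y \in W) &
      (forall a x, x \in W -> a *: x \in W)].

Section Submodules.
Variables (A : comNzRingType) (E : finLmodType A).
Implicit Types W D Z : {set E}.

Lemma submod0 W : submod W -> 0 \in W. Proof. by case. Qed.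

Lemma submodD W x y : submod W -> x \in W -> y \in W -> x + y \in W.
Proof. by case=> _ h _; apply: h. Qed.

Lemma submodZ W a x : submod W -> x \in W -> a *: x \in W.
Proof. by case=> _ _; apply. Qed.

Lemma submodN W x : submod W -> x \in W -> - x \in W.
Proof. by move=> sW xW; rewrite -scaleN1r; apply: submodZ. Qed.

Lemma submodB W x y : submod W -> x \in W -> y \in W -> x - y \in W.
Proof. by move=> sW xW yW; apply: submodD => //; apply: submodN. Qed.

Lemma submodDr W x y : submod W -> y \in W -> (x + y \in W) = (x \in W).
Proof.
move=> sW yW; apply/idP/idP => h; last exact: submodD.
by rewrite -(addrK y x); apply: submodB.
Qed.

Lemma submodDl W x y : submod W -> y \in W -> (y + x \in W) = (x \in W).
Proof. by move=> sW yW; rewrite addrC submodDr. Qed.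

Lemma submod_sum W (I : Type) (r : seq I) (P : pred I) (F : I -> E) :
  submod W -> (forall i, P i -> F i \in W) -> \sum_(i <- r | P i) F i \in W.
Proof.
move=> sW h; elim/big_ind: _ => //; first exact: submod0.
by move=> x y; apply: submodD.
Qed.

Lemma submodT : submod [set: E].
Proof. by split=> *; rewrite inE. Qed.

Lemma submodI W D : submod W -> submod D -> submod (W :&: D).
Proof.
move=> sW sD; split; first by rewrite inE !submod0.
  by move=> x y; rewrite !inE => /andP[xW xD] /andP[yW yD]; rewrite !submodD.
by move=> a x; rewrite !inE => /andP[xW xD]; rewrite !submodZ.
Qed.

Definition invariant_by W Z := forall x w, w \in W -> (x + w \in Z) = (x \in Z).

Lemma card_translate Z x : #|[set z + x | z in Z]| = #|Z|.
Proof. by rewrite card_imset //; apply: addIr. Qed.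

(** The coset [z + W] lies in [Z'] and misses [Z]. This is the counting device of the mixing
    argument: a strict growth of [W]-invariant sets gains at least [#|W|] elements. *)
Lemma card_invariant_grow W Z Z' z : submod W -> invariant_by W Z ->
  invariant_by W Z' -> Z \subset Z' -> z \in Z' -> z \notin Z ->
  (#|Z| + #|W| <= #|Z'|)%N.
Proof.
move=> sW iZ iZ' sZ zZ' zZ.
have dis : [disjoint Z & [set w + z | w in W]].
  rewrite disjoint_sym; apply/pred0P => v /=; apply/negP => /andP[/imsetP[w wW ->]].
  by rewrite addrC iZ // (negbTE zZ).
rewrite -(card_translate W z) -leq_card_setU in dis *.
move: dis => /eqP <-.
apply: subset_leq_card; apply/subUsetP; split=> //.
by apply/subsetP => v /imsetP[w wW ->]; rewrite addrC iZ'.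
Qed.

Lemma submod_gt0 W : submod W -> (0 < #|W|)%N.
Proof. by move=> sW; apply/card_gt0P; exists 0; apply: submod0. Qed.

Lemma submod_proper_double W D : submod W -> submod D -> W \proper D ->
  (2 * #|W| <= #|D|)%N.
Proof.
move=> sW sD /properP[sWD [z zD zW]]; rewrite mul2n -addnn.
apply: (@card_invariant_grow W W D z) => // x w wW; first by rewrite submodDr.
by rewrite submodDr // (subsetP sWD).
Qed.

End Submodules.

Section Mixing.
Variables (R : realFieldType) (A : finComNzRingType) (n : nat).
Local Notation V := ('cV[A]_n).
Implicit Types (W D : {set V}) (s : {set 'I_n}) (phi : V -> R) (v x : V).

Definition unitv (i : 'I_n) : V := delta_mx i 0.

Definition mask s x : V := \col_i (if i \in s then x i 0 else 0).

Lemma unitvE i j : unitv i j 0 = (j == i)%:R.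
Proof. by rewrite mxE eqxx andbT. Qed.

Lemma maskT x : mask setT x = x.
Proof. by apply/colP => i; rewrite mxE inE. Qed.

Lemma mask0 x : mask set0 x = 0.
Proof. by apply/colP => i; rewrite !mxE inE. Qed.

Lemma mask_sum s x : mask s x = \sum_(i in s) x i 0 *: unitv i.
Proof.
apply/colP => j; rewrite mxE summxE.
under eq_bigr => i _ do rewrite mxE unitvE.
case: ifP => js.
  rewrite (bigD1 j) //= eqxx mulr1 big1 ?addr0 // => i /andP[_ /negbTE].
  by rewrite eq_sym => ->; rewrite mulr0.
rewrite big1 // => i is_; case: eqP => [ji|]; last by rewrite mulr0.
by rewrite ji is_ in js.
Qed.

Lemma mask_submod D s x : submod D -> (forall i, i \in s -> unitv i \in D) ->
  mask s x \in D.
Proof.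
move=> sD h; rewrite mask_sum; apply: submod_sum => // i si.
by apply: submodZ => //; apply: h.
Qed.

Variable mu : 'I_n -> A -> R.

Definition weight x : R := \prod_i mu i (x i 0).

(* Expectation of [phi (v + x)], for [x] the random vector restricted to the coordinates in [s]. *)
Definition emask s phi v : R := \sum_x weight x * phi (v + mask s x).

Definition step i phi v : R := \sum_a mu i a * phi (v + a *: unitv i).

Hypothesis mu_ge0 : forall i a, 0 <= mu i a.
Hypothesis mu_sum1 : forall i, \sum_a mu i a = 1.

Lemma weight_ge0 x : 0 <= weight x.
Proof. by apply: prodr_ge0 => i _. Qed.

Lemma weight_sum1 : \sum_x weight x = 1.
Proof.
transitivity (\sum_(f : {ffun 'I_n -> A}) \prod_i mu i (f i)).
  rewrite (reindex (fun f : {ffun 'I_n -> A} => \col_i f i : V)) /=; last first.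
    exists (fun x : V => [ffun i => x i 0]) => [f _|x _].
      by apply/ffunP => i; rewrite ffunE mxE.
    by apply/colP => i; rewrite mxE ffunE.
  by apply: eq_bigr => f _; apply: eq_bigr => i _; rewrite mxE.
by rewrite -bigA_distr_bigA big1.
Qed.

Definition setc x i a : V := \col_j (if j == i then a else x j 0).

Lemma emask_setU1 i s phi v : i \notin s ->
  emask (i |: s) phi v = emask s (step i phi) v.
Proof.
move=> is_; rewrite /emask /step.
under [RHS]eq_bigr => x _ do rewrite mulr_sumr.
rewrite [RHS]pair_big /=.
(* An involution on pairs: the coordinate [i] of [x], which [mask s] does not see, is exchanged with
   the independent sample [a]. *)
rewrite (reindex (fun p : V * A => (setc p.1 i p.2, p.1 i 0))) /=; last first.
  by exists (fun p : V * A => (setc p.1 i p.2, p.1 i 0)) => -[x a] _ /=;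
     congr pair; rewrite ?mxE ?eqxx //; apply/colP => j; rewrite !mxE;
     case: eqP => // ->.
transitivity (\sum_x \sum_a (weight x * mu i a) * phi (v + mask (i |: s) x)).
  apply: eq_bigr => x _; rewrite -mulr_suml -mulr_sumr mu_sum1 mulr1 //.
rewrite pair_big /=; apply: eq_bigr => -[x a] _ /=; rewrite mulrA; congr (_ * phi _).
  rewrite /weight (bigD1 i) //= [in RHS](bigD1 i) //= !mxE eqxx.
  have -> : \prod_(j | j != i) mu j (setc x i a j 0) = \prod_(j | j != i) mu j (x j 0).
    by apply: eq_bigr => j /negbTE ji; rewrite mxE ji.
  by ring.
rewrite -addrA; congr (_ + _); apply/colP => j; rewrite !mxE !inE eqxx andbT.
case: eqP => [->|_] /=; first by rewrite (negbTE is_) mulr1 add0r.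
by rewrite mulr0 addr0.
Qed.

Lemma emask0 phi v : emask set0 phi v = phi v.
Proof.
rewrite /emask; under eq_bigr => x _ do rewrite mask0 addr0.
by rewrite -mulr_suml weight_sum1 mul1r.
Qed.

Lemma eq_emask s phi psi v : phi =1 psi -> emask s phi v = emask s psi v.
Proof. by move=> h; apply: eq_bigr => x _; rewrite h. Qed.

Lemma emask1 i phi v : emask [set i] phi v = step i phi v.
Proof. by rewrite -(setU0 [set i]) emask_setU1 ?inE // emask0. Qed.

Lemma emaskU s (t : {set 'I_n}) phi v : [disjoint s & t] ->
  emask (s :|: t) phi v = emask s (emask t phi) v.
Proof.
move: {2}#|t| (erefl #|t|) => k; elim: k t phi => [|k IH] t phi.
  move/eqP; rewrite cards_eq0 => /eqP -> _; rewrite setU0.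
  by apply: eq_emask => x; rewrite emask0.
move=> tk dis; have /card_gt0P[i it] : (0 < #|t|)%N by rewrite tk.
have tE : t = i |: (t :\ i) by rewrite setD1K.
have is_ : i \notin s by apply: contraL it => is_; move/disjointFr: dis => ->.
have dis' : [disjoint s & t :\ i].
  by apply: disjointWr dis; apply: subsetDl.
rewrite tE setUCA emask_setU1; last by rewrite !inE eqxx (negbTE is_).
rewrite IH //; last by move: tk; rewrite (cardsD1 i) it => -[].
by apply: eq_emask => x; rewrite emask_setU1 // !inE eqxx.
Qed.

Lemma emask_ge s phi v c : (forall x, c <= phi (v + mask s x)) ->
  c <= emask s phi v.
Proof.
move=> h; rewrite -[c]mul1r -weight_sum1 mulr_suml /emask.
by apply: ler_sum => x _; apply: ler_wpM2l => //; apply: weight_ge0.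
Qed.

Lemma emask_le s phi v c : (forall x, phi (v + mask s x) <= c) ->
  emask s phi v <= c.
Proof.
move=> h; rewrite -[c]mul1r -weight_sum1 mulr_suml /emask.
by apply: ler_sum => x _; apply: ler_wpM2l => //; apply: weight_ge0.
Qed.

Lemma emask_inv s phi W : (forall v w, w \in W -> phi (v + w) = phi v) ->
  forall v w, w \in W -> emask s phi (v + w) = emask s phi v.
Proof. by move=> h v w wW; rewrite /emask; apply: eq_bigr => x _; rewrite addrAC (h _ w). Qed.

Definition additive_subgroup (K : {set A}) :=
  0 \in K /\ forall a b, a \in K -> b \in K -> a - b \in K.

Variable eps : R.
Hypothesis eps_gt0 : 0 < eps.
Hypothesis eps_le : eps <= 1 / 2.
Hypothesis mu_bal : forall i (K : {set A}) a, additive_subgroup K -> K != setT ->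
  \sum_(x : A | x - a \in K) mu i x <= 1 - eps.

(** Chosen so that all atoms lighter than [eta] together weigh at most [eps / 2], half of the mass
    that balancedness puts outside a coset of a proper subgroup. *)
Let eta : R := eps / (2 * #|A|%:R).

Lemma cardA_gt0 : 0 < #|A|%:R :> R.
Proof. by rewrite ltr0n; apply/card_gt0P; exists 0. Qed.

Lemma eta_gt0 : 0 < eta.
Proof. by rewrite divr_gt0 // mulr_gt0 // cardA_gt0. Qed.

Lemma eta_le1 : eta <= 1.
Proof.
rewrite ler_pdivrMr ?mulr_gt0 ?cardA_gt0 // mul1r.
have : 1 <= #|A|%:R :> R by rewrite ler1n; apply/card_gt0P; exists 0.
by move: eps_le; lra.
Qed.

Lemma small_atoms_sum i (P : pred A) : (forall a, P a -> mu i a < eta) ->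
  \sum_(a | P a) mu i a <= eps / 2.
Proof.
move=> h; have -> : eps / 2 = \sum_(a : A) eta.
  rewrite sumr_const -mulr_natl /eta; field; exact: (lt0r_neq0 cardA_gt0).
rewrite [leRHS](bigID P) /=; apply: ler_wpDr.
  by apply: sumr_ge0 => *; apply/ltW/eta_gt0.
by apply: ler_sum => a Pa; apply/ltW/h.
Qed.

Lemma heavy_atom i : exists a, eta <= mu i a.
Proof.
case: (pickP (fun a => eta <= mu i a)) => [a h|h]; first by exists a.
have := @small_atoms_sum i predT; rewrite mu_sum1 => H.
have : 1 <= eps / 2 by apply: H => a _; rewrite ltNge h.
by move: eps_le; lra.
Qed.

(** If [K] were proper, the coset of a heavy atom [a0] would carry at most [1 - eps], while its
    complement, made of light atoms only, carries at most [eps / 2]. *)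
Lemma heavy_atoms_generate i (K : {set A}) : additive_subgroup K ->
  (forall a b, eta <= mu i a -> eta <= mu i b -> a - b \in K) -> K = setT.
Proof.
move=> sK h; apply/eqP/negPn/negP => nK.
have [a0 ha0] := heavy_atom i.
have := mu_bal i a0 sK nK.
have : \sum_(x : A | x - a0 \notin K) mu i x <= eps / 2.
  by apply: small_atoms_sum => a; apply: contraNT; rewrite -leNgt => ha; apply: h.
have := mu_sum1 i; rewrite (bigID (fun x : A => x - a0 \in K)) /=.
by move: eps_gt0; lra.
Qed.

Section Grow.
Variables (W D : {set V}) (U : {set 'I_n}) (d : nat).
Hypotheses (sW : submod W) (sD : submod D) (WD : W \subset D).
Hypothesis cardD : (#|D| <= d * #|W|)%N.

(** Robust generation: [W] and the unit vectors of [U] still span [D] after the deletion of any [b]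
    of these vectors, much as a code of distance more than [b] survives erasures. *)
Definition generates_without b := forall s, s \subset U -> (#|s| <= b)%N ->
  forall D', submod D' -> W \subset D' -> (forall i, i \in U :\: s -> unitv i \in D') ->
  D \subset D'.

Hypothesis UD : forall i, i \in U -> unitv i \in D.

Lemma shift_in_D i a v : i \in U -> v \in D -> v + a *: unitv i \in D.
Proof. by move=> iU vD; apply: submodD => //; apply: submodZ => //; apply: UD. Qed.

Lemma stable_full (Z : {set V}) s : generates_without d -> s \subset U -> (#|s| <= d)%N ->
  Z \subset D -> Z != set0 -> invariant_by W Z ->
  (forall i a z, i \in U :\: s -> (z + a *: unitv i \in Z) = (z \in Z)) -> Z = D.
Proof.
move=> gen sU sd ZD /set0Pn[z0 z0Z] iW iU; apply/eqP; rewrite eqEsubset ZD /=.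
(* The stabiliser of [Z] under translation; asking for all multiples of [w] at once makes it a
   submodule, so that [generates_without] applies to it. *)
pose D' := [set w : V | [forall a, [forall z, (z + a *: w \in Z) == (z \in Z)]]].
have D'P w : reflect (forall a z, (z + a *: w \in Z) = (z \in Z)) (w \in D').
  rewrite inE; apply: (iffP forallP) => [h a z|h a]; first by have /forallP/(_ z)/eqP := h a.
  by apply/forallP => z; rewrite h.
have sD' : submod D'.
  split; first by apply/D'P => a z; rewrite scaler0 addr0.
    by move=> x y /D'P hx /D'P hy; apply/D'P => a z; rewrite scalerDr addrA hy hx.
  by move=> a x /D'P hx; apply/D'P => b z; rewrite scalerA hx.
have : D \subset D'.
  apply: (gen s) => //; last by move=> i i_; apply/D'P => a z; apply: iU.
  by apply/subsetP => w wW; apply/D'P => a z; rewrite iW // submodZ.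
move/subsetP => DD'; apply/subsetP => v vD.
have /D'P/(_ 1 z0) : v - z0 \in D'.
  by apply: DD'; apply: submodB => //; apply: (subsetP ZD).
by rewrite scale1r addrC subrK => ->.
Qed.

Definition sublevel phi c : {set V} := [set v in D | phi v <= c].

Arguments sublevel phi c%_R.

Lemma sublevel_inv phi c : (forall v w, w \in W -> phi (v + w) = phi v) ->
  invariant_by W (sublevel phi c).
Proof.
move=> iphi v w wW; rewrite !inE (iphi _ w) // submodDr //; exact: (subsetP WD).
Qed.

(* If no coordinate enlarges the sublevel set, the latter is stable under the remaining unit
   vectors and under [W], hence equal to [D]. *)
Lemma grow_step psi s (c1 del : R) t : generates_without d ->
  (forall v w, w \in W -> psi (v + w) = psi v) ->
  (forall v, v \in D -> psi v <= c1) -> 0 <= del ->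
  s \subset U -> (#|s| <= d)%N ->
  sublevel psi (c1 - eta ^+ t * del) != set0 ->
  sublevel psi (c1 - eta ^+ t * del) != D ->
  exists2 i, i \in U :\: s &
   (#|sublevel psi (c1 - eta ^+ t * del)| + #|W| <=
    #|sublevel (step i psi) (c1 - eta ^+ t.+1 * del)|)%N.
Proof.
move=> gen ipsi psi_le del0 sU sd Z0 ZD.
set Z := sublevel _ _ in Z0 ZD *.
case: (pickP (fun i => (i \in U :\: s) && (#|Z| + #|W| <=
    #|sublevel (step i psi) (c1 - eta ^+ t.+1 * del)|)%N)) => [i /andP[h1 h2]|noi].
  by exists i.
case/eqP: ZD; apply: (stable_full gen sU sd) => //.
- by apply/subsetP => v; rewrite inE => /andP[].
- exact: sublevel_inv.
move=> i a z iUs; have iU : i \in U by move: iUs; rewrite inE => /andP[].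
set Z' := sublevel (step i psi) (c1 - eta ^+ t.+1 * del) in noi.
have nZ' : ~~ (#|Z| + #|W| <= #|Z'|)%N by move: (noi i); rewrite iUs /= => ->.
have istep v w : w \in W -> step i psi (v + w) = step i psi v.
  by move=> wW; rewrite /step; apply: eq_bigr => b _; rewrite addrAC (ipsi _ w).
have iZ : invariant_by W Z by apply: sublevel_inv.
have iZ' : invariant_by W Z' by apply: sublevel_inv.
(* One heavy atom suffices: [psi] is at most [c1] at every shift and lower by [eta ^+ t * del] at
   this one, so the average is lower by at least [eta] times that. *)
have sub b v : eta <= mu i b -> v + b *: unitv i \in Z -> v \in Z'.
  move=> hb; rewrite !inE => /andP[vbD psivb].
  have vD : v \in D.
    by rewrite -(addrK (b *: unitv i) v) -scaleNr; apply: shift_in_D.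
  rewrite vD /= /step (bigD1 b) //=.
  have h1 : \sum_(j | j != b) mu i j * psi (v + j *: unitv i) <= (1 - mu i b) * c1.
    have -> : 1 - mu i b = \sum_(j | j != b) mu i j.
      by rewrite -(mu_sum1 i) (bigD1 b) //= addrAC subrr add0r.
    rewrite mulr_suml; apply: ler_sum => j _; apply: ler_wpM2l => //.
    by apply: psi_le; apply: shift_in_D.
  have h2 : mu i b * psi (v + b *: unitv i) <= mu i b * (c1 - eta ^+ t * del).
    exact: ler_wpM2l.
  have h3 : eta * (eta ^+ t * del) <= mu i b * (eta ^+ t * del).
    by apply: ler_wpM2r => //; apply: mulr_ge0 => //; apply/exprn_ge0/ltW/eta_gt0.
  rewrite exprS -mulrA; move: h1 h2 h3; rewrite !mulrBr !mulrBl mul1r; lra.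
(* Otherwise the translate [Y] of [Z] by [- b' *: unitv i] sits inside [Z'] and misses [v], so [Z']
   gains a whole coset of [W], which [nZ'] excludes. *)
have shift_sub b b' v : eta <= mu i b -> eta <= mu i b' ->
    v + b *: unitv i \in Z -> v + b' *: unitv i \in Z.
  move=> hb hb' vb; apply/negPn/negP => vb'.
  case/negP: nZ'.
  pose Y := [set z + (- b') *: unitv i | z in Z].
  have YP w : (w \in Y) = (w + b' *: unitv i \in Z).
    apply/imsetP/idP => [[y yZ ->]|h]; first by rewrite scaleNr subrK.
    by exists (w + b' *: unitv i) => //; rewrite scaleNr addrK.
  have -> : #|Z| = #|Y| by rewrite card_translate.
  apply: (@card_invariant_grow _ _ W Y Z' v) => //.
  - by move=> x w wW; rewrite !YP addrAC iZ.
  - by apply/subsetP => w; rewrite YP; apply: sub.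
  - exact: (sub b).
  - by rewrite YP.
(* The shifts along coordinate [i] preserving [Z] form a subgroup that contains all differences of
   heavy atoms, hence everything. *)
pose K := [set b : A | [forall y, (y + b *: unitv i \in Z) == (y \in Z)]].
have KP b : reflect (forall y, (y + b *: unitv i \in Z) = (y \in Z)) (b \in K).
  by rewrite inE; apply: (iffP forallP) => h y; [apply/eqP|apply/eqP]; apply: h.
have sK : additive_subgroup K.
  split; first by apply/KP => y; rewrite scale0r addr0.
  move=> b b' /KP hb /KP hb'; apply/KP => y.
  by rewrite scalerBl addrA -hb' subrK hb.
have : K = setT.
  apply: (@heavy_atoms_generate i K) => // b b' hb hb'; apply/KP => y.
  have yE : y = (y - b' *: unitv i) + b' *: unitv i by rewrite subrK.
  have yE' : y + (b - b') *: unitv i = (y - b' *: unitv i) + b *: unitv i.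
    by rewrite scalerBl addrAC addrA.
  rewrite yE' [in RHS]yE; apply/idP/idP; exact: shift_sub.
by move=> KT; have /KP-> : a \in K by rewrite KT inE.
Qed.

(** Start from the coset [g0 + W]. Each further coordinate adds a coset of [W] to the sublevel set
    unless that set is already [D]; the price is a factor [eta] in the depth of the level. *)
Lemma grow phi (c1 del : R) g0 : generates_without d ->
  (forall v w, w \in W -> phi (v + w) = phi v) ->
  (forall v, v \in D -> phi v <= c1) -> 0 <= del ->
  g0 \in D -> phi g0 <= c1 - del -> forall t, (t <= d)%N ->
  exists s, [/\ s \subset U, (#|s| <= t)%N &
    let Z := sublevel (emask s phi) (c1 - eta ^+ t * del) in
    Z = D \/ (t.+1 * #|W| <= #|Z|)%N].
Proof.
move=> gen iphi phi_le del0 g0D phig0; elim=> [|t IH] td.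
  exists set0; rewrite sub0set cards0; split=> //=; right.
  have -> : sublevel (emask set0 phi) (c1 - eta ^+ 0 * del) =
            sublevel phi (c1 - eta ^+ 0 * del).
    by apply/setP => v; rewrite !inE emask0.
  set Z := sublevel _ _.
  have := @card_invariant_grow _ _ W set0 Z g0 sW; rewrite cards0 mul1n; apply.
  - by move=> x w _; rewrite !inE.
  - exact: sublevel_inv.
  - exact: sub0set.
  - by rewrite !inE g0D expr0 mul1r.
  - by rewrite inE.
have [s [sU st]] := IH (ltnW td); set psi := emask s phi; set Z := sublevel _ _.
move=> /= hZ.
have ipsi v w : w \in W -> psi (v + w) = psi v by apply: emask_inv.
have psi_le v : v \in D -> psi v <= c1.
  move=> vD; apply: emask_le => x; apply: phi_le; apply: submodD => //.
  by apply: mask_submod => // i is_; apply: UD; apply: (subsetP sU).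
(* Once [Z = D] no coordinate is added: the new level is only higher, because [eta <= 1]. *)
have [ZD|ZD] := eqVneq Z D.
  exists s; split => //; first exact: leqW.
  left; apply/eqP; rewrite eqEsubset; apply/andP; split.
    by apply/subsetP => v; rewrite inE => /andP[].
  rewrite -{1}ZD; apply/subsetP => v; rewrite !inE => /andP[-> h] /=.
  apply: le_trans h _; rewrite lerD2l lerN2; apply: ler_wpM2r => //.
  by rewrite exprS ler_piMl ?eta_le1 //; apply/exprn_ge0/ltW/eta_gt0.
have hZ' : (t.+1 * #|W| <= #|Z|)%N by case: hZ => // hZ; rewrite hZ eqxx in ZD.
have Z0 : Z != set0.
  by rewrite -card_gt0; apply: leq_trans hZ'; rewrite muln_gt0 /= submod_gt0.
have [i iUs hi] := grow_step gen ipsi psi_le del0 sU (leq_trans st (ltnW td)) Z0 ZD.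
move: iUs; rewrite inE => /andP[is_ iU].
exists (i |: s); split.
- by apply/subUsetP; split=> //; rewrite sub1set.
- by rewrite cardsU1 is_.
right; rewrite mulSn addnC; apply: leq_trans (leq_add hZ' (leqnn _)) _.
apply: leq_trans hi _; apply/eq_leq; congr #|pred_of_set _|; apply/setP => v.
rewrite !inE; congr (_ && (_ <= _)); rewrite -emask1 // setUC.
rewrite setUC emaskU //; last by rewrite disjoints1.
Qed.

(** [D] consists of at most [d] cosets of [W], so after [d] coordinates the alternative with [d + 1]
    cosets is impossible and the averaged function lies below [phi g0 + del] by [eta ^+ d * del] on
    all of [D]. *)
Lemma block_contraction phi (c del : R) : generates_without d ->
  (forall v w, w \in W -> phi (v + w) = phi v) -> 0 <= del ->
  (forall v, v \in D -> c <= phi v <= c + del) ->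
  exists s, [/\ s \subset U, (#|s| <= d)%N & exists c', forall v, v \in D ->
    c' <= emask s phi v <= c' + (1 - eta ^+ d) * del].
Proof.
move=> gen iphi del0 hphi.
have D0 : (0 : V) \in D by apply: submod0.
have [g0 g0D g0min] := arg_minP phi D0.
have phi_le v : v \in D -> phi v <= phi g0 + del.
  move=> vD; have /andP[h1 _] := hphi _ g0D; have /andP[_ h2] := hphi _ vD.
  by move: h1 h2; lra.
have h0 : phi g0 <= (phi g0 + del) - del by rewrite addrK.
have [s [sU sd hZ]] := grow gen iphi phi_le del0 g0D h0 (leqnn d).
exists s; split=> //; exists (phi g0) => v vD.
have shD x : v + mask s x \in D.
  apply: submodD => //; apply: mask_submod => // i is_; apply: UD; exact: (subsetP sU).
apply/andP; split; first by apply: emask_ge => x; apply: g0min; apply: shD.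
have ZD : sublevel (emask s phi) (phi g0 + del - eta ^+ d * del) = D.
  case: hZ => //= hZ; exfalso.
  have : (d.+1 * #|W| <= d * #|W|)%N.
    apply: leq_trans hZ _; apply: leq_trans cardD; apply: subset_leq_card.
    by apply/subsetP => x; rewrite inE => /andP[].
  by rewrite leq_mul2r ltnn orbF -leqn0 leqNgt submod_gt0.
move: vD; rewrite -{1}ZD inE => /andP[_]; by rewrite mulrBl mul1r addrA.
Qed.

End Grow.

Lemma generates_without_setD W D (U s : {set 'I_n}) b b' : s \subset U -> (#|s| <= b)%N ->
  generates_without W D U (b + b') -> generates_without W D (U :\: s) b'.
Proof.
move=> sU sb gen t tU tb D' sD' WD' h; apply: (gen (s :|: t)) => //.
- by apply/subUsetP; split=> //; apply: subset_trans tU (subsetDl _ _).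
- by apply: leq_trans (leq_card_setU _ _) _; apply: leq_add.
- by move=> i hi; apply: h; move: hi; rewrite !inE negb_or => /andP[/andP[-> ->] ->].
Qed.

Lemma generates_withoutW W D (U : {set 'I_n}) b b' : (b' <= b)%N ->
  generates_without W D U b -> generates_without W D U b'.
Proof. by move=> bb gen s sU sb; apply: gen => //; apply: leq_trans bb. Qed.

Lemma mixing W D d j (U : {set 'I_n}) phi (c del : R) :
  submod W -> submod D -> W \subset D -> (#|D| <= d * #|W|)%N ->
  (forall i, i \in U -> unitv i \in D) -> generates_without W D U (j * d) ->
  (forall v w, w \in W -> phi (v + w) = phi v) -> 0 <= del ->
  (forall v, v \in D -> c <= phi v <= c + del) ->
  exists c', forall v, v \in D ->
    c' <= emask U phi v <= c' + (1 - eta ^+ d) ^+ j * del.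
Proof.
move=> sW sD WD cardD; elim: j U phi c del => [|j IH] U phi c del UD gen iphi del0 hphi.
  exists c => v vD; rewrite expr0 mul1r.
  have shD x : v + mask U x \in D by apply: submodD => //; apply: mask_submod.
  by apply/andP; split; [apply: emask_ge|apply: emask_le] => x;
     have /andP[] := hphi _ (shD x).
have gen1 : generates_without W D U d.
  by apply: generates_withoutW gen; rewrite mulSn leq_addr.
have [s [sU sd [c' hc']]] := block_contraction sW sD WD cardD UD gen1 iphi del0 hphi.
have del0' : 0 <= (1 - eta ^+ d) * del.
  by apply: mulr_ge0 => //; rewrite subr_ge0; apply: exprn_ile1; [apply/ltW/eta_gt0|apply: eta_le1].
have [] := IH (U :\: s) (emask s phi) c' _ _ _ _ del0' hc'.
- by move=> i; rewrite inE => /andP[_]; apply: UD.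
- by apply: generates_without_setD sU sd _; rewrite -mulSn.
- exact: emask_inv.
move=> c'' h; exists c'' => v vD; have := h v vD.
rewrite -emaskU; last first.
  by rewrite -setI_eq0; apply/eqP/setP => i; rewrite !inE; case: (i \in s); rewrite ?andbF.
have -> : U :\: s :|: s = U.
  apply/setP => i; rewrite !inE; have [/(subsetP sU)->|_] //= := boolP (i \in s).
  by rewrite orbF.
by rewrite exprSr -mulrA.
Qed.

Definition indic W v : R := (v \in W)%:R.

Lemma indic_inv W : submod W -> forall v w, w \in W -> indic W (v + w) = indic W v.
Proof. by move=> sW v w wW; rewrite /indic submodDr. Qed.

Lemma near_uniform W D d j (U : {set 'I_n}) :
  submod W -> submod D -> W \subset D -> (#|D| <= d * #|W|)%N ->
  (forall i, i \in U -> unitv i \in D) -> generates_without W D U (j * d) ->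
  forall v, v \in D ->
  `|emask U (indic W) v - #|W|%:R / #|D|%:R| <= (1 - eta ^+ d) ^+ j.
Proof.
move=> sW sD WD cardD UD gen.
have h01 v : v \in D -> 0 <= indic W v <= 0 + 1.
  by rewrite /indic add0r ler0n lern1 leq_b1.
have [c hc] := mixing sW sD WD cardD UD gen (indic_inv sW) ler01 h01.
have D0 : 0 < #|D|%:R :> R by rewrite ltr0n submod_gt0.
(* Averaging over [U] translates by elements of [D] only, so the mean over [D] is preserved exactly.
   With a small oscillation, this pins every value near [#|W| / #|D|]. *)
have avg : \sum_(v in D) emask U (indic W) v = #|W|%:R.
  rewrite exchange_big /=.
  under eq_bigr => x _ do rewrite -mulr_sumr.
  have h x : \sum_(v in D) indic W (v + mask U x) = #|W|%:R.
    rewrite (reindex_inj (addIr (- mask U x))) /=.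
    have mD : mask U x \in D by apply: mask_submod.
    under eq_bigl => v do rewrite submodDr ?submodN //.
    under eq_bigr => v _ do rewrite subrK /indic.
    rewrite -sumr_const big_mkcond [RHS]big_mkcond /=; apply: eq_bigr => v _.
    by case: ifP => [|/negP vD]; case: ifP => // /(subsetP WD).
  by under eq_bigr => x _ do rewrite h; rewrite -mulr_suml weight_sum1 mul1r.
have lo : c * #|D|%:R <= #|W|%:R.
  rewrite -avg mulr_natr -sumr_const; apply: ler_sum => v vD.
  by have /andP[] := hc v vD.
have hi : #|W|%:R <= (c + (1 - eta ^+ d) ^+ j) * #|D|%:R.
  rewrite -avg mulr_natr -sumr_const; apply: ler_sum => v vD.
  by have /andP[] := hc v vD; rewrite mulr1.
move=> v vD; have /andP[h1 h2] := hc v vD; rewrite mulr1 in h2.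
have l1 : c <= #|W|%:R / #|D|%:R by rewrite ler_pdivlMr.
have l2 : #|W|%:R / #|D|%:R <= c + (1 - eta ^+ d) ^+ j by rewrite ler_pdivrMr.
by rewrite ler_norml; apply/andP; split; move: l1 l2 h1 h2; lra.
Qed.

(* Pass to a smaller [D] as long as deleting [b] unit vectors loses [D]; the index of [W] in [D]
   drops each time. *)
Lemma depth_decomposition W B b : submod W -> (#|V| <= B * #|W|)%N ->
  exists s D, [/\ submod D, W \subset D, (#|s| <= B * b)%N,
    forall i, i \notin s -> unitv i \in D & generates_without W D (~: s) b].
Proof.
move=> sW cardV.
(* [m] bounds the number of cosets of [W] in [D]. It drops at each failure of robustness, so there
   are at most [B] rounds, each adding at most [b] indices to [s]. *)
suff H m s D : (#|D| <= m * #|W|)%N -> submod D -> W \subset D ->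
    (forall i, i \notin s -> unitv i \in D) ->
    exists s' D', [/\ submod D', W \subset D', (#|s'| <= #|s| + m * b)%N,
    forall i, i \notin s' -> unitv i \in D' & generates_without W D' (~: s') b].
  have [||//||s [D]] := H B set0 setT.
  - by rewrite cardsT.
  - exact: submodT.
  - by move=> *; rewrite inE.
  by rewrite cards0 add0n => h; exists s, D.
elim: m s D => [|m IH] s D cD sD WD hs.
  by move: cD; rewrite mul0n leqn0 => /eqP cD; have := submod_gt0 sD; rewrite cD.
have [gen|/existsNP[t]] := EM (generates_without W D (~: s) b).
  by exists s, D; split=> //; apply: leq_addr.
move/not_implyP => [ts] /not_implyP[tb] /existsNP[D'] /not_implyP[sD'].
move/not_implyP => [WD'] /not_implyP[hD'] /negP/subsetPn[z zD zD'].
have WI : W \subset D :&: D' by rewrite subsetI WD.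
have [||||s' [D'' [h1 h2 h3 h4 h5]]] := IH (s :|: t) (D :&: D').
- rewrite -(leq_add2r #|W|) -mulSnr; apply: leq_trans cD.
  apply: (card_invariant_grow sW _ _ _ zD) => //; last by rewrite inE (negbTE zD') andbF.
  + by move=> x w wW; rewrite submodDr //; [apply: submodI|apply: (subsetP WI)].
  + by move=> x w wW; rewrite submodDr //; apply: (subsetP WD).
  + exact: subsetIl.
- exact: submodI.
- exact: WI.
- move=> i; rewrite !inE negb_or => /andP[is_ it]; rewrite hs //=.
  by apply: hD'; rewrite !inE is_ it.
exists s', D''; split=> //; apply: leq_trans h3 _.
rewrite mulSn addnA leq_add2r; apply: leq_trans (leq_card_setU _ _) _.
by rewrite leq_add2l.
Qed.

Lemma exists_unitv_notin D : submod D -> D != setT -> exists i, unitv i \notin D.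
Proof.
move=> sD nD; apply/existsP; rewrite -[X in is_true X]negbK negb_exists.
apply: contra nD => /forallP h; apply/eqP/setP => v; rewrite inE -(maskT v).
by apply: mask_submod => // i _; have := h i; rewrite negbK.
Qed.

Section ColumnEstimate.
Variables (W D : {set V}) (s : {set 'I_n}) (B j : nat).
Hypotheses (sW : submod W) (sD : submod D) (WD : W \subset D).
Hypothesis cardV : (#|V| <= B * #|W|)%N.
Hypothesis hs : forall i, i \notin s -> unitv i \in D.
Hypothesis gen : generates_without W D (~: s) (j * B).

Let estimate v : v \in D ->
  `|emask (~: s) (indic W) v - #|W|%:R / #|D|%:R| <= (1 - eta ^+ B) ^+ j.
Proof.
apply: near_uniform => //; last by move=> i; rewrite inE; apply: hs.
by apply: leq_trans cardV; apply: subset_leq_card; apply/subsetP.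
Qed.

(** Conditionally on the coordinates in [s], the others already equidistribute: the estimate holds
    from any starting point of [D]. *)
Lemma column_estimate_full : D = setT ->
  `|emask setT (indic W) 0 - #|W|%:R / #|V|%:R| <= (1 - eta ^+ B) ^+ j.
Proof.
move=> DT; rewrite -(setUCr s) emaskU; last by rewrite -setI_eq0 setICr.
have h v : `|emask (~: s) (indic W) v - #|W|%:R / #|V|%:R| <= (1 - eta ^+ B) ^+ j.
  by have := @estimate v; rewrite DT cardsT inE; apply.
rewrite ler_norml; apply/andP; split.
  rewrite lerBrDr; apply: emask_ge => x; rewrite -lerBrDr.
  by have := h (0 + mask s x); rewrite ler_norml => /andP[].
rewrite lerBlDr; apply: emask_le => x; rewrite -lerBlDr.
by have := h (0 + mask s x); rewrite ler_norml => /andP[].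
Qed.

(** The unit vectors outside [s] belong to [D], so landing in [W] forces the part supported on [s]
    into [D]. Some [unitv i] with [i] in [s] is not in [D]; given the other coordinates, the [i]-th
    is then confined to a coset of a proper subgroup, whence the factor [1 - eps]. *)
Lemma column_estimate_proper : D <> setT ->
  emask setT (indic W) 0 <=
  (1 - eps) * (#|W|%:R / #|D|%:R + (1 - eta ^+ B) ^+ j).
Proof.
move=> /eqP DT; have [i iD] := exists_unitv_notin sD DT.
rewrite -(setUCr s) emaskU; last by rewrite -setI_eq0 setICr.
have is_ : i \in s by apply: contraNT iD; apply: hs.
set C := _ + _ ^+ j.
have C0 : 0 <= C.
  rewrite /C addr_ge0 ?divr_ge0 // exprn_ge0 // subr_ge0.
  by apply: exprn_ile1; [apply/ltW/eta_gt0|apply: eta_le1].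
have le1 v : emask (~: s) (indic W) v <= C * indic D v.
  rewrite /indic; have [vD|vD] /= := boolP (v \in D).
    by rewrite mulr1; have := estimate vD; rewrite ler_norml => /andP[_]; rewrite lerBlDl.
  rewrite mulr0; apply: emask_le => x; rewrite /indic; case: (boolP (_ \in W)) => //.
  move/(subsetP WD); rewrite submodDr ?(negbTE vD) //.
  by apply: mask_submod => // k; rewrite inE; apply: hs.
apply: (@le_trans _ _ (C * emask s (indic D) 0)).
  rewrite /emask mulr_sumr; apply: ler_sum => x _; rewrite mulrCA.
  by apply: ler_wpM2l (le1 _); apply: weight_ge0.
rewrite mulrC; apply: ler_wpM2r => //.
rewrite -(setD1K is_) emask_setU1 ?setD11 //; apply: emask_le => x.
set v := 0 + _; rewrite /step.
pose K := [set a : A | a *: unitv i \in D].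
have sK : additive_subgroup K.
  split; first by rewrite inE scale0r submod0.
  by move=> a b; rewrite !inE scalerBl; apply: submodB.
have nK : K != setT.
  by apply: contraNneq iD => /setP/(_ 1); rewrite !inE scale1r => ->.
case: (pickP (fun a : A => v + a *: unitv i \in D)) => [a0 ha0|no]; last first.
  rewrite big1; first by move: eps_le; lra.
  by move=> a _; rewrite /indic no mulr0.
have <- : \sum_(x : A | x - a0 \in K) mu i x = \sum_a mu i a * indic D (v + a *: unitv i).
  rewrite big_mkcond /=; apply: eq_bigr => a _; rewrite inE /indic.
  have -> : v + a *: unitv i = (a - a0) *: unitv i + (v + a0 *: unitv i).
    by rewrite scalerBl addrCA subrK.
  by rewrite submodDr //; case: ifP; rewrite ?mulr1 ?mulr0.
exact: mu_bal.
Qed.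

End ColumnEstimate.
End Mixing.

(** * Elementary estimates *)

Section PowerBounds.
Variable R : archiRealFieldType.

Lemma bernoulli_ge (c : R) n : 0 <= c -> 1 + n%:R * c <= (1 + c) ^+ n.
Proof.
move=> c0; elim: n => [|n IH]; first by rewrite mul0r addr0 expr0.
rewrite exprS; have : (1 + c) * (1 + n%:R * c) <= (1 + c) * (1 + c) ^+ n.
  by apply: ler_wpM2l => //; lra.
apply: le_trans; rewrite -natr1.
have : 0 <= n%:R * c * c by rewrite !mulr_ge0.
nra.
Qed.

Lemma bernoulli_inv (z : R) n : 0 < z -> z <= 1 -> z ^+ n <= (1 + n%:R * (z^-1 - 1))^-1.
Proof.
move=> z0 z1; have c0 : 0 <= z^-1 - 1 by rewrite subr_ge0 invf_ge1.
have := bernoulli_ge n c0; rewrite (addrC 1 (z^-1 - 1)) subrK exprVn => h.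
rewrite -[leLHS]invrK lef_pV2 // posrE ?invr_gt0 ?exprn_gt0 //.
by apply: ltr_wpDr => //; apply: mulr_ge0.
Qed.

Lemma geometric_small (z e : R) : 0 <= z -> z < 1 -> 0 < e ->
  exists n0, forall n, (n0 <= n)%N -> z ^+ n <= e.
Proof.
move=> z0 z1 e0; have [z00|zn0] := eqVneq z 0.
  exists 1%N => n n1; rewrite z00 expr0n; move: n1; case: n => //= n _; exact: ltW.
have zp : 0 < z by rewrite lt_def zn0.
set c := z^-1 - 1; have cp : 0 < c by rewrite subr_gt0 invf_gt1.
exists (Num.Def.archi_bound (e^-1 / c)) => n hn.
apply: le_trans (bernoulli_inv n zp (ltW z1)) _; rewrite -[leRHS]invrK -/c.
rewrite lef_pV2 ?posrE ?invr_gt0 //; last by apply: ltr_pwDl => //; rewrite mulr_ge0 // ltW.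
have h : e^-1 / c < n%:R.
  apply: lt_le_trans (archi_boundP _) _; first by apply: divr_ge0; [rewrite invr_ge0|]; apply: ltW.
  by rewrite ler_nat.
by move: h; rewrite ltr_pdivrMr // => /ltW h; lra.
Qed.

Lemma pow1D_le (t : R) n : 0 <= t -> n%:R * t <= 1 / 2 ->
  (1 + t) ^+ n <= 1 + 2 * (n%:R * t).
Proof.
move=> t0 hn; set y := n%:R * t in hn *.
have y0 : 0 <= y by apply: mulr_ge0.
(* Bernoulli for the inverse; then [(1 - y) * (1 + 2 * y) >= 1] since [y <= 1 / 2]. *)
have h : (1 + t) ^+ n * (1 - y) <= 1.
  rewrite /y; clear hn y y0; elim: n => [|n IH]; first by rewrite expr0 mul0r subr0 mulr1.
  apply: le_trans IH; rewrite exprSr -mulrA; apply: ler_wpM2l.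
    by apply: exprn_ge0; lra.
  rewrite -natr1; have : 0 <= n%:R * t * t by rewrite !mulr_ge0.
  nra.
have P0 : 0 <= (1 + t) ^+ n by apply: exprn_ge0; lra.
have : (1 + t) ^+ n * (1 - y) * (1 + 2 * y) <= 1 * (1 + 2 * y) by apply: ler_wpM2r => //; lra.
have : (1 + t) ^+ n * 1 <= (1 + t) ^+ n * ((1 - y) * (1 + 2 * y)) by apply: ler_wpM2l => //; nra.
lra.
Qed.

(* The exponent [2 * (n %/ h)] is split so that one factor absorbs the linear term. *)
Lemma linear_geometric_small (z e : R) (h u : nat) : 0 < z -> z < 1 -> 0 < e -> (0 < h)%N ->
  exists n0, forall n, (n0 <= n)%N -> (n + u)%:R * z ^+ (2 * (n %/ h)) <= e.
Proof.
move=> z0 z1 e0 h0; have [c cE] : exists c, c = z^-1 - 1 by exists (z^-1 - 1).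
have cp : 0 < c by rewrite cE subr_gt0 invf_gt1.
set K : R := (h + u)%:R + h%:R / c.
have K0 : 0 < K by apply: ltr_pwDl; [rewrite ltr0n addn_gt0 h0|apply: divr_ge0 => //; apply: ltW].
have [i0 hi0] := geometric_small (ltW z0) z1 (divr_gt0 e0 K0).
exists (i0 * h)%N => n hn; set i := (n %/ h)%N.
have ii : (i0 <= i)%N by rewrite leq_divRL.
have hni : (n + u)%:R <= K * (1 + i%:R * c).
  apply: (@le_trans _ _ ((h * i.+1 + u)%:R)).
    by rewrite ler_nat leq_add2r mulnC ltnW // ltn_ceil.
  rewrite /K natrD natrM -natr1 natrD.
  have -> : (h%:R + u%:R + h%:R / c) * (1 + i%:R * c) =
     h%:R + u%:R + h%:R / c + (h%:R + u%:R) * (i%:R * c) + h%:R * i%:R.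
    by field; exact: lt0r_neq0.
  have : 0 <= (h%:R + u%:R) * (i%:R * c) by rewrite !mulr_ge0 ?addr_ge0 ?ler0n ?ltW.
  have : 0 <= h%:R / c by rewrite divr_ge0 ?ler0n ?ltW.
  by lra.
rewrite mul2n -addnn exprD mulrA.
have hz : (n + u)%:R * z ^+ i <= K.
  have pos : 0 < 1 + i%:R * c by apply: ltr_pwDl => //; apply: mulr_ge0 => //; apply: ltW.
  apply: le_trans (_ : K * (1 + i%:R * c) * (1 + i%:R * c)^-1 <= _); last first.
    by rewrite mulfK // lt0r_neq0.
  apply: ler_pM => //; first exact/exprn_ge0/ltW.
  by rewrite cE; apply: bernoulli_inv => //; apply: ltW.
apply: (@le_trans _ _ (K * z ^+ i)); first by apply: ler_wpM2r => //; apply/exprn_ge0/ltW.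
by have := hi0 i ii; rewrite ler_pdivlMr // mulrC.
Qed.

Lemma prod_perturb_le I (r : seq I) (a b rho : I -> R) :
  (forall i, `|a i - b i| <= rho i) -> (forall i, 0 <= b i) ->
  `|\prod_(i <- r) a i - \prod_(i <- r) b i| <=
  \prod_(i <- r) (b i + rho i) - \prod_(i <- r) b i.
Proof.
move=> h b0; have rho0 i : 0 <= rho i by apply: le_trans (h i).
have a_le i : `|a i| <= b i + rho i.
  have := h i; rewrite -{2}(ger0_norm (b0 i)) -lerBlDl; apply: le_trans.
  exact: lerB_dist.
elim: r => [|i r IH]; first by rewrite !big_nil subrr normr0.
rewrite !big_cons; set PA := \prod_(j <- r) a j in IH *; set PB := \prod_(j <- r) b j in IH *.
set PR := \prod_(j <- r) (b j + rho j) in IH *.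
have PB0 : 0 <= PB by apply: prodr_ge0.
have -> : a i * PA - b i * PB = a i * (PA - PB) + (a i - b i) * PB by ring.
apply: le_trans (ler_normD _ _) _; rewrite !normrM (ger0_norm PB0).
have h1 : `|a i| * `|PA - PB| <= (b i + rho i) * (PR - PB) by apply: ler_pM.
have h2 : `|a i - b i| * PB <= rho i * PB by apply: ler_wpM2r.
by lra.
Qed.

End PowerBounds.

(** * Cosets and indices of submodules *)

Section Index.
Variables (A : comNzRingType) (E : finLmodType A).
Implicit Types W D : {set E}.

(** The choice is made from the whole coset and so depends on the coset only. The default is never
    reached, since [v] itself qualifies. *)
Definition coset_rep W v : E := odflt 0 [pick y | y - v \in W].

Lemma coset_repP W v : submod W -> coset_rep W v - v \in W.
Proof.
move=> sW; rewrite /coset_rep; case: pickP => //= /(_ v).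
by rewrite subrr submod0.
Qed.

Lemma eq_coset_rep W v v' : submod W -> (coset_rep W v == coset_rep W v') = (v - v' \in W).
Proof.
move=> sW; apply/eqP/idP => [h|h].
  have -> : v - v' = (coset_rep W v' - v') - (coset_rep W v - v).
    by rewrite h opprB [RHS]addrC addrA subrK.
  by apply: submodB => //; apply: coset_repP.
rewrite /coset_rep; congr odflt; apply: eq_pick => y.
have -> : y - v' = (y - v) + (v - v') by rewrite addrA subrK.
by rewrite /= [RHS]submodDr.
Qed.

Definition idx W D := #|coset_rep W @: D|.

Lemma card_idx W D : submod W -> submod D -> W \subset D -> (idx W D * #|W|)%N = #|D|.
Proof.
move=> sW sD WD; rewrite /idx -cardsX.
have repD v : v \in D -> coset_rep W v \in D.
  by move=> vD; rewrite -(submodDr _ sD (submodN sD vD)); apply/(subsetP WD)/coset_repP.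
have inj : {in setX (coset_rep W @: D) W &, injective (fun p : E * E => p.1 - p.2)}.
  move=> [r w] [r' w']; rewrite !inE /= => /andP[/imsetP[v vD ->] wW] /andP[/imsetP[v' _ ->] w'W] h.
  suff hr : coset_rep W v = coset_rep W v'.
    by move: h; rewrite hr => /addrI/oppr_inj ->.
  apply/eqP; rewrite eq_coset_rep //.
  rewrite -(subrKA (coset_rep W v)) -(subrKA (coset_rep W v') (coset_rep W v)).
  have -> : coset_rep W v - coset_rep W v' = w - w'.
    by apply/eqP; rewrite subr_eq -[eqbLHS](subrK w) h addrC addrCA addrC.
  have hN u : u - coset_rep W u \in W by rewrite -opprB submodN ?coset_repP.
  apply: submodD => //; apply: submodD => //; last exact: coset_repP.
  exact: submodB.
rewrite -(card_in_imset inj); apply: eq_card => x; apply/imsetP/idP => [[[r w]]|xD].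
  rewrite inE /= => /andP[/imsetP[v vD ->] wW] ->.
  by apply: submodB => //; [apply: repD|apply: (subsetP WD)].
exists (coset_rep W x, coset_rep W x - x); last by rewrite /= subKr.
by rewrite inE /= coset_repP // andbT; apply/imsetP; exists x.
Qed.

Lemma idx_gt0 W D : submod D -> (0 < idx W D)%N.
Proof.
by move=> sD; apply/card_gt0P; exists (coset_rep W 0); apply/imsetP; exists 0; rewrite ?submod0.
Qed.

Lemma idx_le W D B : submod W -> submod D -> W \subset D ->
  (#|D| <= B * #|W|)%N = (idx W D <= B)%N.
Proof. by move=> sW sD WD; rewrite -(card_idx sW sD WD) leq_pmul2r ?submod_gt0. Qed.

(** Representatives of the cosets inside [D] are listed first and receive the codes below [idx W D].
    This order lets the later count see the index of [W] in [D] instead of [B]. *)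
Lemma coset_numbering W D B : submod W -> submod D -> W \subset D ->
  (#|E| <= B * #|W|)%N ->
  exists c : E -> 'I_B, (forall v v', (c v == c v') = (v - v' \in W)) /\
    (forall v, v \in D -> (c v < idx W D)%N).
Proof.
move=> sW sD WD cE.
pose X := coset_rep W @: setT; pose Y := coset_rep W @: D.
pose l := enum Y ++ enum (X :\: Y).
have lX v : coset_rep W v \in l.
  rewrite mem_cat !mem_enum inE; case: (_ \in Y) => //=.
  by apply/imsetP; exists v; rewrite ?inE.
have szl : (size l <= B)%N.
  have sT := submodT E.
  apply: (@leq_trans #|X|); last first.
    by rewrite -[#|X|]/(idx W setT) -idx_le ?subsetT // cardsT.
  rewrite size_cat -!cardE -(cardsID Y X) leq_add2r; apply: subset_leq_card.
  by rewrite subsetI subxx andbT; apply: imsetS; apply: subsetT.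
have hc v : (index (coset_rep W v) l < B)%N by apply: leq_trans szl; rewrite index_mem.
exists (fun v => Ordinal (hc v)); split=> [v v'|v vD].
  rewrite -val_eqE /= -eq_coset_rep //; apply/eqP/eqP => [h|->] //.
  by rewrite -(nth_index 0 (lX v)) h nth_index.
have vY : coset_rep W v \in enum Y by rewrite mem_enum; apply: imset_f.
by rewrite /= index_cat vY /idx cardE index_mem.
Qed.

End Index.

(** * Columns in submodules of bounded index *)

Section Counting.
Variables (A : finComNzRingType) (n B : nat).
Local Notation V := ('cV[A]_n).

Definition small_index (W : {set V}) : bool := `[< submod W >] && (#|V| <= B * #|W|)%N.

(** [d] is the index of [W] in [D], not in the whole space. It governs both the number of such [W],
    roughly [d ^ n], and the chance that a column falls into [W], roughly [1 / d] or less. *)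
Definition shallow (s : {set 'I_n}) (d : nat) (W : {set V}) : Prop :=
  exists D, [/\ submod D, W \subset D, idx W D = d & forall i, i \notin s -> unitv A i \in D].

(* A submodule is recovered from the classes of the unit vectors, coded by ['I_B], and the set of
   linear relations between these classes. *)
Definition decode (p : {ffun 'I_n -> 'I_B} * {set {ffun 'I_B -> A}}) : {set V} :=
  [set v : V | [ffun k => \sum_(i | p.1 i == k) v i 0] \in p.2].

Lemma card_bounded_ffun (s : {set 'I_n}) d :
  (#|[set j : {ffun 'I_n -> 'I_B} | [forall i, (i \notin s) ==> (j i < d)%N]]| <=
   B ^ #|s| * d ^ (n - #|s|))%N.
Proof.
pose F (i : 'I_n) : pred 'I_B := fun k => (i \in s) || (k < d)%N.
have -> : #|[set j : {ffun 'I_n -> 'I_B} | [forall i, (i \notin s) ==> (j i < d)%N]]| =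
   #|family F|.
  have FE i k : (k \in F i) = (i \in s) || (k < d)%N by [].
  apply: eq_card => j; rewrite inE; apply/forallP/familyP => h i; have := h i;
    by rewrite FE; case: (i \in s).
rewrite card_family foldrE big_image /= (bigID (mem s)) /=.
apply: leq_mul.
  apply: (@leq_trans (\prod_(i in s) B)%N); last by rewrite prod_nat_const.
  by apply: leq_prod => i _; apply: leq_trans (max_card _) _; rewrite card_ord.
apply: (@leq_trans (\prod_(i in ~: s) d)%N); last first.
  by rewrite prod_nat_const cardsCs setCK card_ord.
under [X in (_ <= X)%N]eq_bigl => i do rewrite in_setC.
apply: leq_prod => i is_; rewrite /F (negbTE is_) /=.
have inj : {in (fun k : 'I_B => (k < d)%N) &, injective (@nat_of_ord B)}.
  by move=> x y _ _; apply: val_inj.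
rewrite -[X in (_ <= X)%N](size_iota 0) cardE -(size_map (@nat_of_ord B)).
apply: uniq_leq_size; first by rewrite map_inj_uniq ?enum_uniq //; apply: val_inj.
by move=> x /mapP[k]; rewrite mem_enum unfold_in => kd ->; rewrite mem_iota.
Qed.

(** Outside [s] the unit vectors have their classes in [D / W], hence [d] possible codes; on [s]
    there are [B]. The first factor counts the sets of relations. *)
Lemma card_shallow (s : {set 'I_n}) d :
  (#|[set W : {set V} | small_index W && `[< shallow s d W >]]| <=
   2 ^ (#|A| ^ B) * (B ^ #|s| * d ^ (n - #|s|)))%N.
Proof.
set J := [set j : {ffun 'I_n -> 'I_B} | [forall i, (i \notin s) ==> (j i < d)%N]].
apply: (@leq_trans #|decode @: setX J setT|).
  apply: subset_leq_card; apply/subsetP => W; rewrite inE /small_index.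
  move=> /andP[/andP[/asboolP sW cW] /asboolP[D [sD WD dE hD]]].
  have [c [c1 c2]] := coset_numbering sW sD WD cW.
  pose rep (k : 'I_B) : V := odflt 0 [pick v | c v == k].
  have repP v : rep (c v) - v \in W.
    rewrite -c1 /rep; case: pickP => [y /eqP -> //|/(_ v)]; by rewrite eqxx.
  pose j := [ffun i => c (unitv A i)].
  pose Q : {set {ffun 'I_B -> A}} := [set a : {ffun 'I_B -> A} | \sum_k a k *: rep k \in W].
  apply/imsetP; exists (j, Q).
    rewrite !inE andbT; apply/forallP => i; apply/implyP => is_.
    by rewrite ffunE -dE; apply: c2; apply: hD.
  apply/setP => v; rewrite !inE /=.
  (* Grouping the coordinates of [v] by the class of their unit vector yields a combination of
     representatives congruent to [v] modulo [W]. *)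
  have -> : \sum_k [ffun k => \sum_(i | j i == k) v i 0] k *: rep k =
    \sum_i v i 0 *: rep (c (unitv A i)).
    under eq_bigr => k _ do rewrite ffunE scaler_suml.
    rewrite (exchange_big_dep xpredT) //=; apply: eq_bigr => i _.
    by rewrite (big_pred1 (c (unitv A i))) // => k; rewrite ffunE /= eq_sym.
  rewrite -{1}(maskT v) mask_sum.
  have -> : \sum_i v i 0 *: rep (c (unitv A i)) =
     \sum_i v i 0 *: (rep (c (unitv A i)) - unitv A i) + \sum_(i in setT) v i 0 *: unitv A i.
    under [X in _ + X]eq_bigl => i do rewrite inE.
    by rewrite -big_split /=; apply: eq_bigr => i _; rewrite -scalerDr subrK.
  by rewrite submodDl //; apply: submod_sum => // i _; apply: submodZ.
apply: leq_trans (leq_imset_card _ _) _; rewrite cardsX mulnC.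
apply: leq_mul; last exact: card_bounded_ffun.
by rewrite -powersetT card_powerset cardsT card_ffun card_ord.
Qed.

End Counting.

(** * Total gap between balanced and uniform column probabilities *)

Section Moments.
Variables (R : archiRealFieldType) (A : finComNzRingType).

Definition balanced_pmf (eps : R) (mu : A -> R) : Prop :=
  [/\ forall a, 0 <= mu a, \sum_a mu a = 1 &
   forall (K : {set A}) a, additive_subgroup K -> K != setT ->
     \sum_(x : A | x - a \in K) mu x <= 1 - eps].

Definition prob_cols n m (mu : 'I_n -> 'I_m -> A -> R) (W : {set 'cV[A]_n}) : R :=
  \prod_(c < m) emask (fun i => mu i c) setT (indic R W) 0.

(** Chernoff's device: [x ^+ #|s| >= x ^+ b] on the counted sets, and [x ^+ #|s|] sums to
    [(1 + x) ^+ n] over all sets. With [x = eps], this growth is beaten by the gain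
    [(1 - eps) ^+ n]. *)
Lemma card_small_sets (n b : nat) (x : R) : 0 < x -> x <= 1 ->
  #|[set s : {set 'I_n} | (#|s| <= b)%N]|%:R <= x^-1 ^+ b * (1 + x) ^+ n.
Proof.
move=> x0 x1.

have h : \sum_(s : {set 'I_n}) x ^+ #|s| = (1 + x) ^+ n.
  have -> : (1 + x) ^+ n = \prod_(i < n) (x + 1) by rewrite prodr_const card_ord addrC.
  rewrite bigA_distr; apply: eq_bigr => s _.
  by rewrite -big_mkcond /= prodr_const.
rewrite -h mulr_sumr -sum1_card natr_sum big_mkcond /=.
apply: ler_sum => s _; rewrite inE; have px k : 0 < x ^+ k by apply: exprn_gt0.
case: ifP => [sb|_]; last by apply/ltW/mulr_gt0 => //; rewrite exprVn invr_gt0.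
rewrite exprVn mulrC ler_pdivlMr // mul1r; exact: ler_wiXn2l (ltW x0) x1 _ _ sb.
Qed.

Section Estimate.
Variables (n m B j : nat) (eps : R) (mu : 'I_n -> 'I_m -> A -> R).
Hypotheses (eps0 : 0 < eps) (eps1 : eps <= 1 / 2).
Hypothesis mu_bal : forall i c, balanced_pmf eps (mu i c).
Local Notation V := ('cV[A]_n).

Definition mixrate : R := 1 - (eps / (2 * #|A|%:R)) ^+ B.
Let del : R := mixrate ^+ j.

Lemma mixrate_ge0 : 0 <= mixrate.
Proof.
rewrite subr_ge0; apply: exprn_ile1; [exact/ltW/eta_gt0|exact: eta_le1].
Qed.

Lemma prob_cols_ge0 W : 0 <= prob_cols mu W.
Proof.
apply: prodr_ge0 => c _; apply: sumr_ge0 => x _; apply: mulr_ge0; last by rewrite /indic.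
by apply: weight_ge0 => i a; have [] := mu_bal i c.
Qed.

(** The cases are [D = setT], with a small relative error per column, and [D] proper, where both
    probabilities are below the same small bound. An index between 1 and [B] is written [g.+1] with
    [g : 'I_B]. *)
Lemma moment_term_bound (W : {set V}) : small_index B W ->
  (exists g : 'I_B, shallow set0 g.+1 W /\
     `|prob_cols mu W - (#|W|%:R / #|V|%:R) ^+ m| <=
     g.+1%:R^-1 ^+ m * ((1 + B%:R * del) ^+ m - 1)) \/
  (exists (s : {set 'I_n}) (d : 'I_B), [/\ (#|s| <= B * (j * B))%N, shallow s d.+1 W &
     `|prob_cols mu W - (#|W|%:R / #|V|%:R) ^+ m| <=
     ((1 - eps) * (d.+1%:R^-1 * (1 + B%:R * del))) ^+ m]).
Proof.
move=> /andP[/asboolP sW cW].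
have del0 : 0 <= del by apply/exprn_ge0/mixrate_ge0.
have [s [D [sD WD ss hD gen]]] := depth_decomposition (j * B) sW cW.
have sT := submodT V.
have idxE D' : submod D' -> W \subset D' -> #|W|%:R / #|D'|%:R = (idx W D')%:R^-1 :> R.
  move=> sD' WD'; rewrite -(card_idx sW sD' WD') natrM invfM mulrCA divff ?mulr1 //.
  by rewrite pnatr_eq0 -lt0n submod_gt0.
have small D' : submod D' -> W \subset D' -> (idx W D' <= B)%N.
  move=> sD' WD'; rewrite -(idx_le B sW sD' WD'); apply: leq_trans cW.
  exact: max_card.
have mE c : [/\ forall i a, 0 <= mu i c a, forall i, \sum_a mu i c a = 1 &
   forall i (K : {set A}) a, additive_subgroup K -> K != setT ->
     \sum_(x : A | x - a \in K) mu i c x <= 1 - eps].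
  by split=> i; have [] := mu_bal i c.
have [DT|DT] := pselect (D = setT).
  left; have g0 := idx_gt0 W sT; have gB := small setT sT (subsetT _).
  have gE : (idx W [set: V]).-1.+1 = idx W setT by rewrite prednK.
  have gB' : ((idx W [set: V]).-1 < B)%N by rewrite gE.
  exists (Ordinal gB') => /=; rewrite gE; split.
    by exists setT; split=> // i _; rewrite inE.
  have := idxE setT sT (subsetT _); rewrite cardsT; set x := (idx _ _)%:R^-1 => xE.
  rewrite xE.
  have x0 : 0 <= x by rewrite invr_ge0.
  have -> : x ^+ m = \prod_(c < m) x by rewrite prodr_const card_ord.
  apply: le_trans (prod_perturb_le _ (rho := fun=> del) _ _) _ => // [c|].
    have [m1 m2 m3] := mE c.
    have := column_estimate_full m1 m2 eps0 eps1 m3 sW sD WD cW hD gen DT.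
    by rewrite xE.
  rewrite !prodr_const card_ord mulrBr mulr1 lerB // -exprMn.
  apply: lerXn2r; rewrite ?nnegrE ?addr_ge0 ?mulr_ge0 ?addr_ge0 ?mulr_ge0 //.
  rewrite mulrDr mulr1 lerD2l mulrA; apply: ler_peMl => //.
  by rewrite mulrC /x ler_pdivlMr ?mul1r ?ltr0n // ler_nat.
right; exists s.
have d0 := idx_gt0 W sD; have dB := small D sD WD.
have dE : (idx W D).-1.+1 = idx W D by rewrite prednK.
have dB' : ((idx W D).-1 < B)%N by rewrite dE.
exists (Ordinal dB'); rewrite /= dE; split => //; first by exists D.
set x := (idx W D)%:R^-1; have x0 : 0 <= x by rewrite invr_ge0.
have Bx : 1 <= B%:R * x by rewrite /x ler_pdivlMr ?mul1r ?ltr0n // ler_nat.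
have e1 : 0 <= 1 - eps by move: eps1; lra.
have C0 : 0 <= (1 - eps) * (x * (1 + B%:R * del)).
  by apply: mulr_ge0 => //; apply: mulr_ge0 => //; apply: addr_ge0 => //; apply: mulr_ge0.
have h1 : prob_cols mu W <= ((1 - eps) * (x * (1 + B%:R * del))) ^+ m.
  rewrite -[X in _ ^+ X]card_ord -prodr_const; apply: ler_prod => c _.
  have [m1 m2 m3] := mE c; apply/andP; split.
    apply: sumr_ge0 => y _; apply: mulr_ge0; last by rewrite /indic.
    exact: weight_ge0.
  apply: le_trans (column_estimate_proper m1 m2 eps0 eps1 m3 sW sD WD cW hD gen DT) _.
  rewrite idxE // -/x; apply: ler_wpM2l => //; rewrite mulrDr mulr1 lerD2l mulrA.
  by rewrite [x * _]mulrC; apply: ler_peMl.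
(* For the uniform law a proper [D] costs a factor 2, and [1 / 2 <= 1 - eps]. *)
have h2 : (#|W|%:R / #|V|%:R) ^+ m <= ((1 - eps) * (x * (1 + B%:R * del))) ^+ m.
  apply: lerXn2r; rewrite ?nnegrE ?divr_ge0 //.
  have hprop : D \proper setT by rewrite properT; apply/eqP.
  have := submod_proper_double sD sT hprop; rewrite cardsT => hDV.
  apply: (@le_trans _ _ (2^-1 * x)).
    rewrite /x -idxE // mulrCA ler_wpM2l // -invfM lef_pV2 ?posrE.
    - by rewrite -natrM ler_nat.
    - by rewrite ltr0n -cardsT submod_gt0.
    - by rewrite mulr_gt0 // ltr0n submod_gt0.
  apply: ler_pM; rewrite ?invr_ge0 //; first by move: eps1; lra.
  by rewrite -{1}[x]mulr1 ler_wpM2l // lerDl mulr_ge0.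
rewrite ler_norml; apply/andP; split; last first.
  have : 0 <= (#|W|%:R / #|V|%:R) ^+ m :> R by rewrite exprn_ge0 ?divr_ge0.
  by move: h1; lra.
by have := prob_cols_ge0 W; move: h2; lra.
Qed.

(** The count [d ^ n] of the [W] cancels against the column probabilities [d ^ -m]. In the second
    case there remain [(1 - eps) ^+ n], the codes [B ^ #|s|] and the number of sets [s]; the last
    contributes [(1 + eps) ^+ n] and a power of [1 / eps], hence the factor
    [(1 - eps ^+ 2) ^+ n]. *)
Lemma moment_sum_bound : (n <= m)%N ->
  \sum_(W : {set V} | small_index B W) `|prob_cols mu W - (#|W|%:R / #|V|%:R) ^+ m| <=
  (2 ^ (#|A| ^ B))%:R * B%:R * (((1 + B%:R * del) ^+ m - 1) +
    ((B%:R / eps) ^+ (B * B)) ^+ j * (1 - eps ^+ 2) ^+ n * (1 + B%:R * del) ^+ m).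
Proof.
move=> nm; set C : R := (2 ^ _)%:R.
set al := fun g : 'I_B => g.+1%:R^-1 ^+ m * ((1 + B%:R * del) ^+ m - 1).
set be := fun d : 'I_B => ((1 - eps) * (d.+1%:R^-1 * (1 + B%:R * del))) ^+ m.
have del0 : 0 <= del by apply/exprn_ge0/mixrate_ge0.
have D1 : 1 <= 1 + B%:R * del by rewrite lerDl mulr_ge0.
have e1 : 0 <= 1 - eps by move: eps1; lra.
have al0 g : 0 <= al g.
  by rewrite mulr_ge0 ?exprn_ge0 ?invr_ge0 // subr_ge0 exprn_ege1.
have be0 d : 0 <= be d.
  by rewrite exprn_ge0 // !mulr_ge0 ?invr_ge0 //; apply: le_trans D1.
pose sm := [set s : {set 'I_n} | (#|s| <= B * (j * B))%N].
apply: (@le_trans _ _ (\sum_(W : {set V} | small_index B W)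
  (\sum_(g < B) `[< shallow set0 g.+1 W >]%:R * al g +
   \sum_(s in sm) \sum_(d < B) `[< shallow s d.+1 W >]%:R * be d))).
  apply: ler_sum => W hW; have [[g [h1 h2]]|[s [d [h1 h2 h3]]]] := moment_term_bound hW.
    rewrite (bigD1 g) //= (asboolT h1) mulr1n mul1r -addrA; apply: ler_wpDr => //.
    by rewrite addr_ge0 ?sumr_ge0 // => *; rewrite ?sumr_ge0 // => *; rewrite mulr_ge0.
  rewrite [X in _ <= _ + X](bigD1 s) ?inE //= [X in _ <= _ + (X + _)](bigD1 d) //= (asboolT h2) mulr1n mul1r [leRHS]addrC -!addrA; apply: ler_wpDr => //.
  by rewrite !addr_ge0 ?sumr_ge0 // => *; rewrite ?sumr_ge0 // => *; rewrite mulr_ge0.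
have cnt (t : {set 'I_n}) d : \sum_(W : {set V} | small_index B W) `[< shallow t d W >]%:R <=
    C * (B ^ #|t| * d ^ (n - #|t|))%:R :> R.
  rewrite -natr_sum -natrM ler_nat; apply: leq_trans (card_shallow A B t d).
  rewrite -sum1_card [X in (_ <= X)%N](eq_bigl (fun W => small_index B W && `[< shallow t d W >])).
    by rewrite [X in (_ <= X)%N]big_mkcondr.
  by move=> W; rewrite inE.
rewrite big_split /= mulrDr; apply: lerD.
  rewrite exchange_big /=.
  apply: (@le_trans _ _ (\sum_(g < B) C * ((1 + B%:R * del) ^+ m - 1))).
    apply: ler_sum => g _; rewrite -mulr_suml.
    apply: le_trans (ler_wpM2r (al0 g) (cnt set0 g.+1)) _.
    rewrite cards0 expn0 mul1n subn0 -mulrA; apply: ler_wpM2l => //.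
    rewrite mulrA; apply: ler_piMl; first by rewrite subr_ge0 exprn_ege1.
    rewrite exprVn ler_pdivrMr ?exprn_gt0 // mul1r -natrX ler_nat leq_pexp2l //.
  by rewrite sumr_const card_ord -[leLHS]mulr_natr mulrAC.
rewrite exchange_big /=.
apply: (@le_trans _ _ (\sum_(s in sm) \sum_(d < B)
    C * (B ^ (B * (j * B)))%:R * ((1 - eps) ^+ n * (1 + B%:R * del) ^+ m))).
  apply: ler_sum => s; rewrite inE => ss; rewrite exchange_big /=.
  apply: ler_sum => d _; rewrite -mulr_suml.
  apply: le_trans (ler_wpM2r (be0 d) (cnt s d.+1)) _.
  rewrite -!mulrA; apply: ler_wpM2l => //.
  rewrite natrM -mulrA; apply: ler_pM => //; first by rewrite mulr_ge0.
    by rewrite ler_nat leq_pexp2l // (leq_ltn_trans _ (ltn_ord d)).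
  rewrite /be exprMn [leLHS]mulrCA exprMn; apply: ler_pM => //; first exact: exprn_ge0.
  - by rewrite !mulr_ge0 // ?exprn_ge0 ?invr_ge0 //; apply: le_trans D1.
  - by apply: ler_wiXn2l => //; move: eps0; lra.
  rewrite mulrA; apply: ler_piMl; first by rewrite exprn_ge0 //; apply: le_trans D1.
  rewrite exprVn ler_pdivrMr ?exprn_gt0 // mul1r -natrX ler_nat leq_pexp2l //.
  by apply: leq_trans nm; apply: leq_subr.
rewrite !sumr_const card_ord.
have e1' : eps <= 1 by move: eps1; lra.
have := card_small_sets n (B * (j * B)) eps0 e1'; rewrite -/sm => hsm.
set F := (1 - eps) ^+ n * _; have F0 : 0 <= F.
  by rewrite mulr_ge0 ?exprn_ge0 //; apply: le_trans D1.
set G := C * _ * F.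
have -> : G *+ B *+ #|sm| = #|sm|%:R * (B%:R * G) by rewrite !mulr_natl.
apply: (@le_trans _ _ (eps^-1 ^+ (B * (j * B)) * (1 + eps) ^+ n * (B%:R * G))).
  by apply: ler_wpM2r => //; apply: mulr_ge0 => //; apply: mulr_ge0 => //; apply: mulr_ge0; rewrite ler0n.
rewrite /G /F natrX; rewrite le_eqVlt; apply/orP; left; apply/eqP.
have -> : (1 - eps ^+ 2) ^+ n = (1 + eps) ^+ n * (1 - eps) ^+ n.
  by rewrite -exprMn; congr (_ ^+ _); ring.
have -> : (B%:R / eps) ^+ (B * B) ^+ j = eps^-1 ^+ (B * (j * B)) * B%:R ^+ (B * (j * B)).
  by rewrite -exprM -exprMn mulrC; congr (_ ^+ _); lia.
by ring.
Qed.

End Estimate.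

Theorem subspace_moments (B u : nat) (eps : R) : 0 < eps -> eps <= 1 / 2 ->
  forall e, 0 < e -> exists n0, forall n, (n0 <= n)%N ->
  forall mu : 'I_n -> 'I_(n + u) -> A -> R, (forall i c, balanced_pmf eps (mu i c)) ->
  \sum_(W : {set 'cV[A]_n} | small_index B W)
     `|prob_cols mu W - (#|W|%:R / #|'cV[A]_n|%:R) ^+ (n + u)| <= e.
Proof.
move=> eps0 eps1 e e0.
have [B0|Bpos] := posnP B.
  exists 0%N => n _ mu _; rewrite big1 ?ltW // => W /andP[/asboolP sW].
  rewrite B0 mul0n leqn0 => /eqP c0; have := submod_gt0 (submodT 'cV[A]_n).
  by rewrite cardsT c0.
set K : R := (2 ^ (#|A| ^ B))%:R * B%:R.
have K0 : 0 < K by rewrite mulr_gt0 ?ltr0n ?expn_gt0.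
set z : R := mixrate B eps; have z0 : 0 <= z by apply: mixrate_ge0.
have z1 : z < 1 by rewrite /z /mixrate ltrBlDr ltrDl exprn_gt0 // eta_gt0.
set Q : R := (B%:R / eps) ^+ (B * B).
have Q0 : 0 <= Q by apply/exprn_ge0/divr_ge0 => //; apply: ltW.
have y0 : 0 < eps ^+ 2 by rewrite exprn_gt0.
have y1 : eps ^+ 2 <= 1 / 4 by rewrite expr2; nra.
(* Below, [j = 2 * (n %/ h)]: large enough for [n * z ^+ j] to vanish, and small enough for
   [Q ^+ j <= (1 + eps ^+ 2) ^+ n], which is what [h] secures. The product with
   [(1 - eps ^+ 2) ^+ n] is then at most [w ^+ n] with [w = 1 - eps ^+ 4]. *)
have [h h0 hQ] : exists2 h, (0 < h)%N & Q ^+ 2 <= (1 + eps ^+ 2) ^+ h.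
  exists (Num.Def.archi_bound (Q ^+ 2 / eps ^+ 2)).+1 => //.
  apply: le_trans (bernoulli_ge _ (ltW y0)).
  have : Q ^+ 2 / eps ^+ 2 < (Num.Def.archi_bound (Q ^+ 2 / eps ^+ 2)).+1%:R.
    apply: lt_trans (archi_boundP _) _; last by rewrite ltr_nat.
    by rewrite divr_ge0 ?exprn_ge0 ?divr_ge0 // ltW.
  by rewrite ltr_pdivrMr //; lra.
(* The maximum makes the base positive, as [linear_geometric_small] requires. *)
pose y : R := Num.max z (1/2).
have [yz yp yl] : [/\ z <= y, 0 < y & y < 1].
  by rewrite /y; split; rewrite ?le_max ?lexx ?lt_max ?gt_max ?z1 /=; try lra; apply/orP; right; lra.

have B0 : 0 < B%:R :> R by rewrite ltr0n.
set f := Num.min (e / (4 * K)) (1 / 4).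
have f0 : 0 < f.
  by rewrite lt_min; apply/andP; split; [apply: divr_gt0 => //; apply: mulr_gt0|lra].
have f1 : f <= e / (4 * K) by rewrite ge_min lexx.
have f2 : f <= 1 / 4 by rewrite ge_min lexx orbT.
have [n1 hn1] := linear_geometric_small u yp yl (divr_gt0 f0 B0) h0.
set w : R := 1 - eps ^+ 2 * eps ^+ 2.
have w0 : 0 <= w by rewrite /w; nra.
have w1 : w < 1 by rewrite /w; nra.
have [n2 hn2] := geometric_small w0 w1 (divr_gt0 e0 (mulr_gt0 (ltr0n R 4) K0) : 0 < e / (4%:R * K)).
exists (maxn n1 n2) => n; rewrite geq_max => /andP[hn1' hn2'] mu hmu.
pose j := (2 * (n %/ h))%N.
apply: le_trans (moment_sum_bound B j eps0 eps1 hmu (leq_addr _ _)) _.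
rewrite -/K -/z -/Q.
set X := (1 + B%:R * z ^+ j) ^+ (n + u).
have zj : z ^+ j <= y ^+ j by apply: lerXn2r; rewrite ?nnegrE // ltW.
have zj0 : 0 <= z ^+ j by apply: exprn_ge0.
have hz : (n + u)%:R * (B%:R * z ^+ j) <= f.
  rewrite mulrCA -ler_pdivlMl // [leRHS]mulrC; apply: le_trans (hn1 _ hn1').
  exact: ler_wpM2l.
have hX : X <= 1 + 2 * f.
  apply: le_trans (pow1D_le _ _) _; first by rewrite mulr_ge0 // ltW.
    by move: hz f2; lra.
  by move: hz; lra.
have hP : Q ^+ j * (1 - eps ^+ 2) ^+ n <= w ^+ n.
  have -> : w = (1 + eps ^+ 2) * (1 - eps ^+ 2) by rewrite /w; ring.
  rewrite [leRHS]exprMn; apply: ler_wpM2r; first by apply: exprn_ge0; lra.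
  rewrite /j exprM; apply: (@le_trans _ _ (((1 + eps ^+ 2) ^+ h) ^+ (n %/ h))).
    by apply: lerXn2r => //; rewrite nnegrE; apply: exprn_ge0; [exact: Q0|lra].
  rewrite -exprM; apply: ler_weXn2l; first by lra.
  by rewrite mulnC leq_trunc_div.
have X1 : 0 <= X by apply: exprn_ge0; rewrite addr_ge0 // mulr_ge0 // ltW.
have hw : w ^+ n <= e / (4 * K) by apply: hn2.
have hw0 : 0 <= w ^+ n by apply: exprn_ge0.
have h2 : Q ^+ j * (1 - eps ^+ 2) ^+ n * X <= w ^+ n * (3 / 2).
  apply: (@le_trans _ _ (w ^+ n * X)); first exact: ler_wpM2r.
  by apply: ler_wpM2l => //; move: hX f2; lra.
have : K * (X - 1 + Q ^+ j * (1 - eps ^+ 2) ^+ n * X) <= K * (2 * (e / (4 * K)) + e / (4 * K) * (3 / 2)).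
  apply: ler_wpM2l; first exact: ltW.
  by move: h2 hw hX f1; lra.
move=> h3; apply: le_trans h3 _.
have -> : K * (2 * (e / (4 * K)) + e / (4 * K) * (3 / 2)) = e * (7 / 8).
  by field; apply: lt0r_neq0.
by move: e0; lra.
Qed.

End Moments.

(** * Full rank over a finite field and Newton interpolation *)

Section RowFreeCount.
Variable F : finFieldType.
Local Notation q := #|F|.

Lemma row_freeP_ker m n (M : 'M[F]_(m, n)) :
  reflect (forall w : 'rV_m, w *m M = 0 -> w = 0) (row_free M).
Proof.
rewrite -kermx_eq0; apply: (iffP idP) => [/eqP kM w wM|h].
  by apply/eqP; rewrite -submx0 -kM; apply/sub_kermxP.
by apply/rowV0P => w /sub_kermxP; apply: h.
Qed.

Lemma row_free_col_mx m n (v : 'rV[F]_n) (M : 'M[F]_(m, n)) :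
  row_free (col_mx v M) = row_free M && ~~ (v <= M)%MS.
Proof.
apply/row_freeP_ker/andP => [h|[/row_freeP_ker hM vM] w].
  split.
    apply/row_freeP_ker => w wM.
    have := h (row_mx 0 w); rewrite mul_row_col mul0mx add0r => /(_ wM) /eqP.
    by rewrite row_mx_eq0 => /andP[_ /eqP].
  apply/negP => /submxP[w vw].
  have := h (row_mx 1%:M (- w)); rewrite mul_row_col mul1mx mulNmx -vw subrr => /(_ erefl) /eqP.
  by rewrite row_mx_eq0 => /andP[]; rewrite oner_eq0.
rewrite -[w]hsubmxK mul_row_col; set a := lsubmx w; set b := rsubmx w.
rewrite [a]mx11_scalar mul_scalar_mx; set c := a 0 0 => e.
have c0 : c = 0.
  apply/eqP/negPn/negP => c0; case/negP: vM; apply/submxP; exists (- c^-1 *: b).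
  have -> : v = c^-1 *: (c *: v) by rewrite scalerA mulVf // scale1r.
  by move/eqP: e; rewrite addr_eq0 => /eqP ->; rewrite -scalemxAl scalerN scaleNr.
rewrite c0 scale0r add0r in e; rewrite c0 (hM _ e).
by apply/eqP; rewrite row_mx_eq0 eqxx andbT; apply/eqP/matrixP => i j; rewrite !mxE mul0rn.
Qed.

Lemma card_mulmx_row_free p m n (K : 'M[F]_(m, n)) : row_free K ->
  injective (fun X : 'M[F]_(p, m) => X *m K).
Proof. by move=> fK; apply: row_free_inj. Qed.

(** Each new row avoids the span of the others. For [r > s] both sides vanish, on the right through
    the factor [j = s]. *)
Lemma card_row_free r s :
  #|[set M : 'M[F]_(r, s) | row_free M]| = (\prod_(j < r) (q ^ s - q ^ j))%N.
Proof.
elim: r => [|r IH].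
  rewrite big_ord0; have -> : [set M : 'M[F]_(0, s) | row_free M] = setT.
    by apply/setP => M; rewrite !inE flatmx0 /row_free mxrank0.
  by rewrite cardsT card_mx mul0n.
rewrite big_ord_recr /= -IH.
have -> : #|[set M : 'M[F]_(r.+1, s) | row_free M]| = (\sum_(M : 'M[F]_(1 + r, s) | row_free M) 1)%N.
  by rewrite -sum1_card; apply: eq_bigl => M; rewrite inE.
rewrite (reindex (fun p : 'M[F]_(r, s) * 'rV[F]_s => col_mx p.2 p.1)) /=; last first.
  exists (fun M : 'M[F]_(1 + r, s) => (dsubmx M, usubmx M)) => [[M v] _|M _] /=.
    by rewrite col_mxKd col_mxKu.
  exact: vsubmxK.
under eq_bigl => p do rewrite row_free_col_mx.
rewrite -(pair_big_dep (fun M : 'M[F]_(r, s) => row_free M)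
   (fun M v => ~~ (v <= M)%MS) (fun _ _ => 1%N)) /=.
rewrite (eq_bigr (fun _ => (q ^ s - q ^ r)%N)).
  by rewrite sum_nat_const; congr (_ * _)%N; apply: eq_card => M; rewrite inE.
move=> M fM; rewrite sum1_card.
have cM : #|[set v : 'rV[F]_s | (v <= M)%MS]| = (q ^ r)%N.
  have -> : [set v : 'rV[F]_s | (v <= M)%MS] = (fun w : 'rV_r => w *m M) @: setT.
    apply/setP => v; rewrite inE; apply/submxP/imsetP => [[w ->]|[w _ ->]]; by exists w.
  by rewrite card_imset ?cardsT ?card_mx ?mul1n //; apply: row_free_inj.
have := cardsC [set v : 'rV[F]_s | (v <= M)%MS]; rewrite cM card_mx mul1n => <-.
by rewrite addKn; apply: eq_card => v; rewrite !inE.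
Qed.

Lemma card_left_kernel p n m (B : 'M[F]_(n, m)) :
  #|[set X : 'M[F]_(p, n) | X *m B == 0]| = (q ^ (p * (n - \rank B)))%N.
Proof.
rewrite -mxrank_ker; set K := row_base (kermx B).
have -> : [set X : 'M[F]_(p, n) | X *m B == 0] = (fun Y => Y *m K) @: setT.
  apply/setP => X; rewrite inE; apply/eqP/imsetP => [/sub_kermxP|[Y _ ->]].
    by rewrite -(eq_row_base (kermx B)) => /submxP[Y ->]; exists Y.
  by apply/sub_kermxP; rewrite -(eq_row_base (kermx B)) submxMl.
rewrite card_imset ?cardsT ?card_mx //; apply: card_mulmx_row_free; exact: row_base_free.
Qed.

Lemma card_row_free_kernel r n m (B : 'M[F]_(n, m)) :
  #|[set X : 'M[F]_(r, n) | row_free X && (X *m B == 0)]| =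
  (\prod_(j < r) (q ^ (n - \rank B) - q ^ j))%N.
Proof.
rewrite -mxrank_ker -card_row_free; set K := row_base (kermx B).
have fK : row_free K by apply: row_base_free.
have -> : [set X : 'M[F]_(r, n) | row_free X && (X *m B == 0)] =
    (fun Y => Y *m K) @: [set Y : 'M[F]_(r, \rank (kermx B)) | row_free Y].
  apply/setP => X; rewrite inE; apply/andP/imsetP => [[fX /eqP/sub_kermxP]|[Y]].
    rewrite -(eq_row_base (kermx B)) => /submxP[Y XY]; exists Y => //.
    by rewrite inE; move: fX; rewrite XY /row_free mxrankMfree.
  rewrite inE => fY ->; split; first by rewrite /row_free mxrankMfree.
  by apply/eqP/sub_kermxP; rewrite -(eq_row_base (kermx B)) submxMl.
by rewrite card_imset //; apply: card_mulmx_row_free.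
Qed.

(** Double counting of pairs of a matrix [B] and [r] independent rows [X] with [X *m B = 0]: at most
    [q ^ (r * n)] choices of [X], then [q ^ (m * (n - r))] of [B], and [r * n <= r * m]. So this
    factorial moment has mean at most 1. *)
Lemma sum_row_free_kernel_le r n m : (n <= m)%N ->
  (\sum_(B : 'M[F]_(n, m)) \prod_(j < r) (q ^ (n - \rank B) - q ^ j) <= q ^ (n * m))%N.
Proof.
move=> nm.
under eq_bigr => B _ do rewrite -card_row_free_kernel -sum1_card.
under eq_bigr => B _ do under eq_bigl => X do rewrite inE.
rewrite (exchange_big_dep (fun X : 'M[F]_(r, n) => row_free X)) /=; last by move=> B X _ /andP[].
have [rn|nr] := leqP r n; last first.
  rewrite big_pred0 // => X; apply/negbTE; rewrite /row_free neq_ltn.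
  by rewrite (leq_ltn_trans (rank_leq_col _)).
apply: (@leq_trans (\sum_(X : 'M[F]_(r, n) | row_free X) q ^ (m * (n - r)))).
  apply: leq_sum => X fX.
  rewrite sum1_card; apply: (@leq_trans #|[set Y : 'M[F]_(m, n) | Y *m X^T == 0]|).
    rewrite -(card_imset _ (@trmx_inj _ n m)); apply: subset_leq_card.
    apply/subsetP => Y /imsetP[B]; rewrite unfold_in fX /= => /eqP h ->.
    by rewrite inE -trmx_mul h trmx0.
  by rewrite card_left_kernel mxrank_tr (eqP fX).
rewrite sum_nat_const; apply: (@leq_trans (q ^ (r * n) * q ^ (m * (n - r)))).
  by rewrite leq_mul2r -(card_mx F r n) max_card orbT.
rewrite -expnD leq_pexp2l //; first by apply/card_gt0P; exists 0.
by nia.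
Qed.

End RowFreeCount.

Section Newton.
Variables (R : realFieldType) (q : nat).
Hypothesis q2 : (2 <= q)%N.
Local Notation qR := (q%:R : R).

(* Newton interpolation of the indicator of [x = 1] at the nodes [q ^ j]. *)
Definition newton m (x : R) : R := \prod_(1 <= j < m.+1) ((x - qR ^+ j) / (1 - qR ^+ j)).

Definition newton_coef m : R := \prod_(1 <= j < m.+1) (qR ^+ j - 1)^-1.

(** The node [j = 0] is included, so this vanishes at [q ^ 0, ..., q ^ m], where the interpolation
    is exact; at the higher powers of [q] it is positive. *)
Definition newton_tail m (x : R) : R := newton_coef m * \prod_(0 <= j < m.+1) (x - qR ^+ j).

Let qge j : (1 <= j)%N -> 2 ^+ j <= qR ^+ j.
Proof. by move=> _; apply: lerXn2r; rewrite ?nnegrE // ler_nat. Qed.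

Let q1 j : (1 <= j)%N -> 1 < qR ^+ j.
Proof.
move=> j1; rewrite exprn_egt1 ?ltr1n //; by case: j j1.
Qed.

Lemma newton_coef_ge0 m : 0 <= newton_coef m.
Proof.
rewrite /newton_coef big_nat; apply: prodr_ge0 => j /andP[j1 _].
by rewrite invr_ge0 subr_ge0 ltW // q1.
Qed.

Lemma newton_coef_le m : newton_coef m.+1 <= 2^-1 ^+ m.
Proof.
elim: m => [|m IH].
  rewrite /newton_coef big_nat1 expr0; have := qge (leqnn 1); rewrite !expr1 => h.
  by rewrite invf_le1; lra.
rewrite /newton_coef big_nat_recr //= -/(newton_coef m.+1) [leRHS]exprSr.
apply: ler_pM => //; first exact: newton_coef_ge0.
  by rewrite invr_ge0 subr_ge0 ltW // q1.
rewrite lef_pV2 ?posrE //; last by rewrite subr_gt0 q1.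
have := @qge m.+2 isT; rewrite !exprS.
have : 1 <= 2 ^+ m :> R by apply: exprn_ege1; lra.
lra.
Qed.

(** For [s <= m] both sides vanish. Beyond, the right side is the left one times
    [q ^ s - 1 >= 1]. *)
Lemma newton_error m s :
  `|newton m (qR ^+ s) - (s == 0%N)%:R| <= newton_tail m (qR ^+ s).
Proof.
have [->|s0] := posnP s.
  rewrite /newton big_nat big1 ?subrr ?normr0.
    by rewrite /newton_tail big_nat_recl //= subrr mul0r mulr0.
  move=> j /andP[j1 _]; rewrite expr0 divff //.
  by rewrite subr_eq0 eq_sym (gt_eqF (q1 j1)).
rewrite subr0.
have [sm|ms] := leqP s m.
  rewrite /newton (bigD1_seq s) ?mem_index_iota ?iota_uniq //=; last by rewrite s0 ltnS.
  rewrite subrr !mul0r normr0 /newton_tail (bigD1_seq s) ?mem_index_iota ?iota_uniq //=.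
  by rewrite subrr mul0r mulr0.
have pos j : (j <= m)%N -> 0 < qR ^+ s - qR ^+ j.
  move=> jm; rewrite subr_gt0 ltr_eXn2l ?ltr1n //; exact: leq_ltn_trans jm ms.
rewrite /newton normr_prod /newton_tail [\prod_(0 <= _ < _) _]big_nat_recl //= mulrCA.
have -> : \prod_(1 <= j < m.+1) `|(qR ^+ s - qR ^+ j) / (1 - qR ^+ j)| =
  newton_coef m * \prod_(0 <= i < m) (qR ^+ s - qR ^+ i.+1).
  rewrite -[\prod_(0 <= i < m) _](@big_add1 _ _ _ 0 m.+1 xpredT (fun i => qR ^+ s - qR ^+ i)).
  rewrite /newton_coef -big_split /=; apply: eq_big_nat => j /andP[j1 jm].
  rewrite normrM normfV gtr0_norm ?pos // distrC gtr0_norm ?subr_gt0 ?q1 //.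
  by rewrite mulrC.
apply: ler_peMl.
  apply: mulr_ge0; first exact: newton_coef_ge0.
  by rewrite big_nat; apply: prodr_ge0 => j /andP[_ jm]; apply/ltW/pos.
have := qge s0; rewrite expr0; case: s s0 ms pos => // s _ _ _.
have : 1 <= 2 ^+ s :> R by apply: exprn_ege1; lra.
rewrite !exprS; lra.
Qed.

End Newton.

(** * Coordinates over the residue field *)

Section ResidueCoordinates.
Variables (S : nzRingType) (E : lmodType S) (K : finFieldType) (h : {rmorphism S -> K}).
Hypothesis h_surj : forall c, exists a, h a = c.
Variables (L U : E -> Prop).
Hypothesis L_lin : forall a x y, L x -> L y -> L (a *: x + y).
Hypothesis L0 : L 0.
Hypothesis U_lin : forall a x y, U x -> U y -> U (a *: x + y).
Hypothesis U0 : U 0.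
Hypothesis hU : forall a x, h a = 0 -> L x -> U (a *: x).
Hypothesis fin : exists s : seq E, forall x, L x -> exists2 y, y \in s & U (x - y).

Let sec c : S := projT1 (cid (h_surj c)).

Let secK c : h (sec c) = c. Proof. by rewrite /sec; case: cid. Qed.

Let U_D x y : U x -> U y -> U (x + y).
Proof. by move=> ux uy; rewrite -[x]scale1r; apply: U_lin. Qed.

Let U_Z a x : U x -> U (a *: x).
Proof. by move=> ux; rewrite -[_ *: _]addr0; apply: U_lin. Qed.

Let U_B x y : U x -> U y -> U (x - y).
Proof. by move=> ux uy; rewrite -scaleN1r addrC; apply: U_lin. Qed.

Let U_sum m (F : 'I_m -> E) : (forall j, U (F j)) -> U (\sum_j F j).
Proof. by move=> hF; apply: (big_ind U). Qed.

Let L_sum m (F : 'I_m -> E) : (forall j, L (F j)) -> L (\sum_j F j).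
Proof.
move=> hF; apply: (big_ind L) => // x y Lx Ly.
by rewrite -[x]scale1r; apply: L_lin.
Qed.

Let L_Z a x : L x -> L (a *: x).
Proof. by move=> ux; rewrite -[_ *: _]addr0; apply: L_lin. Qed.

Definition residually_free m (l : 'I_m -> E) :=
  (forall j, L (l j)) /\
  forall a : 'I_m -> S, U (\sum_j a j *: l j) -> forall j, h (a j) = 0.

Let comb m (l : 'I_m -> E) (c : 'rV[K]_m) : E := \sum_j sec (c 0 j) *: l j.

Lemma residually_free_inj m (l : 'I_m -> E) c c' : residually_free l ->
  U (comb l c - comb l c') -> c = c'.
Proof.
move=> [_ hl]; rewrite /comb -sumrB; under eq_bigr => j _ do rewrite -scalerBl.
move=> /hl e; apply/rowP => j; apply/eqP; rewrite -subr_eq0.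
by have := e j; rewrite rmorphB !secK => ->.
Qed.

Lemma residually_free_bound : exists B, forall m (l : 'I_m -> E),
  residually_free l -> (m <= B)%N.
Proof.
have [s hs] := fin; exists (size s) => m l fl.
have Lc c : L (comb l c) by apply: L_sum => j; apply/L_Z/(fl.1).
pose y c := s2val (cid2 (hs _ (Lc c))).
have ys c : y c \in s by rewrite /y; case: cid2.
have yU c : U (comb l c - y c) by rewrite /y; case: cid2.
have yI : injective y.
  move=> c c' e; apply: (residually_free_inj fl).
  have -> : comb l c - comb l c' = (comb l c - y c) - (comb l c' - y c').
    by rewrite e opprB addrA subrK.
  exact: U_B.
have : (#|{: 'rV[K]_m}| <= size s)%N.
  rewrite cardE -(size_map y); apply: uniq_leq_size.
    by rewrite map_inj_uniq // enum_uniq.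
  by move=> _ /mapP[c _ ->].
apply: leq_trans; rewrite card_mx mul1n; apply/ltnW/ltn_expl.
exact: card_finNzRing_gt1.
Qed.

(** A residually free family of maximal length is a basis of [L / U] over [K]; finiteness of [L / U]
    bounds the length. It serves twice: for [ker f / pi ker f] with scalars [A], and for [T / I]
    with integer scalars. *)
Lemma residue_coordinates : exists m (theta : E -> 'rV[K]_m),
  [/\ forall a x y, L x -> L y -> theta (a *: x + y) = h a *: theta x + theta y,
      forall v, exists2 x, L x & theta x = v &
      forall x, L x -> (theta x = 0 <-> U x)].
Proof.
have [B hB] := residually_free_bound.
have ex0 : exists m, `[< exists l : 'I_m -> E, residually_free l >].
  exists 0%N; apply/asboolP; exists (fun=> 0); split; first by case.
  by move=> a _ [].
have ub m : `[< exists l : 'I_m -> E, residually_free l >] -> (m <= B)%N.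
  by move/asboolP=> [l]; apply: hB.
have [m /asboolP[l fl] mmax] := ex_maxnP ex0 ub.
have ll j : L (l j) by apply: fl.1.
have span x : L x -> exists c, U (x - comb l c).
  move=> Lx.
  pose l' (i : 'I_m.+1) : E := if unlift ord0 i is Some j then l j else x.
  have Ll' j : L (l' j) by rewrite /l'; case: unliftP => //= ? _.
  have : ~ residually_free l'.
    move=> fl'; have : (m.+1 <= m)%N by apply: mmax; apply/asboolP; exists l'.
    by rewrite ltnn.
  move/not_andP => [//|/existsNP[a /not_implyP[aU /existsNP[j0 aj0]]]].
  move: aU; rewrite big_ord_recl /l' unlift_none.
  under eq_bigr => j _ do rewrite liftK.
  move=> aU; set a0 := a ord0 in aU; pose b := fun j => a (lift ord0 j).
  have ha0 : h a0 != 0.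
    apply/eqP => ha0; apply: aj0.
    have hb : forall j, h (b j) = 0.
      apply: fl.2; have := U_B aU (hU ha0 Lx); by rewrite addrC addrA addNr add0r.
    by have [j ->|->] := unliftP ord0 j0; [exact: hb|exact: ha0].
  (* Maximality gave a relation whose coefficient on [x] is nonzero in [K]. With [b0] lifting its
     inverse, [x] is solved for, up to multiples by elements of the kernel of [h], which [hU] sends
     into [U]. *)
  set b0 := sec (h a0)^-1.
  exists (\row_j - h (b0 * b j)).
  have -> : x - comb l (\row_j - h (b0 * b j)) =
      (1 - b0 * a0) *: x + b0 *: (a0 *: x + \sum_j b j *: l j) -
      \sum_j (b0 * b j + sec (- h (b0 * b j))) *: l j.
    rewrite scalerDr scaler_sumr scalerBl scale1r scalerA addrA subrK.
    rewrite -addrA; congr (_ + _); rewrite -sumrB /comb -sumrN; apply: eq_bigr => j _.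
    by rewrite scalerDl scalerA opprD addrA subrr add0r mxE.
  apply: U_B; first apply: U_D.
  - by apply: hU => //; rewrite rmorphB rmorph1 rmorphM secK mulVf ?subrr.
  - exact: U_Z.
  - by apply: U_sum => j; apply: hU => //; rewrite rmorphD secK subrr.
pose theta x := if pselect (L x) is left Lx then projT1 (cid (span x Lx)) else 0.
have thetaP x : L x -> U (x - comb l (theta x)).
  by rewrite /theta; case: pselect => // Lx _; case: cid.
have thetaE x c : L x -> U (x - comb l c) -> theta x = c.
  move=> Lx hc; apply: (residually_free_inj fl).
  have -> : comb l (theta x) - comb l c = (x - comb l c) - (x - comb l (theta x)).
    by rewrite opprB [RHS]addrC addrA subrK.
  by apply: U_B => //; apply: thetaP.
have Lcomb c : L (comb l c) by apply: L_sum => j; apply: L_Z.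
exists m, theta; split.
- move=> a x y Lx Ly; apply: thetaE; first exact: L_lin.
  have -> : a *: x + y - comb l (h a *: theta x + theta y) =
     a *: (x - comb l (theta x)) + (y - comb l (theta y)) -
     (comb l (h a *: theta x + theta y) - (a *: comb l (theta x) + comb l (theta y))).
    by rewrite scalerBr addrACA -opprD opprB addrA subrK.
  apply: U_B; first by apply: U_lin; apply: thetaP.
  rewrite /comb scaler_sumr -big_split -sumrB /=; apply: U_sum => j.
  rewrite scalerA -scalerDl -scalerBl; apply: hU => //.
  by rewrite rmorphB rmorphD rmorphM !secK !mxE subrr.
- by move=> v; exists (comb l v) => //; apply: thetaE; rewrite ?subrr.
move=> x Lx; split=> [tx|ux].
  have := thetaP x Lx; rewrite tx /comb => h0; rewrite -(subrK (comb l 0) x).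
  apply: U_D => //; apply: U_sum => j; apply: hU => //; by rewrite secK mxE.
apply: thetaE => //; apply: U_B => //; apply: U_sum => j; apply: hU => //.
by rewrite secK mxE.
Qed.
End ResidueCoordinates.

(** * Surjections onto a finite module *)

Lemma card_additive_image (E Y : finZmodType) (L : {set E}) (g : E -> Y) :
  0 \in L -> (forall x y, x \in L -> y \in L -> x - y \in L) ->
  (forall x y, x \in L -> y \in L -> g (x - y) = g x - g y) ->
  #|L| = (#|g @: L| * #|[set x in L | g x == 0%R]|)%N.
Proof.
move=> L0 LB gB; rewrite -sum1_card (partition_big g (mem (g @: L))) /=; last first.
  by move=> x xL; apply: imset_f.
rewrite -sum_nat_const; apply: eq_bigr => _ /imsetP[x0 x0L ->].
rewrite sum1_card -[RHS](card_imset _ (addIr x0)); apply: eq_card => x.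
apply/idP/imsetP => [/andP[xL /eqP gx]|[z]].
  exists (x - x0); last by rewrite subrK.
  by rewrite inE LB // gB // gx subrr eqxx.
rewrite inE => /andP[zL /eqP gz] ->.
have zx : z + x0 \in L by rewrite -[x0]opprK; apply: (LB) => //; rewrite -sub0r LB.
by apply/andP; split=> //; rewrite -subr_eq0 -gB // addrK gz.
Qed.

Section Cokernel.
Variables (A : finComNzRingType) (N : finLmodType A) (n : nat).
Local Notation V := ('cV[A]_n).
Implicit Types (f : {ffun 'I_n -> N}) (W : {set V}).

Definition linext f (v : V) : N := \sum_i v i 0 *: f i.

Lemma linext_lin f a x y : linext f (a *: x + y) = a *: linext f x + linext f y.
Proof.
rewrite /linext scaler_sumr -big_split /=; apply: eq_bigr => i _.
by rewrite !mxE scalerDl scalerA.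
Qed.

Lemma linextD f x y : linext f (x + y) = linext f x + linext f y.
Proof. by rewrite -[x]scale1r linext_lin !scale1r. Qed.

Lemma linext0 f : linext f 0 = 0.
Proof. by rewrite /linext big1 // => i _; rewrite mxE scale0r. Qed.

Lemma linextZ f a x : linext f (a *: x) = a *: linext f x.
Proof. by rewrite -[_ *: x]addr0 linext_lin linext0 addr0. Qed.

Lemma linextB f x y : linext f (x - y) = linext f x - linext f y.
Proof. by rewrite linextD -scaleN1r linextZ scaleN1r. Qed.

Lemma linext_unitv f i : linext f (unitv A i) = f i.
Proof.
rewrite /linext (bigD1 i) //= big1 => [|j /negbTE ji]; last by rewrite unitvE ji scale0r.
by rewrite unitvE eqxx scale1r addr0.
Qed.

Definition fker f : {set V} := [set v : V | linext f v == 0].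

Lemma submod_fker f : submod (fker f).
Proof.
split; first by rewrite inE linext0.
  by move=> x y; rewrite !inE linextD => /eqP-> /eqP->; rewrite addr0.
by move=> a x; rewrite !inE linextZ => /eqP->; rewrite scaler0.
Qed.

Definition fsurj f : bool := [forall y, exists v, linext f v == y].

Lemma fsurjP f : reflect (forall y, exists v, linext f v = y) (fsurj f).
Proof.
apply: (iffP forallP) => h y; first by have /existsP[v /eqP <-] := h y; exists v.
by have [v <-] := h y; apply/existsP; exists v.
Qed.

Lemma card_fker f : fsurj f -> (#|V| = #|N| * #|fker f|)%N.
Proof.
move/fsurjP=> fs; rewrite -cardsT (@card_additive_image V N setT (linext f)).
- congr (_ * _)%N; last by apply: eq_card => v; rewrite !inE.
  by apply: eq_card => y; have [v <-] := fs y; rewrite inE; apply/imsetP; exists v.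
- by rewrite inE.
- by move=> *; rewrite inE.
- by move=> *; rewrite linextB.
Qed.

Definition cols_in m (M : 'M[A]_(n, m)) W : bool := [forall c, col c M \in W].

Lemma mulmx_cols m (M : 'M[A]_(n, m)) (w : 'cV_m) : M *m w = \sum_c w c 0 *: col c M.
Proof.
apply/colP => i; rewrite mxE summxE; apply: eq_bigr => c _.
by rewrite !mxE mulrC.
Qed.

Definition mximage m (M : 'M[A]_(n, m)) : {set V} := [set M *m w | w : 'cV_m].

Lemma submod_mximage m (M : 'M[A]_(n, m)) : submod (mximage M).
Proof.
split; first by apply/imsetP; exists 0; rewrite ?mulmx0.
  move=> _ _ /imsetP[x _ ->] /imsetP[y _ ->].
  by apply/imsetP; exists (x + y); rewrite ?mulmxDr.
by move=> a _ /imsetP[x _ ->]; apply/imsetP; exists (a *: x); rewrite ?scalemxAr.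
Qed.

Lemma col_mximage m (M : 'M[A]_(n, m)) c : col c M \in mximage M.
Proof.
apply/imsetP; exists (delta_mx c 0) => //.
by apply/colP => i; rewrite -colE.
Qed.

Lemma mximage_sub m (M : 'M[A]_(n, m)) W : submod W -> (mximage M \subset W) = cols_in M W.
Proof.
move=> sW; apply/subsetP/forallP => [h c|h _ /imsetP[w _ ->]].
  exact/h/col_mximage.
by rewrite mulmx_cols; apply: submod_sum => // c _; apply: submodZ.
Qed.

Definition module_aut : {set {ffun N -> N}} :=
  [set g : {ffun N -> N} | injectiveb g &&
    [forall a, forall x, forall y, g (a *: x + y) == a *: g x + g y]].

Definition cok_iso m (M : 'M[A]_(n, m)) : bool :=
  [exists f, fsurj f && (fker f == mximage M)].

(** By composition, the automorphisms of [N] act simply transitively on the surjections with kernel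
    [im M], once there is one. *)
Lemma card_cok_iso m (M : 'M[A]_(n, m)) :
  (\sum_f (fsurj f && (fker f == mximage M)) = #|module_aut| * cok_iso M)%N.
Proof.
rewrite /cok_iso; case: existsP => [[f0 /andP[s0 /eqP k0]]|no]; last first.
  rewrite muln0 big1 // => f _; apply/eqP; rewrite eqb0; apply/negP => h.
  by apply: no; exists f.
rewrite muln1 -big_mkcond /= sum1_card.
pose tof (g : {ffun N -> N}) := [ffun i => g (f0 i)] : {ffun 'I_n -> N}.
have sf0 := fsurjP _ s0.
have autP g : g \in module_aut ->
   injective g /\ forall a x y, g (a *: x + y) = a *: g x + g y.
  rewrite inE => /andP[/injectiveP gi /forallP gl]; split=> // a x y.
  by have /forallP/(_ x)/forallP/(_ y)/eqP := gl a.
have fg g v : g \in module_aut -> linext (tof g) v = g (linext f0 v).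
  move=> /autP[_ gl].
  have g0 : g 0 = 0.
    by have := gl 1 0 0; rewrite !scale1r addr0 => /eqP; rewrite -subr_eq subrr => /eqP.
  rewrite /linext (big_morph g (id1 := 0) (op1 := +%R)) //; last first.
    by move=> x y; have := gl 1 x y; rewrite !scale1r.
  apply: eq_bigr => i _; rewrite ffunE.
  by have := gl (v i 0) (f0 i) 0; rewrite g0 !addr0.
have inj : {in module_aut &, injective tof}.
  move=> g g' hg hg' e; apply/ffunP => y; have [v <-] := sf0 y.
  by rewrite -!fg // e.
rewrite -(card_in_imset inj); apply: eq_card => f.
apply/idP/imsetP => [/andP[sf /eqP kf]|[g hg ->]].
  have ker_eq v v' : (linext f v == linext f v') = (linext f0 v == linext f0 v').
    rewrite -subr_eq0 -linextB -[RHS]subr_eq0 -linextB.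
    by have := erefl (v - v' \in mximage M); rewrite -{1}kf -k0 !inE.
  pose pre y := odflt 0 [pick v | linext f0 v == y].
  have preP y : linext f0 (pre y) = y.
    rewrite /pre; case: pickP => [v /eqP //|no]; have [v e] := sf0 y.
    by have := no v; rewrite e eqxx.
  exists [ffun y => linext f (pre y)]; last first.
    apply/ffunP => i; rewrite !ffunE -linext_unitv; apply/eqP.
    by rewrite ker_eq preP linext_unitv.
  rewrite inE; apply/andP; split.
    apply/injectiveP => y y'; rewrite !ffunE => /eqP.
    by rewrite ker_eq !preP => /eqP.
  apply/forallP => a; apply/forallP => x; apply/forallP => y.
  by rewrite !ffunE -linext_lin ker_eq linext_lin !preP.
have [gi gl] := autP _ hg; apply/andP; split.
  apply/fsurjP => y; have [g' gK Kg] := injF_bij gi.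
  by have [v hv] := sf0 (g' y); exists v; rewrite fg // hv Kg.
apply/eqP; rewrite -k0; apply/setP => v; rewrite !inE fg //.
have g0 : g 0 = 0.
  by have := gl 1 0 0; rewrite !scale1r addr0 => /eqP; rewrite -subr_eq subrr => /eqP.
by rewrite -{1}g0 (inj_eq gi).
Qed.

End Cokernel.

(** * Reduction of the columns modulo the primes *)

Section ResidueTheta.
Variables (A : finComNzRingType) (N : finLmodType A) (n : nat).
Variables (K : finFieldType) (h : {rmorphism A -> K}) (pi : A).
Hypothesis h_surj : forall c, exists a, h a = c.
Hypothesis h_ker : forall a, h a = 0 <-> exists b, a = pi * b.
Hypothesis ann : forall a, pi * a = 0 -> forall v : N, a *: v = 0.
Local Notation V := ('cV[A]_n).
Local Notation q := #|K|.

(** Multiplication by [pi] and reduction by [h] give [|A^n|] as [|pi A^n|] times the torsion and as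
    [|pi A^n| * q ^ n]. *)
Lemma card_torsion : #|[set v : V | pi *: v == 0]| = (q ^ n)%N.
Proof.
have e1 := @card_additive_image V V setT (fun v => pi *: v) (in_setT _) (fun _ _ _ _ => in_setT _)
  (fun x y _ _ => scalerBr _ _ _).
have e2 := @card_additive_image V 'cV[K]_n setT (map_mx h) (in_setT _) (fun _ _ _ _ => in_setT _)
  (fun x y _ _ => map_mxB _ _ _).
move: e2; rewrite e1 mulnC.
have -> : map_mx h @: [set: V] = setT.
  apply/setP => w; rewrite inE; apply/imsetP.
  exists (\col_i projT1 (cid (h_surj (w i 0)))) => //.
  by apply/colP => i; rewrite !mxE; case: cid.
have -> : [set x in setT | map_mx h x == 0 :> 'cV[K]_n] = (fun v : V => pi *: v) @: setT.
  apply/setP => x; rewrite !inE; apply/eqP/imsetP => [hx|[y _ ->]].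
    have hb i : exists b, x i 0 = pi * b.
      by apply/h_ker; have /colP/(_ i) := hx; rewrite !mxE.
    exists (\col_i projT1 (cid (hb i))) => //.
    by apply/colP => i; rewrite !mxE; case: cid.
  by apply/colP => i; rewrite !mxE; apply/h_ker; exists (y i 0).
rewrite cardsT card_mx muln1 => /eqP; rewrite eqn_pmul2r; last first.
  by apply/card_gt0P; exists (pi *: 0); apply/imsetP; exists 0.
by move/eqP <-; apply: eq_card => v; rewrite !inE.
Qed.

(** The dimension is exactly [n]: [|L / pi L|] equals the order of the [pi]-torsion of [L], and [L]
    contains the whole [pi]-torsion of [A^n], whose entries kill [N] by [ann]. This is the concrete
    use of the spare exponent of the modulus. *)
Lemma residue_theta (f : {ffun 'I_n -> N}) : exists theta : V -> 'rV[K]_n,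
  [/\ forall a x y, x \in fker f -> y \in fker f ->
         theta (a *: x + y) = h a *: theta x + theta y,
      forall v, exists2 x, x \in fker f & theta x = v &
      forall x, x \in fker f -> (theta x = 0 <-> exists2 y, y \in fker f & x = pi *: y)].
Proof.
have sL := submod_fker f; set L := fker f in sL *.
have [||||||m [theta [t1 t2 t3]]] := @residue_coordinates A V K h h_surj
   (fun x => x \in L) (fun x => exists2 y, y \in L & x = pi *: y).
- by move=> a x y xL yL; apply: submodD => //; apply: submodZ.
- exact: submod0.
- move=> a _ _ [x xL ->] [y yL ->]; exists (a *: x + y).
    by apply: submodD => //; apply: submodZ.
  by rewrite scalerDr !scalerA mulrC.
- by exists 0; rewrite ?scaler0 // submod0.
- by move=> a x /h_ker[b ->] xL; exists (b *: x); rewrite ?scalerA // submodZ.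
- exists (enum {: V}) => x xL; exists x; first by rewrite mem_enum.
  by exists 0; rewrite ?subrr ?scaler0 // submod0.
suff mn : m = n by subst m; exists theta.
have tB x y : x \in L -> y \in L -> theta (x - y) = theta x - theta y.
  by move=> xL yL; rewrite addrC -scaleN1r t1 // rmorphN rmorph1 scaleN1r addrC.
have LB x y : x \in L -> y \in L -> x - y \in L by apply: submodB.
have e1 := @card_additive_image V V L (fun v => pi *: v) (submod0 sL) LB
  (fun x y _ _ => scalerBr _ _ _).
have := @card_additive_image V 'rV[K]_m L theta (submod0 sL) LB tB.
rewrite e1 mulnC.
have -> : theta @: L = setT.
  apply/setP => w; rewrite inE; apply/imsetP; have [x xL <-] := t2 w; by exists x.
have -> : [set x in L | theta x == 0] = (fun v : V => pi *: v) @: L.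
  apply/setP => x; rewrite inE; apply/andP/imsetP => [[xL /eqP]|[y yL ->]].
    by move/(t3 _ xL) => [y yL ->]; exists y.
  have pyL : pi *: y \in L by apply: submodZ.
  by split=> //; apply/eqP/t3 => //; exists y.
have -> : [set x in L | pi *: x == 0] = [set v : V | pi *: v == 0].
  apply/setP => x; rewrite inE [RHS]inE; case: eqP => [px|]; rewrite ?andbF ?andbT //.
  rewrite inE; apply/eqP; rewrite /linext big1 // => i _; apply: ann.
  by have /colP/(_ i) := px; rewrite !mxE.
rewrite card_torsion cardsT card_mx mul1n => /eqP; rewrite eqn_pmul2r; last first.
  by apply/card_gt0P; exists (pi *: 0); apply/imsetP; exists 0; rewrite ?submod0.
by rewrite eqn_exp2l ?card_finNzRing_gt1 // => /eqP.
Qed.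

End ResidueTheta.

Section ManyPrimes.
Variables (A : finComNzRingType) (N : finLmodType A) (k : nat).
Variables (K : 'I_k -> finFieldType) (h : forall i, {rmorphism A -> K i}) (pi : 'I_k -> A).
Hypothesis h_surj : forall i c, exists a, h i a = c.
Hypothesis h_ker : forall i a, h i a = 0 <-> exists b, a = pi i * b.
Hypothesis ann : forall i a, pi i * a = 0 -> forall v : N, a *: v = 0.
Hypothesis idem : forall i, exists a, h i a = 1 /\ forall j, j != i -> h j a = 0.
Hypothesis nil : exists s : seq 'I_k, \prod_(i <- s) pi i = 0.

Section Fixed.
Variables (n : nat) (f : {ffun 'I_n -> N}).
Local Notation V := ('cV[A]_n).
Local Notation L := (fker f).

Definition theta i : V -> 'rV[K i]_n :=
  projT1 (cid (@residue_theta A N n (K i) (h i) (pi i) (@h_surj i) (@h_ker i) (@ann i) f)).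

Lemma thetaP i :
  [/\ forall a x y, x \in L -> y \in L ->
         theta i (a *: x + y) = h i a *: theta i x + theta i y,
      forall v, exists2 x, x \in L & theta i x = v &
      forall x, x \in L -> (theta i x = 0 <-> exists2 y, y \in L & x = pi i *: y)].
Proof. exact: (projT2 (cid (@residue_theta A N n (K i) (h i) (pi i) (@h_surj i) (@h_ker i) (@ann i) f))). Qed.

Lemma theta_lin i a x y : x \in L -> y \in L ->
  theta i (a *: x + y) = h i a *: theta i x + theta i y.
Proof. by have [t1 _ _] := thetaP i; apply: t1. Qed.

Lemma theta_surj i v : exists2 x, x \in L & theta i x = v.
Proof. by have [_ t2 _] := thetaP i; apply: t2. Qed.

Lemma theta_ker i x : x \in L -> theta i x = 0 <-> exists2 y, y \in L & x = pi i *: y.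
Proof. by have [_ _ t3] := thetaP i; apply: t3. Qed.

Lemma theta0 i : theta i 0 = 0.
Proof.
apply/theta_ker; first by rewrite submod0 //; apply: submod_fker.
by exists 0; rewrite ?scaler0 // submod0 //; apply: submod_fker.
Qed.

Lemma thetaZ i a x : x \in L -> theta i (a *: x) = h i a *: theta i x.
Proof.
move=> xL; rewrite -[_ *: x]addr0 theta_lin ?theta0 ?addr0 // submod0 //.
exact: submod_fker.
Qed.

Lemma thetaD i x y : x \in L -> y \in L -> theta i (x + y) = theta i x + theta i y.
Proof. by move=> xL yL; rewrite -[x]scale1r theta_lin // rmorph1 !scale1r. Qed.

Lemma thetaB i x y : x \in L -> y \in L -> theta i (x - y) = theta i x - theta i y.
Proof.
move=> xL yL; rewrite thetaD ?submodN //; last exact: submod_fker.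
by rewrite -scaleN1r thetaZ // rmorphN rmorph1 scaleN1r.
Qed.

Lemma theta_sum i (I : finType) (F : I -> V) : (forall c, F c \in L) ->
  theta i (\sum_c F c) = \sum_c theta i (F c).
Proof.
move=> FL; pose P (x : V) (y : 'rV[K i]_n) := x \in L /\ theta i x = y.
suff : P (\sum_c F c) (\sum_c theta i (F c)) by case.
apply: (big_ind2 P).
- by split; [apply/submod0/submod_fker|apply: theta0].
- move=> x1 x2 y1 y2 [xL <-] [yL <-]; split; last exact: thetaD.
  by apply: submodD => //; apply: submod_fker.
- by [].
Qed.

Definition Theta i m (M : 'M[A]_(n, m)) : 'M[K i]_(n, m) :=
  \matrix_(a, c) theta i (col c M) 0 a.

Lemma row_TrTheta i m (M : 'M[A]_(n, m)) c : row c (Theta i M)^T = theta i (col c M).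
Proof. by apply/rowP => a; rewrite !mxE. Qed.

Lemma cols_inP m (M : 'M[A]_(n, m)) (W : {set V}) : reflect (forall c, col c M \in W) (cols_in M W).
Proof. exact: forallP. Qed.

Lemma ThetaD i m (M M' : 'M[A]_(n, m)) : cols_in M L -> cols_in M' L ->
  Theta i (M + M') = Theta i M + Theta i M'.
Proof.
move=> /cols_inP ML /cols_inP ML'; apply/matrixP => a c; rewrite !mxE linearD /= thetaD //.
by rewrite mxE.
Qed.

Lemma cols_inD m (M M' : 'M[A]_(n, m)) W : submod W -> cols_in M' W ->
  cols_in (M + M') W = cols_in M W.
Proof.
move=> sW /cols_inP ML'; apply: eq_forallb => c; by rewrite linearD /= submodDr.
Qed.

Lemma Theta_lift i m (B : 'M[K i]_(n, m)) : exists M : 'M[A]_(n, m),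
  [/\ cols_in M L, Theta i M = B & forall j, j != i -> Theta j M = 0].
Proof.
have [a [a1 a2]] := idem i.
have hx c : exists x, x \in L /\ theta i x = row c B^T.
  by have [x xL e] := theta_surj (row c B^T); exists x.
pose x c := projT1 (cid (hx c)).
have xL c : x c \in L by rewrite /x; case: cid => ? [].
have xE c : theta i (x c) = row c B^T by rewrite /x; case: cid => ? [].
pose M : 'M[A]_(n, m) := \matrix_(b, c) (a *: x c) b 0.
have cM c : col c M = a *: x c by apply/colP => b; rewrite !mxE.
exists M; split.
- by apply/cols_inP => c; rewrite cM submodZ //; apply: submod_fker.
- by apply/matrixP => b c; rewrite mxE cM thetaZ // a1 scale1r xE !mxE.
- by move=> j ji; apply/matrixP => b c; rewrite mxE cM thetaZ // a2 // scale0r !mxE.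
Qed.

Lemma mximage_fker m (M : 'M[A]_(n, m)) :
  (fker f == mximage M) = cols_in M L && [forall i, row_free (Theta i M)].
Proof.
have sL := submod_fker f; have sC := submod_mximage M.
apply/eqP/andP => [LC|[ML /forallP free]].
  have ML : cols_in M L by rewrite -mximage_sub // LC.
  split=> //; apply/forallP => i; apply/row_freeP_ker => w wT.
  apply/eqP/negPn/negP => w0.
  (* A row vector killing [Theta i M] kills every class, since each element of [L] has the form
     [M *m z]; but all vectors occur as classes. *)
  have [y hy] : exists y : 'cV[K i]_n, w *m y != 0.
    have /rV0Pn[j wj] : w != 0 by [].
    by exists (delta_mx j 0); apply/eqP => /matrixP/(_ 0 0); rewrite -colE !mxE; apply/eqP.
  have [x xL xE] := theta_surj y^T.
  move: xL; rewrite LC => /imsetP[z _ xz].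
  have : y = Theta i M *m (map_mx (h i) z).
    apply: trmx_inj; rewrite -xE xz mulmx_cols theta_sum; last first.
      by move=> c; apply: submodZ => //; move/cols_inP: ML.
    rewrite trmx_mul mulmx_sum_row; apply: eq_bigr => c _.
    by rewrite thetaZ ?row_TrTheta ?mxE //; move/cols_inP: ML.
  by move=> yE; move: hy; rewrite yE mulmxA wT mul0mx eqxx.
apply/eqP; rewrite eqEsubset mximage_sub // ML andbT.
(* Full rank at [i] means [L = im M + pi_i L]. Iteration along a sequence of primes with
   [\prod pi_i = 0] leaves [L = im M]. *)
have base i x : x \in L -> exists2 c, c \in mximage M & exists2 y, y \in L & x = c + pi i *: y.
  move=> xL.
  have /submxP[w wE] : (theta i x <= (Theta i M)^T)%MS.
    apply: submx_full; rewrite /row_full mxrank_tr; exact: free.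
  pose z : 'cV[A]_m := \col_c projT1 (cid (@h_surj i (w 0 c))).
  have zE c : h i (z c 0) = w 0 c by rewrite mxE; case: cid.
  have cL : M *m z \in L.
    by apply: (subsetP (_ : mximage M \subset L)); [rewrite mximage_sub|apply/imsetP; exists z].
  exists (M *m z); first by apply/imsetP; exists z.
  have : theta i (x - M *m z) = 0.
    rewrite thetaB // wE mulmx_cols theta_sum; last first.
      by move=> c; apply: submodZ => //; move/cols_inP: ML.
    rewrite mulmx_sum_row -sumrB big1 // => c _.
    by rewrite thetaZ ?zE ?row_TrTheta ?subrr //; move/cols_inP: ML.
  move/theta_ker => /(_ (submodB sL xL cL))[y yL e]; exists y => //.
  by rewrite -e addrC subrK.
have [s s0] := nil.
suff H r x : x \in L -> exists2 c, c \in mximage M &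
    exists2 y, y \in L & x = c + (\prod_(i <- r) pi i) *: y.
  apply/subsetP => x xL; have [c cM [y _ ->]] := H s x xL.
  by rewrite s0 scale0r addr0.
elim: r x => [|i r IH] x xL.
  by exists 0; [exact: submod0|exists x => //; rewrite big_nil scale1r add0r].
have [c cM [y yL ->]] := base i x xL; have [c' cM' [y' yL' ->]] := IH y yL.
exists (c + pi i *: c'); first by apply: submodD => //; apply: submodZ.
by exists y' => //; rewrite big_cons scalerDr scalerA addrA.
Qed.

Lemma card_cols_in m (W : {set V}) : #|[set M : 'M[A]_(n, m) | cols_in M W]| = (#|W| ^ m)%N.
Proof.
have -> : (#|W| ^ m)%N = #|[set g : {ffun 'I_m -> V} | g \in ffun_on (mem W)]|.
  by rewrite cardsE card_ffun_on card_ord.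
have inj : injective (fun M : 'M[A]_(n, m) => [ffun c => col c M] : {ffun 'I_m -> V}).
  move=> M M' /ffunP e; apply/matrixP => a c; have := e c; rewrite !ffunE.
  by move/colP/(_ a); rewrite !mxE.
rewrite -(card_imset _ inj); apply: eq_card => g; rewrite inE.
apply/imsetP/ffun_onP => [[M]|gW].
  by rewrite inE => /cols_inP ML -> c; rewrite ffunE.
exists (\matrix_(a, c) g c a 0).
  rewrite inE; apply/cols_inP => c; suff -> : col c (\matrix_(a, c) g c a 0) = g c by apply: gW.
  by apply/colP => a; rewrite !mxE.
by apply/ffunP => c; rewrite ffunE; apply/colP => a; rewrite !mxE.
Qed.

(** Translating [M] by a lift of [B] at the prime [i] changes no other [Theta j]. Averaging over [B]
    therefore replaces [phi i (Theta i M)] by its mean. *)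
Lemma uniform_independence (R : realFieldType) m (phi : forall i, 'M[K i]_(n, m) -> R) (s : seq 'I_k) :
  uniq s ->
  \sum_(M : 'M[A]_(n, m) | cols_in M L) \prod_(i <- s) phi i (Theta i M) =
  (#|L| ^ m)%:R * \prod_(i <- s) ((\sum_B phi i B) / #|{: 'M[K i]_(n, m)}|%:R).
Proof.
elim: s => [_|i s IH] /=.
  under eq_bigr => M _ do rewrite big_nil.
  rewrite big_nil mulr1 -card_cols_in -sum1_card natr_sum.
  by apply: eq_bigl => M; rewrite inE.
move=> /andP[is_ us]; under eq_bigr => M _ do rewrite big_cons.
rewrite big_cons mulrCA -IH //; set C := #|_|%:R.
have C0 : C != 0 by rewrite pnatr_eq0 -lt0n; apply/card_gt0P; exists 0.
set S := LHS; apply: (mulfI C0); rewrite [RHS]mulrA [C * (_ / C)]mulrC divfK // [LHS]mulrC.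
have shift B : S = \sum_(M : 'M[A]_(n, m) | cols_in M L)
   phi i (Theta i M + B) * \prod_(j <- s) phi j (Theta j M).
  have [M0 [M0L M0i M0j]] := Theta_lift B.
  rewrite /S (reindex_inj (addIr M0)) /=.
  apply: eq_big => [M|M]; first by rewrite cols_inD //; apply: submod_fker.
  rewrite cols_inD //; last exact: submod_fker.
  move=> ML; rewrite ThetaD // M0i; congr (_ * _).
  apply: eq_big_seq => j js; rewrite ThetaD // M0j ?addr0 //.
  by apply: contraNneq is_ => <-.
have -> : S * C = \sum_(B : 'M[K i]_(n, m)) S by rewrite sumr_const mulr_natr.
rewrite (eq_bigr _ (fun B _ => shift B)).
rewrite exchange_big /= mulr_sumr; apply: eq_bigr => M _.
rewrite -mulr_suml; congr (_ * _).
by rewrite [RHS](reindex_inj (addrI (Theta i M))).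
Qed.

End Fixed.
End ManyPrimes.

(** * Linear combinations of submodule indicators *)

Section SubmoduleLattice.
Variables (A : comNzRingType) (E : finLmodType A).
Implicit Types W X : {set E}.

Lemma coset_rep_idem X v : submod X -> coset_rep X (coset_rep X v) = coset_rep X v.
Proof. by move=> sX; apply/eqP; rewrite eq_coset_rep // coset_repP. Qed.

Lemma card_oversubmod X : submod X ->
  (#|[set W : {set E} | `[< submod W >] && (X \subset W)]| <= 2 ^ idx X setT)%N.
Proof.
move=> sX; rewrite /idx -card_powerset.
have inj : {in [set W : {set E} | `[< submod W >] && (X \subset W)] &,
    injective (fun W => coset_rep X @: W)}.
  move=> W W'; rewrite !inE => /andP[/asboolP sW XW] /andP[/asboolP sW' XW'].
  have mem (Y : {set E}) v : submod Y -> X \subset Y ->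
      (v \in Y) = (coset_rep X v \in coset_rep X @: Y).
    move=> sY XY; apply/idP/imsetP => [vY|[y yY /eqP]]; first by exists v.
    rewrite eq_coset_rep // => /(subsetP XY) h.
    by rewrite -(subrK y v) submodD.
  by move=> e; apply/setP => v; rewrite (mem W) // (mem W') // e.
rewrite -(card_in_imset inj); apply: subset_leq_card; apply/subsetP => Y /imsetP[W _ ->].
by rewrite inE; apply: imsetS; apply: subsetT.
Qed.

Lemma card_submodI B B' W W' : submod W -> submod W' ->
  (#|E| <= B * #|W|)%N -> (#|E| <= B' * #|W'|)%N ->
  (#|E| <= (B * B') * #|W :&: W'|)%N.
Proof.
move=> sW sW' cW cW'; have sI := submodI sW sW'; have sT := submodT E.
rewrite -[#|E|]cardsT idx_le ?subsetT //.
have [c [c1 _]] := coset_numbering sW sT (subsetT _) cW.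
have [c' [c1' _]] := coset_numbering sW' sT (subsetT _) cW'.
apply: (@leq_trans #|{: 'I_B * 'I_B'}|); last by rewrite card_prod !card_ord.
have inj : {in coset_rep (W :&: W') @: setT &, injective (fun v => (c v, c' v))}.
  move=> _ _ /imsetP[v _ ->] /imsetP[v' _ ->] [/eqP e1 /eqP e2].
  move: e1 e2; rewrite c1 c1' => e1 e2.
  rewrite -(coset_rep_idem v sI) -(coset_rep_idem v' sI).
  by apply/eqP; rewrite eq_coset_rep // inE e1.
by rewrite /idx -(card_in_imset inj); apply: max_card.
Qed.

End SubmoduleLattice.

Section Tests.
Variables (R : archiRealFieldType) (A : finComNzRingType) (N : finLmodType A).

Section Fixed.
Variables (n m : nat) (f : {ffun 'I_n -> N}).
Local Notation V := ('cV[A]_n).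
Implicit Types (W X : {set V}) (Phi : 'M[A]_(n, m) -> R).

(** [B] and [C] are to stay fixed while [n] grows. The inclusion in [fker f] is recorded because the
    sums over [f] and [W] get exchanged, and only boundedly many [f] vanish on a given [W]. *)
Definition istest (B : nat) (C : R) Phi : Prop := exists om : {set V} -> R,
  [/\ forall W, `|om W| <= C,
      forall W, om W != 0 -> [/\ submod W, W \subset fker f & (#|V| <= B * #|W|)%N] &
      forall M, Phi M = \sum_W om W * (cols_in M W)%:R].

Lemma istest_base : fsurj f -> istest #|N| 1 (fun M => (cols_in M (fker f))%:R).
Proof.
move=> sf; exists (fun W => (W == fker f)%:R); split.
- by move=> W; case: (W =P fker f) => _; rewrite ?normr1 ?normr0.
- move=> W; case: (W =P fker f) => [->|]; last by rewrite eqxx.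
  by move=> _; split; [exact: submod_fker|exact: subxx|rewrite (card_fker sf)].
- move=> M; rewrite (bigD1 (fker f)) //= eqxx mul1r big1 ?addr0 // => W /negbTE ->.
  by rewrite mul0r.
Qed.

Lemma istest_add B B' C C' Phi Psi : istest B C Phi -> istest B' C' Psi ->
  istest (B + B') (C + C') (fun M => Phi M + Psi M).
Proof.
move=> [om [o1 o2 o3]] [om' [o1' o2' o3']]; exists (fun W => om W + om' W); split.
- by move=> W; apply: le_trans (ler_normD _ _) _; apply: lerD.
- move=> W h; have [e|ne] := eqVneq (om W) 0.
    rewrite e add0r in h; have [h1 h2 h3] := o2' _ h; split=> //.
    by apply: leq_trans h3 _; rewrite leq_mul2r leq_addl orbT.
  have [h1 h2 h3] := o2 _ ne; split=> //.
  by apply: leq_trans h3 _; rewrite leq_mul2r leq_addr orbT.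
- by move=> M; rewrite o3 o3' -big_split /=; apply: eq_bigr => W _; rewrite mulrDl.
Qed.

Lemma istest_scale B C c Phi : istest B C Phi -> istest B (`|c| * C) (fun M => c * Phi M).
Proof.
move=> [om [o1 o2 o3]]; exists (fun W => c * om W); split.
- by move=> W; rewrite normrM; apply: ler_wpM2l.
- by move=> W h; apply: o2; apply: contraNneq h => ->; rewrite mulr0.
- by move=> M; rewrite o3 mulr_sumr; apply: eq_bigr => W _; rewrite mulrA.
Qed.

Lemma cols_inI (M : 'M[A]_(n, m)) W W' : cols_in M (W :&: W') = cols_in M W && cols_in M W' :> bool.
Proof.
apply/forallP/andP => [h|[/forallP h1 /forallP h2] c]; last by rewrite inE h1 h2.
by split; apply/forallP => c; have := h c; rewrite inE => /andP[].
Qed.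

(** Indicators multiply by intersecting the submodules, and indices at most multiply. The weights
    stay bounded: both members of a pair with intersection [X] contain [X], which has at most
    [2 ^ (B * B')] overmodules. *)
Lemma istest_mul B B' C C' Phi Psi : istest B C Phi -> istest B' C' Psi ->
  istest (B * B') (C * C' * (2 ^ (B * B') * 2 ^ (B * B'))%:R) (fun M => Phi M * Psi M).
Proof.
move=> [om [o1 o2 o3]] [om' [o1' o2' o3']].
have C0 : 0 <= C by apply: le_trans (o1 set0).
have C0' : 0 <= C' by apply: le_trans (o1' set0).
pose om2 X : R := \sum_(p : {set V} * {set V} | p.1 :&: p.2 == X) om p.1 * om' p.2.
have hom2 X : om2 X != 0 -> [/\ submod X, X \subset fker f & (#|V| <= (B * B') * #|X|)%N].
  move=> h; have /existsP[[W W'] /andP[/eqP <-]] :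
      [exists p : {set V} * {set V}, (p.1 :&: p.2 == X) && (om p.1 * om' p.2 != 0)].
    apply: contraNT h => /existsPn h; apply/eqP; apply: big1 => p pX.
    by have := h p; rewrite pX /= negbK => /eqP.
  rewrite mulf_eq0 negb_or => /andP[/o2[a1 a2 a3] /o2'[b1 b2 b3]] /=; split.
  - exact: submodI.
  - by apply: subset_trans a2; apply: subsetIl.
  - exact: card_submodI.
exists om2; split => // [X|M].
  have [->|/hom2[sX _ cX]] := eqVneq (om2 X) 0.
    by rewrite normr0 !mulr_ge0.
  set O := [set W : {set V} | `[< submod W >] && (X \subset W)].
  have cO : (#|O| <= 2 ^ (B * B'))%N.
    apply: leq_trans (card_oversubmod sX) _; rewrite leq_exp2l //.
    by rewrite -idx_le ?cardsT ?subsetT //; exact: submodT.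
  apply: (@le_trans _ _ (\sum_(p in setX O O) C * C')); last first.
    rewrite sumr_const cardsX -[leLHS]mulr_natr; apply: ler_wpM2l; first exact: mulr_ge0.
    by rewrite ler_nat; apply: leq_mul.
  rewrite /om2; apply: le_trans (ler_norm_sum _ _ _) _.
  rewrite big_mkcond [leRHS]big_mkcond /=; apply: ler_sum => -[W W'] _ /=.
  have CC : 0 <= if (W, W') \in setX O O then C * C' else 0.
    by case: ifP => // _; apply: mulr_ge0.
  case: eqP => // XE; have [->|nz] := eqVneq (om W * om' W') 0; first by rewrite normr0.
  move: (nz); rewrite mulf_eq0 negb_or => /andP[/o2[a1 a2 a3] /o2'[b1 b2 b3]].
  have -> : (W, W') \in setX O O.
    by rewrite !inE -XE subsetIl subsetIr !andbT; apply/andP; split; apply/asboolP.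
  by rewrite normrM; apply: ler_pM.
rewrite o3 o3' big_distrlr /= pair_big /=.
rewrite (partition_big (fun p : {set V} * {set V} => p.1 :&: p.2) xpredT) //=.
apply: eq_bigr => X _; rewrite mulr_suml; apply: eq_bigr => -[W W'] /= /eqP <-.
by rewrite cols_inI mulrACA -natrM mulnb.
Qed.

Lemma card_fun_over W B : submod W -> (#|V| <= B * #|W|)%N ->
  (#|[set g : {ffun 'I_n -> N} | W \subset fker g]| <= #|N| ^ B)%N.
Proof.
move=> sW cW; have sT := submodT V.
have [c [c1 _]] := coset_numbering sW sT (subsetT _) cW.
pose rep (j : 'I_B) : V := odflt 0 [pick v | c v == j].
have repP v : rep (c v) - v \in W.
  rewrite -c1 /rep; case: pickP => [y /eqP -> //|/(_ v)]; by rewrite eqxx.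
have inj : {in [set g : {ffun 'I_n -> N} | W \subset fker g] &,
    injective (fun g : {ffun 'I_n -> N} => [ffun j => linext g (rep j)])}.
  move=> g g'; rewrite !inE => Wg Wg' /ffunP e; apply/ffunP => i.
  have H (g0 : {ffun 'I_n -> N}) : W \subset fker g0 -> g0 i = linext g0 (rep (c (unitv A i))).
    move=> /subsetP/(_ _ (repP (unitv A i))); rewrite inE linextB linext_unitv subr_eq0.
    by move=> /eqP.
  by rewrite !H //; have := e (c (unitv A i)); rewrite !ffunE.
rewrite -(card_in_imset inj); apply: leq_trans (max_card _) _.
by rewrite card_ffun card_ord.
Qed.

End Fixed.

Section Expectation.
Variables (n m : nat).
Local Notation V := ('cV[A]_n).

Definition mxprob (mu : 'I_n -> 'I_m -> A -> R) (M : 'M[A]_(n, m)) : R :=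
  \prod_i \prod_c mu i c (M i c).

Lemma mxprob_cols_in mu (W : {set V}) :
  \sum_M mxprob mu M * (cols_in M W)%:R = prob_cols mu W.
Proof.
rewrite /prob_cols /emask bigA_distr_bigA /=.
rewrite (reindex (fun g : {ffun 'I_m -> V} => \matrix_(i, c) g c i 0)) /=; last first.
  exists (fun M : 'M[A]_(n, m) => [ffun c => col c M]) => [g _|M _].
    by apply/ffunP => c; rewrite ffunE; apply/colP => i; rewrite !mxE.
  by apply/matrixP => i c; rewrite mxE ffunE mxE.
apply: eq_bigr => g _; rewrite big_split /=; congr (_ * _).
  rewrite /mxprob exchange_big /=; apply: eq_bigr => c _; apply: eq_bigr => i _.
  by rewrite mxE.
have colE c : col c (\matrix_(i, c) g c i 0) = g c by apply/colP => i; rewrite !mxE.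
have -> : \prod_i indic R W (0 + mask [set: 'I_n] (g i)) = \prod_(c < m) (g c \in W)%:R.
  by apply: eq_bigr => c _; rewrite add0r maskT.
rewrite /cols_in; case: forallP => [h|/forallP h].
  by rewrite big1 // => c _; have := h c; rewrite colE => ->.
move: h; rewrite negb_forall => /existsP[c]; rewrite colE => /negbTE h.
by rewrite (bigD1 c) //= h mul0r.
Qed.

(** After the exchange of sums, each [W] is charged once for every [f] vanishing on it, that is at
    most [#|N| ^ B] times, with weight at most [C]. *)
Lemma expectation_gap B C (Phi : {ffun 'I_n -> N} -> 'M[A]_(n, m) -> R) mu : 0 <= C ->
  (forall f, fsurj f -> istest f B C (Phi f)) ->
  `|\sum_(f : {ffun 'I_n -> N} | fsurj f)
      (\sum_M mxprob mu M * Phi f M - (\sum_M Phi f M) / (#|V| ^ m)%:R)| <=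
  C * (#|N| ^ B)%:R *
    \sum_(W : {set V} | small_index B W) `|prob_cols mu W - (#|W|%:R / #|V|%:R) ^+ m|.
Proof.
move=> C0 hPhi; apply: le_trans (ler_norm_sum _ _ _) _.
apply: (@le_trans _ _ (\sum_(f : {ffun 'I_n -> N} | fsurj f)
  \sum_(W : {set V} | small_index B W) (W \subset fker f)%:R *
    (C * `|prob_cols mu W - (#|W|%:R / #|V|%:R) ^+ m|))).
  apply: ler_sum => f sf; have [om [o1 o2 o3]] := hPhi f sf.
  have -> : \sum_M mxprob mu M * Phi f M = \sum_W om W * prob_cols mu W.
    under eq_bigr => M _ do rewrite o3 mulr_sumr.
    rewrite exchange_big /=; apply: eq_bigr => W _; rewrite -mxprob_cols_in mulr_sumr.
    by apply: eq_bigr => M _; rewrite mulrCA.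
  have -> : (\sum_M Phi f M) / (#|V| ^ m)%:R = \sum_W om W * (#|W|%:R / #|V|%:R) ^+ m.
    under eq_bigr => M _ do rewrite o3.
    rewrite exchange_big /= mulr_suml; apply: eq_bigr => W _; rewrite -mulr_sumr -mulrA.
    congr (_ * _); rewrite expr_div_n -!natrX; congr (_ / _).
    rewrite -(@card_cols_in A n m W) -sum1_card natr_sum big_mkcond [RHS]big_mkcond /=.
    by apply: eq_bigr => M _; rewrite inE; case: (cols_in M W).
  rewrite -sumrB; apply: le_trans (ler_norm_sum _ _ _) _.
  rewrite [leRHS]big_mkcond /=; apply: ler_sum => W _.
  rewrite -mulrBr normrM; have [->|nz] := eqVneq (om W) 0.
    by rewrite normr0 mul0r; case: ifP => // _; rewrite !mulr_ge0.
  have [sW Wf cW] := o2 _ nz.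
  by rewrite /small_index cW asboolT //= Wf mulr1n mul1r; apply: ler_wpM2r.
rewrite exchange_big /= mulr_sumr; apply: ler_sum => W /andP[/asboolP sW cW].
rewrite -mulr_suml [leRHS]mulrAC [leRHS]mulrC; apply: ler_wpM2r; first by rewrite mulr_ge0.
rewrite -natr_sum ler_nat; apply: leq_trans (card_fun_over sW cW).
rewrite -sum1_card big_mkcond [X in (_ <= X)%N]big_mkcond /=.
apply: leq_sum => f _; rewrite inE; case: ifP => // _; by case: (W \subset _).
Qed.

End Expectation.
End Tests.

(** * Universality over a finite ring *)

Lemma prod_perturb_unit (R : archiRealFieldType) I (r : seq I) (a b rho : I -> R) :
  (forall i, `|a i - b i| <= rho i) -> (forall i, 0 <= b i <= 1) ->
  `|\prod_(i <- r) a i - \prod_(i <- r) b i| <= \prod_(i <- r) (1 + rho i) - 1.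
Proof.
move=> hab b01; have rho0 i : 0 <= rho i by apply: le_trans (hab i).
have b0 i : 0 <= b i by have /andP[] := b01 i.
have b1 i : b i <= 1 by have /andP[] := b01 i.
apply: le_trans (prod_perturb_le r hab b0) _.
have br i : 0 <= b i + rho i by apply: addr_ge0.
elim: r => [|i r IH]; first by rewrite !big_nil !subrr.
have h1 : \prod_(j <- r) b j <= \prod_(j <- r) (b j + rho j).
  by apply: ler_prod => j _; rewrite b0 lerDl rho0.
have h2 : \prod_(j <- r) (b j + rho j) <= \prod_(j <- r) (1 + rho j).
  by apply: ler_prod => j _; rewrite br lerD2r b1.
rewrite !big_cons; move: IH h1 h2.
set P := \prod_(j <- r) (1 + rho j); set Q := \prod_(j <- r) (b j + rho j).
set q := \prod_(j <- r) b j => IH h1 h2.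
have h3 : 0 <= rho i * (P - Q) by rewrite mulr_ge0 ?subr_ge0.
have h4 : b i * (Q - q) <= 1 * (Q - q) by apply: ler_wpM2r; rewrite ?subr_ge0.
move: IH h3 h4; rewrite !mulrBr mul1r !mulrDl !mul1r; lra.
Qed.

Section Assembly.
Variables (R : archiRealFieldType) (A : finComNzRingType) (N : finLmodType A) (k : nat).
Variables (K : 'I_k -> finFieldType) (h : forall i, {rmorphism A -> K i}) (pi : 'I_k -> A).
Hypothesis h_surj : forall i c, exists a, h i a = c.
Hypothesis h_ker : forall i a, h i a = 0 <-> exists b, a = pi i * b.
Hypothesis ann : forall i a, pi i * a = 0 -> forall v : N, a *: v = 0.
Hypothesis idem : forall i, exists a, h i a = 1 /\ forall j, j != i -> h j a = 0.
Hypothesis nil : exists s : seq 'I_k, \prod_(i <- s) pi i = 0.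

Local Notation Th f i M := (Theta h_surj h_ker ann f i M).
Local Notation th f i x := (theta h_surj h_ker ann f i x).
Local Notation q i := #|K i|.

Lemma K_gt1 i : (1 < q i)%N. Proof. exact: card_finNzRing_gt1. Qed.

(** The power of [q i] counts the [v] with [v *m Theta = 0], and for a single [v] this condition
    says that the columns lie in [Wv v], which has index at most [q i] in [ker f]. *)
Lemma istest_corank n m (f : {ffun 'I_n -> N}) i : fsurj f ->
  istest f (#|N| * q i) (q i)%:R
    (fun M : 'M[A]_(n, m) => (cols_in M (fker f))%:R * ((q i)%:R ^+ (n - \rank (Th f i M)) : R)).
Proof.
move=> sf; have sL := submod_fker f; set L := fker f in sL *.
pose Wv (v : 'rV[K i]_n) := [set l in L | th f i l *m v^T == 0].
have WvP v l : (l \in Wv v) = (l \in L) && (th f i l *m v^T == 0) by rewrite inE.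
have sW v : submod (Wv v).
  split.
  - by rewrite WvP submod0 // theta0 mul0mx eqxx.
  - move=> x y; rewrite !WvP => /andP[xL /eqP xv] /andP[yL /eqP yv].
    by rewrite submodD // thetaD // mulmxDl xv yv addr0 eqxx.
  - move=> a x; rewrite !WvP => /andP[xL /eqP xv].
    by rewrite submodZ // thetaZ // -scalemxAl xv scaler0 eqxx.
exists (fun W => #|[set v | Wv v == W]|%:R); split.
- move=> W; rewrite normr_nat ler_nat.
  (* At most [q i] vectors share the same [Wv]: only [v = 0] gives [L]; otherwise [v] is determined
     by its pairing with one [l0] outside [W], functionals with the same kernel being
     proportional. *)
  have [LW|] := boolP (L \subset W).
    apply: (@leq_trans #|[set 0 : 'rV[K i]_n]|); last by rewrite cards1 ltnW ?K_gt1.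
    apply: subset_leq_card; apply/subsetP => v.
    rewrite !inE => /eqP vW; apply/eqP/rowP => j; rewrite mxE.
    have [x xL xE] := theta_surj h_surj h_ker ann f (delta_mx 0 j : 'rV[K i]_n).
    have := subsetP LW x xL; rewrite -vW WvP xL xE /= => /eqP/matrixP/(_ 0 0).
    by rewrite -rowE !mxE.
  case/subsetPn => l0 l0L l0W.
  have inj : {in [set v | Wv v == W] &, injective (fun v : 'rV[K i]_n => (th f i l0 *m v^T) 0 0)}.
    move=> v v'; rewrite !inE => /eqP vW /eqP vW' e.
    set c := (th f i l0 *m v^T) 0 0 in e.
    have c0 : c != 0.
      apply: contraNneq l0W => c0; rewrite -vW WvP l0L /=.
      by apply/eqP; rewrite [LHS]mx11_scalar -/c c0 raddf0.
    apply/rowP => j.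
    have [x xL xE] := theta_surj h_surj h_ker ann f (delta_mx 0 j : 'rV[K i]_n).
    have xv (w : 'rV[K i]_n) : (th f i x *m w^T) 0 0 = w 0 j by rewrite xE -rowE !mxE.
    have [a ha] := @h_surj i (v 0 j / c).
    have yL : x - a *: l0 \in L by apply: submodB => //; apply: submodZ.
    have yE (w : 'rV[K i]_n) : (th f i (x - a *: l0) *m w^T) 0 0 =
        w 0 j - v 0 j / c * (th f i l0 *m w^T) 0 0.
      have E (X Y : 'M[K i]_1) b : (X - b *: Y) 0 0 = X 0 0 - b * Y 0 0 by rewrite !mxE.
      by rewrite thetaB ?submodZ // thetaZ // ha mulmxBl -scalemxAl E xv.
    have : x - a *: l0 \in Wv v.
      rewrite WvP yL; apply/eqP; rewrite [LHS]mx11_scalar yE -/c divfK // subrr.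
      by rewrite raddf0.
    rewrite vW -vW' WvP yL /= => /eqP/matrixP/(_ 0 0); rewrite yE -e divfK // mxE.
    by move/eqP; rewrite subr_eq0 => /eqP.
  by rewrite -(card_in_imset inj); apply: max_card.
- move=> W; rewrite pnatr_eq0 -lt0n => /card_gt0P[v]; rewrite inE => /eqP <-; split=> //.
    by apply/subsetP => x; rewrite WvP => /andP[].
  rewrite (card_fker sf) -mulnA leq_mul2l; apply/orP; right.
  have := @card_additive_image _ 'M[K i]_1 L (fun l => th f i l *m v^T) (submod0 sL)
    (fun x y => @submodB _ _ _ x y sL).
  move=> -> //; last by move=> x y xL yL; rewrite thetaB // mulmxBl.
  apply: leq_mul => //; apply: leq_trans (max_card _) _; by rewrite card_mx.
move=> M.
have cE v : cols_in M (Wv v) = cols_in M L && (v *m Th f i M == 0).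
  apply/forallP/andP => [H|[/forallP ML /eqP vT] c].
    split; first by apply/forallP => c; have := H c; rewrite WvP => /andP[].
    apply/eqP/rowP => c; have := H c; rewrite WvP => /andP[_ /eqP/matrixP/(_ 0 0)].
    by rewrite !mxE => e; rewrite -[RHS]e; apply: eq_bigr => a _; rewrite !mxE mulrC.
  rewrite WvP ML; apply/eqP/matrixP => a b; rewrite !ord1 [RHS]mxE.
  have := congr1 (fun X : 'rV_m => X 0 c) vT; rewrite [RHS]mxE => <-.
  by rewrite !mxE; apply: eq_bigr => j _; rewrite !mxE mulrC.
transitivity (\sum_v (cols_in M (Wv v))%:R : R); last first.
  rewrite (partition_big Wv xpredT) //=; apply: eq_bigr => W _.
  rewrite (eq_bigr (fun=> (cols_in M W)%:R)); last by move=> v /eqP ->.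
  by rewrite sumr_const mulr_natl; congr (_ *+ _); apply: eq_card => v; rewrite inE.
under eq_bigr => v _ do rewrite cE -mulnb natrM.
rewrite -mulr_sumr; congr (_ * _); rewrite -natr_sum -natrX; congr (_%:R).
rewrite -[(n - _)%N]mul1n -(card_left_kernel 1) -sum1_card big_mkcond /=.
by apply: eq_bigr => v _; rewrite inE; case: eqP.
Qed.

Variable u : nat.

(** The order of quantifiers matters: one pair [B], [C] serves all [n] and all surjective [f]. *)
Definition utest (Phi : forall n, {ffun 'I_n -> N} -> 'M[A]_(n, n + u) -> R) :=
  exists B C, 0 <= C /\ forall n (f : {ffun 'I_n -> N}), fsurj f ->
   istest f B C (fun M => (cols_in M (fker f))%:R * Phi n f M).

Lemma istest_ext n m (f : {ffun 'I_n -> N}) B C (Phi Psi : 'M[A]_(n, m) -> R) :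
  Phi =1 Psi -> istest f B C Phi -> istest f B C Psi.
Proof. by move=> e [om [o1 o2 o3]]; exists om; split=> // M; rewrite -e. Qed.

Lemma utest_cst c : utest (fun _ _ _ => c).
Proof.
exists #|N|, (`|c| * 1); split=> [|n f sf]; first by rewrite mulr1.
by apply: istest_ext (istest_scale c (istest_base R _ sf)) => M; rewrite mulrC.
Qed.

Lemma utest_add Phi Psi : utest Phi -> utest Psi ->
  utest (fun n f M => Phi n f M + Psi n f M).
Proof.
move=> [B [C [C0 hP]]] [B' [C' [C0' hP']]].
exists (B + B')%N, (C + C'); split=> [|n f sf]; first exact: addr_ge0.
by apply: istest_ext (istest_add (hP n f sf) (hP' n f sf)) => M; rewrite mulrDr.
Qed.

Lemma utest_mul Phi Psi : utest Phi -> utest Psi ->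
  utest (fun n f M => Phi n f M * Psi n f M).
Proof.
move=> [B [C [C0 hP]]] [B' [C' [C0' hP']]].
exists (B * B')%N, (C * C' * (2 ^ (B * B') * 2 ^ (B * B'))%:R).
split=> [|n f sf]; first by rewrite !mulr_ge0.
apply: istest_ext (istest_mul (hP n f sf) (hP' n f sf)) => M.
by rewrite mulrACA -natrM mulnb andbb.
Qed.

Lemma utest_prod I (r : seq I) (Phi : I -> forall n, {ffun 'I_n -> N} -> 'M[A]_(n, n + u) -> R) :
  (forall i, utest (Phi i)) -> utest (fun n f M => \prod_(i <- r) Phi i n f M).
Proof.
move=> hP; elim: r => [|i r [B [C [C0 IH]]]].
  have [B [C [C0 H]]] := utest_cst 1; exists B, C; split=> // n f sf.
  by apply: istest_ext (H n f sf) => M; rewrite big_nil.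
have [B' [C' [C0' H]]] := utest_mul (hP i) (ex_intro _ B (ex_intro _ C (conj C0 IH))).
exists B', C'; split=> // n f sf.
by apply: istest_ext (H n f sf) => M; rewrite big_cons.
Qed.

Definition qcorank i n (f : {ffun 'I_n -> N}) (M : 'M[A]_(n, n + u)) : R :=
  (q i)%:R ^+ (n - \rank (Th f i M)).

Lemma utest_qcorank i : utest (qcorank i).
Proof. by exists (#|N| * q i)%N, (q i)%:R; split=> // n f sf; apply: istest_corank. Qed.

Lemma utest_affine i a b : utest (fun n f M => (qcorank i f M - a) * b).
Proof.
exact: (utest_mul (utest_add (utest_qcorank i) (utest_cst (- a))) (utest_cst b)).
Qed.

Lemma utest_newton i t : utest (fun n f M => newton (q i) t (qcorank i f M)).
Proof. by apply: utest_prod => j; apply: utest_affine. Qed.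

Lemma utest_newton_tail i t : utest (fun n f M => newton_tail (q i) t (qcorank i f M)).
Proof.
apply: (utest_mul (utest_cst _)); apply: utest_prod => j.
exact: (utest_add (utest_qcorank i) (utest_cst (- _))).
Qed.

Variable eps : R.
Hypothesis eps0 : 0 < eps.
Hypothesis eps1 : eps <= 1 / 2.

Lemma utest_limit Phi : utest Phi -> forall e, 0 < e -> exists n0, forall n, (n0 <= n)%N ->
  forall mu : 'I_n -> 'I_(n + u) -> A -> R, (forall i c, balanced_pmf eps (mu i c)) ->
  `|\sum_(f : {ffun 'I_n -> N} | fsurj f)
      (\sum_M mxprob mu M * ((cols_in M (fker f))%:R * Phi n f M) -
       (\sum_M (cols_in M (fker f))%:R * Phi n f M) / (#|'cV[A]_n| ^ (n + u))%:R)| <= e.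
Proof.
move=> [B [C [C0 hP]]] e e0.
set D := C * (#|N| ^ B)%:R; have D0 : 0 <= D by apply: mulr_ge0.
have D1 : 0 < D + 1 by rewrite ltr_wpDl.
have [n0 H] := subspace_moments A B u eps0 eps1 (divr_gt0 e0 D1).
exists n0 => n hn mu hmu.
apply: le_trans (expectation_gap mu C0 (hP n)) _; rewrite -/D.
apply: (@le_trans _ _ ((D + 1) * (e / (D + 1)))); last first.
  by rewrite mulrC divfK // gt_eqF.
apply: ler_pM => //; first exact: sumr_ge0.
  by rewrite lerDl.
exact: H.
Qed.

Definition euler_partial n : R :=
  \prod_(i < k) \prod_(1 <= j < n.+1) (1 - ((q i)%:R ^+ (u + j))^-1).

Definition surj_count n := #|[set f : {ffun 'I_n -> N} | fsurj f]|.

Lemma row_free_fraction i n :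
  (\sum_(B : 'M[K i]_(n, n + u)) (row_free B)%:R) / #|{: 'M[K i]_(n, n + u)}|%:R =
  \prod_(1 <= j < n.+1) (1 - ((q i)%:R ^+ (u + j))^-1) :> R.
Proof.
have -> : \sum_(B : 'M[K i]_(n, n + u)) (row_free B)%:R =
   (\prod_(j < n) (q i ^ (n + u) - q i ^ j))%N%:R :> R.
  rewrite -card_row_free -sum1_card natr_sum [RHS]big_mkcond /=.
  by apply: eq_bigr => B _; rewrite inE; case: row_free.
have q0 : (q i)%:R != 0 :> R by rewrite pnatr_eq0 -lt0n ltnW // K_gt1.
rewrite card_mx mulnC expnM natr_prod natrX.
have -> : ((q i) ^ (n + u))%:R ^+ n = \prod_(j < n) ((q i) ^ (n + u))%:R :> R.
  by rewrite prodr_const card_ord.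
(* Reversing the order turns the exponents [n + u - j], [0 <= j < n], into [u + j],
   [1 <= j <= n]. *)
rewrite -prodf_div big_add1 /= big_nat_rev /= add0n big_mkord; apply: eq_bigr => j _.
have jn := ltn_ord j.
rewrite natrB ?leq_pexp2l ?(ltnW (K_gt1 i)) //; last first.
  by apply: leq_trans (ltnW jn) (leq_addr _ _).
rewrite mulrBl divff ?pnatr_eq0 ?expn_eq0 -?lt0n; last first.
  by rewrite negb_and -lt0n (ltnW (K_gt1 i)).
congr (1 - _); rewrite !natrX.
have -> : (n + u = j + (u + (n - j.+1).+1))%N by lia.
by rewrite exprD invfM mulrA divff ?mul1r // expf_neq0.
Qed.

Lemma tail_fraction i t n :
  (\sum_(B : 'M[K i]_(n, n + u)) newton_tail (q i) t ((q i)%:R ^+ (n - \rank B))) /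
   #|{: 'M[K i]_(n, n + u)}|%:R <= newton_coef R (q i) t.
Proof.
rewrite ler_pdivrMr; last by rewrite ltr0n; apply/card_gt0P; exists 0.
rewrite /newton_tail -mulr_sumr; apply: ler_wpM2l; first exact: newton_coef_ge0 (K_gt1 i) _.
have -> : \sum_(B : 'M[K i]_(n, n + u))
     \prod_(0 <= j < t.+1) ((q i)%:R ^+ (n - \rank B) - (q i)%:R ^+ j) =
   (\sum_(B : 'M[K i]_(n, n + u)) \prod_(j < t.+1) (q i ^ (n - \rank B) - q i ^ j))%N%:R :> R.
  rewrite natr_sum; apply: eq_bigr => B _; rewrite natr_prod big_mkord.
  (* Natural subtraction truncates, but for [s <= t] both products contain the zero factor
     [j = s]. *)
  set s := (n - _)%N; have [st|ts] := ltnP s t.+1.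
    rewrite (bigD1 (Ordinal st)) //= subrr mul0r (bigD1 (Ordinal st)) //= subnn mul0r //.
  apply: eq_bigr => j _; rewrite natrB ?natrX // leq_pexp2l ?(ltnW (K_gt1 i)) //.
  by apply: leq_trans ts; apply: ltnW.
by rewrite ler_nat card_mx; apply: sum_row_free_kernel_le; apply: leq_addr.
Qed.

Lemma newton_coef_total e : 0 < e -> exists t, \prod_(i < k) (1 + newton_coef R (q i) t) - 1 <= e.
Proof.
move=> e0; set e' := Num.min (e / 2) (1 / 2).
have e'0 : 0 < e' by rewrite lt_min; apply/andP; split; lra.
have k0 : 0 < k.+1%:R :> R by rewrite ltr0n.
have z0 : (0 : R) <= 2^-1 by rewrite invr_ge0.
have z1 : (2^-1 : R) < 1 by lra.
have [t ht] := geometric_small z0 z1 (divr_gt0 e'0 k0).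
exists t.+1; set y : R := 2^-1 ^+ t.
have y0 : 0 <= y by apply: exprn_ge0.
have ky : k%:R * y <= e'.
  have := ht t (leqnn t); rewrite -/y ler_pdivlMr // -natr1 mulrC.
  by move: y0; lra.
have e1 : e' <= e / 2 by rewrite ge_min lexx.
have e2 : e' <= 1 / 2 by rewrite ge_min lexx orbT.
apply: (@le_trans _ _ ((1 + y) ^+ k - 1)).
  rewrite lerB // -[X in _ ^+ X]card_ord -prodr_const; apply: ler_prod => i _.
  rewrite addr_ge0 ?newton_coef_ge0 ?K_gt1 //= lerD2l.
  by apply: newton_coef_le; apply: K_gt1.
have := pow1D_le y0 (le_trans ky e2); move: ky e1; lra.
Qed.

Definition main_test t n (f : {ffun 'I_n -> N}) (M : 'M[A]_(n, n + u)) : R :=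
  \prod_(i < k) newton (q i) t (qcorank i f M).

(** Replacing each of [k] factors in [[0, 1]] by an approximation within [rho i] changes the product
    by at most [\prod (1 + rho i) - 1]; here [rho i] is the Newton tail at the prime [i]. *)
Definition tail_test t n (f : {ffun 'I_n -> N}) (M : 'M[A]_(n, n + u)) : R :=
  \prod_(i < k) (1 + newton_tail (q i) t (qcorank i f M)) - 1.

Lemma utest_main t : utest (@main_test t).
Proof. by apply: utest_prod => i; apply: utest_newton. Qed.

Lemma utest_tail t : utest (@tail_test t).
Proof.
apply: (utest_add _ (utest_cst (-1))); apply: utest_prod => i.
exact: (utest_add (utest_cst 1) (utest_newton_tail i t)).
Qed.

Lemma spanning_error t n (f : {ffun 'I_n -> N}) (M : 'M[A]_(n, n + u)) :
  `|(fker f == mximage M)%:R - (cols_in M (fker f))%:R * main_test t f M| <=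
  (cols_in M (fker f))%:R * tail_test t f M.
Proof.
rewrite (mximage_fker h_surj h_ker ann nil); case: cols_in; last by rewrite !mul0r subrr normr0.
rewrite /= !mul1r distrC.
have -> : [forall i, row_free (Th f i M)]%:R = \prod_(i < k) (row_free (Th f i M))%:R :> R.
  case: forallP => [H|/forallP]; first by rewrite big1 // => i _; rewrite H.
  by rewrite negb_forall => /existsP[i /negbTE H]; rewrite (bigD1 i) //= H mul0r.
apply: prod_perturb_unit => i; last by case: row_free; rewrite ?lexx ?ler01.
have -> : row_free (Th f i M) = ((n - \rank (Th f i M))%N == 0%N).
  by rewrite subn_eq0 /row_free eqn_leq rank_leq_row.
exact: newton_error (K_gt1 i) _ _.
Qed.

Lemma card_quot_pow n m (f : {ffun 'I_n -> N}) : fsurj f ->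
  (#|fker f| ^ m)%:R / (#|'cV[A]_n| ^ m)%:R = ((#|N| ^ m)%:R)^-1 :> R.
Proof.
move=> sf; rewrite (card_fker sf) expnMn natrM invfM mulrCA divff ?mulr1 //.
rewrite pnatr_eq0 expn_eq0 negb_and -lt0n submod_gt0 //; exact: submod_fker.
Qed.

Lemma sum_cols_in n m (W : {set 'cV[A]_n}) (F : 'M[A]_(n, m) -> R) :
  \sum_M (cols_in M W)%:R * F M = \sum_(M | cols_in M W) F M.
Proof.
rewrite [RHS]big_mkcond; apply: eq_bigr => M _.
by case: cols_in; rewrite ?mul1r ?mul0r.
Qed.

Lemma uniform_spanning n (f : {ffun 'I_n -> N}) : fsurj f ->
  (\sum_(M : 'M[A]_(n, n + u)) (fker f == mximage M)%:R) / (#|'cV[A]_n| ^ (n + u))%:R =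
  ((#|N| ^ (n + u))%:R)^-1 * euler_partial n.
Proof.
move=> sf.
have -> : \sum_(M : 'M[A]_(n, n + u)) (fker f == mximage M)%:R =
   \sum_(M : 'M[A]_(n, n + u) | cols_in M (fker f))
      \prod_(i <- index_enum 'I_k) (row_free (Th f i M))%:R :> R.
  rewrite -sum_cols_in; apply: eq_bigr => M _.
  rewrite (mximage_fker h_surj h_ker ann nil) -mulnb natrM; congr (_ * _).
  case: forallP => [H|/forallP]; first by rewrite big1 // => i _; rewrite H.
  by rewrite negb_forall => /existsP[i /negbTE H]; rewrite (bigD1 i) //= H mul0r.
rewrite (uniform_independence h_surj h_ker ann idem f (fun i (B : 'M[K i]_(n, n + u)) => (row_free B)%:R : R));
  last exact: index_enum_uniq.
rewrite mulrAC card_quot_pow //; congr (_ * _).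
by apply: eq_bigr => i _; apply: row_free_fraction.
Qed.

Lemma uniform_tail t n (f : {ffun 'I_n -> N}) : fsurj f ->
  (\sum_(M : 'M[A]_(n, n + u)) (cols_in M (fker f))%:R * tail_test t f M) /
     (#|'cV[A]_n| ^ (n + u))%:R <=
  ((#|N| ^ (n + u))%:R)^-1 * (\prod_(i < k) (1 + newton_coef R (q i) t) - 1).
Proof.
move=> sf; rewrite sum_cols_in sumrB.
rewrite (uniform_independence h_surj h_ker ann idem f
  (fun i (B : 'M[K i]_(n, n + u)) => 1 + newton_tail (q i) t ((q i)%:R ^+ (n - \rank B)) : R));
  last exact: index_enum_uniq.
have -> : \sum_(M : 'M[A]_(n, n + u) | cols_in M (fker f)) 1 = (#|fker f| ^ (n + u))%:R :> R.
  rewrite -card_cols_in -sum1_card natr_sum; apply: eq_bigl => M; by rewrite inE.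
rewrite -{2}[(#|fker f| ^ _)%:R]mulr1 -mulrBr mulrAC card_quot_pow //.
apply: ler_wpM2l; first by rewrite invr_ge0.
rewrite lerB //; apply: ler_prod => i _; apply/andP; split.
  apply: divr_ge0 => //; apply: sumr_ge0 => B _; apply: addr_ge0 => //.
  by apply: le_trans (newton_error R (K_gt1 i) _ _).
rewrite big_split /= mulrDl lerD //; last exact: tail_fraction.
rewrite sumr_const divff // pnatr_eq0 -lt0n; apply/card_gt0P; by exists 0.
Qed.

Theorem finite_universality (e : R) : 0 < e -> exists n0, forall n, (n0 <= n)%N ->
  forall mu : 'I_n -> 'I_(n + u) -> A -> R, (forall i c, balanced_pmf eps (mu i c)) ->
  `|#|module_aut N|%:R * (\sum_M mxprob mu M * (cok_iso N M)%:R) -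
    (surj_count n)%:R / (#|N| ^ (n + u))%:R * euler_partial n| <= e.
Proof.
move=> e0; have e4 : 0 < e / 4 by rewrite divr_gt0.
have [t ht] := newton_coef_total e4; set tau := _ - 1 in ht.
have [n1 H1] := utest_limit (utest_main t) e4.
have [n2 H2] := utest_limit (utest_tail t) e4.
exists (maxn n1 n2) => n; rewrite geq_max => /andP[hn1 hn2] mu hmu.
have {}H1 := H1 n hn1 mu hmu; have {}H2 := H2 n hn2 mu hmu.
set m := (n + u)%N in mu hmu H1 H2 *; set VV := (#|'cV[A]_n| ^ m)%:R in H1 H2 *.
have VV0 : 0 <= VV by [].
have pr0 M : 0 <= mxprob mu M.
  by apply: prodr_ge0 => i _; apply: prodr_ge0 => c _; have [] := hmu i c.
pose I (f : {ffun 'I_n -> N}) (M : 'M[A]_(n, m)) : R := (fker f == mximage M)%:R.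
pose L1 (f : {ffun 'I_n -> N}) (M : 'M[A]_(n, m)) : R := (cols_in M (fker f))%:R.
have -> : #|module_aut N|%:R * (\sum_M mxprob mu M * (cok_iso N M)%:R) =
   \sum_(f : {ffun 'I_n -> N} | fsurj f) \sum_M mxprob mu M * I f M.
  rewrite exchange_big mulr_sumr /=; apply: eq_bigr => M _.
  rewrite -mulr_sumr mulrCA -natrM -card_cok_iso natr_sum [in RHS]big_mkcond /=.
  by congr (_ * _); apply: eq_bigr => f _; rewrite /I; case: (fsurj f).
have -> : (surj_count n)%:R / (#|N| ^ m)%:R * euler_partial n =
   \sum_(f : {ffun 'I_n -> N} | fsurj f) (\sum_M I f M) / VV.
  rewrite (eq_bigr (fun=> ((#|N| ^ m)%:R)^-1 * euler_partial n)); last first.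
    by move=> f sf; apply: uniform_spanning.
  rewrite sumr_const -[RHS]mulr_natl mulrA; congr (_ * _ * _); congr (_%:R).
  by apply: eq_card => f; rewrite inE.
rewrite -sumrB.
pose er (f : {ffun 'I_n -> N}) (M : 'M[A]_(n, m)) := I f M - L1 f M * main_test t f M.
have erb (f : {ffun 'I_n -> N}) (M : 'M[A]_(n, m)) : `|er f M| <= L1 f M * tail_test t f M by apply: spanning_error.
have tail0 (f : {ffun 'I_n -> N}) (M : 'M[A]_(n, m)) : 0 <= L1 f M * tail_test t f M by apply: le_trans (erb f M).
have split_f (f : {ffun 'I_n -> N}) : \sum_M mxprob mu M * I f M - (\sum_M I f M) / VV =
   (\sum_M mxprob mu M * (L1 f M * main_test t f M) - (\sum_M L1 f M * main_test t f M) / VV) +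
   (\sum_M mxprob mu M * er f M - (\sum_M er f M) / VV).
  rewrite addrACA -opprD -mulrDl -!big_split /=.
  congr (_ - _ / _); apply: eq_bigr => M _; rewrite -?mulrDr /er addrC subrK //.
rewrite (eq_bigr _ (fun f _ => split_f f)) big_split /=.
(* Under both laws the error is dominated by the tail test. The sum of the two means of that test is
   their difference, which is small by [utest_limit], plus twice the uniform mean. *)
have er_f (f : {ffun 'I_n -> N}) : `|\sum_M mxprob mu M * er f M - (\sum_M er f M) / VV| <=
   (\sum_M mxprob mu M * (L1 f M * tail_test t f M) - (\sum_M L1 f M * tail_test t f M) / VV) +
   2 * ((\sum_M L1 f M * tail_test t f M) / VV).
  have h1 : `|\sum_M mxprob mu M * er f M| <= \sum_M mxprob mu M * (L1 f M * tail_test t f M).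
    apply: le_trans (ler_norm_sum _ _ _) _; apply: ler_sum => M _.
    by rewrite normrM (ger0_norm (pr0 M)); apply: ler_wpM2l.
  have h2 : `|(\sum_M er f M) / VV| <= (\sum_M L1 f M * tail_test t f M) / VV.
    rewrite normrM normfV (ger0_norm VV0); apply: ler_wpM2r; first by rewrite invr_ge0.
    by apply: le_trans (ler_norm_sum _ _ _) _; apply: ler_sum => M _.
  by apply: le_trans (ler_normB _ _) _; move: h1 h2; lra.
(* There are at most [#|N| ^ n] maps [f], each of weight [#|N| ^ -(n + u)]. *)
have tot : \sum_(f : {ffun 'I_n -> N} | fsurj f) (\sum_M L1 f M * tail_test t f M) / VV <= tau.
  have tau0 : 0 <= tau.
    rewrite subr_ge0; elim/big_ind: _ => // [x y x1 y1|i _].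
      by rewrite -[1]mulr1; apply: ler_pM.
    by rewrite lerDl newton_coef_ge0 // K_gt1.
  apply: (@le_trans _ _ (\sum_(f : {ffun 'I_n -> N} | fsurj f) ((#|N| ^ m)%:R)^-1 * tau)).
    by apply: ler_sum => f sf; apply: uniform_tail.
  rewrite sumr_const -[leLHS]mulr_natl mulrA; apply: ler_piMl => //.
  have N0 : (0 < #|N|)%N by apply/card_gt0P; exists 0.
  rewrite ler_pdivrMr ?ltr0n ?expn_gt0 ?N0 // mul1r ler_nat.
  apply: leq_trans (max_card _) _; rewrite card_ffun card_ord leq_pexp2l //.
  exact: leq_addr.
apply: le_trans (ler_normD _ _) _.
apply: (@le_trans _ _ (e / 4 + (e / 4 + 2 * tau))); last by move: ht; lra.
apply: lerD; first exact: H1.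
apply: le_trans (ler_norm_sum _ _ _) _.
apply: (@le_trans _ _ (\sum_(f : {ffun 'I_n -> N} | fsurj f)
   ((\sum_M mxprob mu M * (L1 f M * tail_test t f M) - (\sum_M L1 f M * tail_test t f M) / VV) +
   2 * ((\sum_M L1 f M * tail_test t f M) / VV)))); first exact: ler_sum.
rewrite big_split /= -mulr_sumr; apply: lerD; last by apply: ler_wpM2l.
by apply: le_trans (ler_norm _) _; apply: H2.
Qed.

End Assembly.

(** * Finite quotients *)

Section FiniteQuotientRing.
Local Open Scope quotient_scope.
Variables (T : GRing.ComNzRing.type) (I : T -> Prop).
Hypothesis I0 : I 0.
Hypothesis ID : forall x y, I x -> I y -> I (x + y).
Hypothesis IM : forall a x, I x -> I (a * x).
Hypothesis I1 : ~ I 1.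
Variable s : seq T.
Hypothesis hs : forall x, exists2 y, y \in s & I (x - y).

Definition idl_pred : {pred T} := fun x => `[< I x >].

Lemma idl_pred_zmod : zmod_closed idl_pred.
Proof.
split=> [|x y /asboolP Ix /asboolP Iy]; apply/asboolP => //.
by apply: ID => //; rewrite -mulN1r; apply: IM.
Qed.

Lemma idl_pred_proper : 1 \notin idl_pred /\ forall a, {in idl_pred, forall x, a * x \in idl_pred}.
Proof.
split; first by apply/asboolP.
by move=> a x /asboolP Ix; apply/asboolP; apply: IM.
Qed.

HB.instance Definition _ := GRing.isZmodClosed.Build T idl_pred idl_pred_zmod.
HB.instance Definition _ := isProperIdeal.Build T idl_pred idl_pred_proper.

Definition qring := {ideal_quot idl_pred}.
HB.instance Definition _ := GRing.ComNzRing.on qring.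

Definition qproj : T -> qring := \pi_qring.

Lemma qproj_eq x y : qproj x = qproj y <-> I (x - y).
Proof.
have := @Quotient.idealrBE T idl_pred x y => e.
split=> [h|h]; first by apply/asboolP; have : x - y \in idl_pred by rewrite e; apply/eqP.
by apply/eqP; rewrite -e; apply/asboolP.
Qed.

Definition qring_enum := undup [seq qproj x | x <- s].

Lemma qring_enumP : forall x : qring, count_mem x qring_enum = 1%N.
Proof.
move=> x; rewrite count_uniq_mem ?undup_uniq // mem_undup.
suff -> : x \in [seq qproj y | y <- s] by [].
rewrite -[x]reprK; have [y ys h] := hs (repr x).
by apply/mapP; exists y => //; apply/qproj_eq.
Qed.

Lemma qring_pickleK :
  pcancel (fun x : qring => index x qring_enum) (fun n => onth qring_enum n).
Proof.
move=> x; have xe : x \in qring_enum.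
  by rewrite -has_pred1 has_count qring_enumP.
by rewrite onthE (nth_map x) ?index_mem // nth_index.
Qed.

HB.instance Definition _ : isCountable qring := PCanIsCountable qring_pickleK.
HB.instance Definition _ := isFinite.Build qring qring_enumP.

Lemma qproj_zmod : zmod_morphism qproj.
Proof. by move=> x y; rewrite /qproj !piE. Qed.

Lemma qproj_monoid : monoid_morphism qproj.
Proof. by split=> [|x y]; rewrite /qproj !piE. Qed.

HB.instance Definition _ := GRing.isZmodMorphism.Build T qring qproj qproj_zmod.
HB.instance Definition _ := GRing.isMonoidMorphism.Build T qring qproj qproj_monoid.

Lemma finite_quotient_ring : exists (B : finComNzRingType) (r : {rmorphism T -> B}),
  (forall b, exists x, r x = b) /\ (forall x, r x = 0 <-> I x).
Proof.
exists qring, qproj; split=> [b|x]; first by exists (repr b); apply: reprK.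
by rewrite -(rmorph0 qproj); split => [/qproj_eq|h]; [|apply/qproj_eq]; rewrite subr0.
Qed.

End FiniteQuotientRing.

Section FiniteField.
Variables (B : finComNzRingType).
Hypothesis hB : forall x : B, x != 0 -> exists y, y * x = 1.

Definition field_of : Type := B.
HB.instance Definition _ := FinRing.ComNzRing.on field_of.

Definition field_of_inv (x : field_of) : field_of :=
  if x == 0 then 0 else odflt 0 [pick y | y * x == 1].

Lemma field_of_mulVf (x : field_of) : x != 0 -> field_of_inv x * x = 1.
Proof.
move=> x0; rewrite /field_of_inv (negbTE x0); case: pickP => [y /eqP //|no].
by have [y hy] := hB x0; have := no y; rewrite hy eqxx.
Qed.

Lemma field_of_invr0 : field_of_inv 0 = 0.
Proof. by rewrite /field_of_inv eqxx. Qed.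

HB.instance Definition _ := GRing.ComNzRing_isField.Build field_of field_of_mulVf field_of_invr0.

Lemma finite_field_of : exists (K : finFieldType) (r : {rmorphism B -> K}), bijective r.
Proof.
exists field_of, (idfun : {rmorphism B -> field_of}).
by exists id.
Qed.
End FiniteField.

Section QuotientModule.
Local Open Scope quotient_scope.
Variables (T : nzRingType) (E : lmodType T) (W : E -> Prop).
Hypothesis W0 : W 0.
Hypothesis W_lin : forall a x y, W x -> W y -> W (a *: x + y).

Definition mod_pred : {pred E} := fun x => `[< W x >].

Lemma mod_pred_zmod : zmod_closed mod_pred.
Proof.
split=> [|x y /asboolP Wx /asboolP Wy]; apply/asboolP => //.
by rewrite addrC -scaleN1r; apply: W_lin.
Qed.

HB.instance Definition _ := GRing.isZmodClosed.Build E mod_pred mod_pred_zmod.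

Definition qmod := Quotient.quot mod_pred.
HB.instance Definition _ := GRing.Zmodule.on qmod.

Definition qmod_proj : E -> qmod := \pi_qmod.

Lemma qmod_proj_eq x y : qmod_proj x = qmod_proj y <-> W (x - y).
Proof.
have := @Quotient.idealrBE E mod_pred x y => e.
split=> [h|h]; first by apply/asboolP; have : x - y \in mod_pred by rewrite e; apply/eqP.
by apply/eqP; rewrite -e; apply/asboolP.
Qed.

Lemma qmod_projD x y : qmod_proj (x + y) = qmod_proj x + qmod_proj y.
Proof. by rewrite /qmod_proj !piE. Qed.

Definition qmod_scale (a : T) (x : qmod) : qmod := qmod_proj (a *: repr x).

Lemma qmod_projK x : qmod_proj (repr x) = x. Proof. exact: reprK. Qed.

Lemma qmod_scale_proj a x : qmod_scale a (qmod_proj x) = qmod_proj (a *: x).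
Proof.
apply/qmod_proj_eq; rewrite -scalerBr -[_ *: _]addr0; apply: W_lin => //.
by apply/qmod_proj_eq; rewrite qmod_projK.
Qed.

Lemma qmod_scalerA a b v : qmod_scale a (qmod_scale b v) = qmod_scale (a * b) v.
Proof. by rewrite -[v]qmod_projK !qmod_scale_proj scalerA. Qed.

Lemma qmod_scale1r : left_id 1 qmod_scale.
Proof. by move=> v; rewrite -[v]qmod_projK !qmod_scale_proj scale1r. Qed.

Lemma qmod_scalerDr : right_distributive qmod_scale +%R.
Proof.
by move=> a v w; rewrite -[v]qmod_projK -[w]qmod_projK -qmod_projD !qmod_scale_proj
  scalerDr qmod_projD.
Qed.

Lemma qmod_scalerDl v : {morph qmod_scale^~ v: a b / a + b}.
Proof.
by move=> a b; rewrite -[v]qmod_projK !qmod_scale_proj scalerDl qmod_projD.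
Qed.

HB.instance Definition _ := GRing.Zmodule_isLmodule.Build T qmod
  qmod_scalerA qmod_scale1r qmod_scalerDr qmod_scalerDl.

(** Provides the targets on which the universal property of the tensor product is tested:
    [N / im phi] and [T^n / (im M + J T^n)]. *)
Lemma quotient_module : exists (Q : lmodType T) (g : E -> Q),
  [/\ forall a x y, g (a *: x + y) = a *: g x + g y,
      forall y, exists x, g x = y & forall x, g x = 0 <-> W x].
Proof.
exists qmod, qmod_proj; split=> [a x y|y|x].
- by rewrite qmod_projD -qmod_scale_proj.
- by exists (repr y); apply: qmod_projK.
have <- : qmod_proj 0 = 0 by rewrite /qmod_proj !piE.
by split => [/qmod_proj_eq|h]; [|apply/qmod_proj_eq]; rewrite subr0.
Qed.

End QuotientModule.

Section ModuleOverQuotient.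
Variables (T : comNzRingType) (A : finComNzRingType) (r : {rmorphism T -> A}) (N : finLmodType T).
Hypothesis r_surj : forall a, exists x, r x = a.
Hypothesis r_ker : forall x, r x = 0 -> forall v : N, x *: v = 0.

Definition desc_mod : Type := N.
HB.instance Definition _ := FinRing.Zmodule.on desc_mod.

Definition desc_lift (a : A) : T := projT1 (cid (r_surj a)).

Lemma desc_liftK a : r (desc_lift a) = a. Proof. by rewrite /desc_lift; case: cid. Qed.

Lemma desc_act x y (v : N) : r x = r y -> x *: v = y *: v.
Proof.
move=> e; apply/eqP; rewrite -subr_eq0 -scalerBl; apply/eqP; apply: r_ker.
by rewrite rmorphB e subrr.
Qed.

Definition desc_scale (a : A) (v : desc_mod) : desc_mod := desc_lift a *: (v : N).

Lemma desc_scalerA a b v : desc_scale a (desc_scale b v) = desc_scale (a * b) v.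
Proof.
by rewrite /desc_scale scalerA; apply: desc_act; rewrite rmorphM !desc_liftK.
Qed.

Lemma desc_scale1r : left_id 1 desc_scale.
Proof. by move=> v; rewrite -[RHS](scale1r (v : N)); apply: desc_act; rewrite desc_liftK rmorph1. Qed.

Lemma desc_scalerDr : right_distributive desc_scale +%R.
Proof. by move=> a v w; rewrite /desc_scale; apply: (scalerDr (desc_lift a) (v : N) w). Qed.

Lemma desc_scalerDl v : {morph desc_scale^~ v: a b / a + b}.
Proof.
move=> a b; rewrite /desc_scale; apply: etrans (scalerDl (v : N) (desc_lift a) (desc_lift b)).
by apply: desc_act; rewrite rmorphD !desc_liftK.
Qed.

HB.instance Definition _ := GRing.Zmodule_isLmodule.Build A desc_mod
  desc_scalerA desc_scale1r desc_scalerDr desc_scalerDl.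

Lemma module_over_quotient : exists (N' : finLmodType A) (g : N -> N'),
  [/\ bijective g, forall v w, g (v + w) = g v + g w & forall x v, g (x *: v) = r x *: g v].
Proof.
exists desc_mod, (fun v : N => v : desc_mod); split=> // [|x v]; first by exists id.
by apply: desc_act; rewrite desc_liftK.
Qed.

End ModuleOverQuotient.

From mathcomp Require Import all_classical all_reals all_analysis.

(** * Nonzero primes of a Dedekind domain *)

Section IdealFacts.
Variable T : comNzRingType.
Implicit Types I J : set T.

Lemma idl0 I : is_idl I -> I 0. Proof. by case. Qed.

Lemma idlD I x y : is_idl I -> I x -> I y -> I (x + y).
Proof. by case=> _ h _; apply: h. Qed.

Lemma idlM I a x : is_idl I -> I x -> I (a * x).
Proof. by case=> _ _; apply. Qed.

Lemma idlMr I a x : is_idl I -> I x -> I (x * a).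
Proof. by rewrite mulrC; apply: idlM. Qed.

Lemma idlN I x : is_idl I -> I x -> I (- x).
Proof. by move=> iI Ix; rewrite -mulN1r; apply: idlM. Qed.

Lemma idlB I x y : is_idl I -> I x -> I y -> I (x - y).
Proof. by move=> iI Ix Iy; apply: idlD => //; apply: idlN. Qed.

Lemma idl_sum I (S : Type) (r : seq S) (F : S -> T) : is_idl I ->
  (forall i, I (F i)) -> I (\sum_(i <- r) F i).
Proof.
by move=> iI h; apply: (big_ind I) => // [|x y]; [apply: idl0|apply: idlD].
Qed.

Lemma idl_cong I x y : is_idl I -> I (x - y) -> I x <-> I y.
Proof.
move=> iI h; split=> [Ix|Iy]; last by rewrite -(subrK y x); apply: idlD.
by have -> : y = x - (x - y); [rewrite subKr|apply: idlB].
Qed.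

Lemma ideal_mul_mem I J x y : I x -> J y -> ideal_mul I J (x * y).
Proof.
move=> Ix Jy; exists [:: (x, y)]; split; last by rewrite big_seq1.
by move=> ab; rewrite inE => /eqP ->.
Qed.

Lemma is_idl_mul I J : is_idl I -> is_idl J -> is_idl (ideal_mul I J).
Proof.
move=> iI iJ; split.
- by exists [::]; split=> //; rewrite big_nil.
- move=> _ _ [s [hs ->]] [s' [hs' ->]]; exists (s ++ s'); split; last by rewrite big_cat.
  by move=> ab; rewrite mem_cat => /orP[/hs|/hs'].
- move=> a _ [s [hs ->]]; exists [seq (a * ab.1, ab.2) | ab <- s]; split.
    by move=> _ /mapP[ab /hs[h1 h2] ->]; split=> //; apply: idlM.
  by rewrite big_map mulr_sumr; apply: eq_bigr => ab _; rewrite mulrA.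
Qed.

Lemma ideal_mul_ind I J (Q : T -> Prop) : Q 0 -> (forall x y, Q x -> Q y -> Q (x + y)) ->
  (forall x y, I x -> J y -> Q (x * y)) -> forall z, ideal_mul I J z -> Q z.
Proof.
move=> Q0 QD QM _ [s [hs ->]]; rewrite big_seq_cond.
by apply: big_ind => // ab /andP[/hs[h1 h2] _]; apply: QM.
Qed.

Lemma is_idl_pow I m : is_idl I -> is_idl (ideal_pow I m).
Proof. by move=> iI; elim: m => [|m IH] //=; apply: is_idl_mul. Qed.

Lemma ideal_mulW I J x : is_idl J -> ideal_mul I J x -> J x.
Proof.
move=> iJ; apply: ideal_mul_ind; [exact: idl0|by move=> *; apply: idlD|].
by move=> y z _ Jz; apply: idlM.
Qed.

Lemma ideal_mulWl I J x : is_idl I -> ideal_mul I J x -> I x.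
Proof.
move=> iI; apply: ideal_mul_ind; [exact: idl0|by move=> *; apply: idlD|].
by move=> y z Iy _; apply: idlMr.
Qed.

Lemma ideal_powW I m m' x : is_idl I -> (m <= m')%N -> ideal_pow I m' x -> ideal_pow I m x.
Proof.
move=> iI; elim: m' => [|m' IH]; first by rewrite leqn0 => /eqP ->.
rewrite leq_eqVlt => /orP[/eqP -> //|mm'] h; apply: IH => //.
by apply: ideal_mulW h; apply: is_idl_pow.
Qed.

Lemma ideal_pow1 I x : is_idl I -> ideal_pow I 1 x <-> I x.
Proof.
move=> iI; split; first exact: ideal_mulWl.
by move=> Ix; rewrite -[x]mulr1; apply: ideal_mul_mem.
Qed.

Lemma ideal_pow_sub I m x : is_idl I -> (0 < m)%N -> ideal_pow I m x -> I x.
Proof. by move=> iI m0 h; apply/(ideal_pow1 _ iI)/ideal_powW/h. Qed.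

Lemma ideal_pow_exp I m x : I x -> ideal_pow I m (x ^+ m).
Proof.
by move=> Ix; elim: m => [|m IH] //=; rewrite exprS; apply: ideal_mul_mem.
Qed.

Lemma prime_expr (p : set T) x m : prime_idl p -> p (x ^+ m) -> p x.
Proof.
move=> [[ip p1] pM]; elim: m => [|m IH]; first by rewrite expr0 => /p1.
by rewrite exprS => /pM[].
Qed.

Lemma prime_prod_notin (p : set T) (S : Type) (r : seq S) (P : pred S) (F : S -> T) : prime_idl p ->
  (forall i, P i -> ~ p (F i)) -> ~ p (\prod_(i <- r | P i) F i).
Proof.
move=> [[ip p1] pM] h; apply: (big_ind (fun x => ~ p x)) => //.
by move=> x y px py /pM[].
Qed.

End IdealFacts.

Section LocalUniformizer.
Variable T : idomainType.
Hypothesis hT : dedekind_domain T.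
Hypothesis hfin : forall J : set T, proper_idl J -> nonzero_idl J -> finite_quotient J.
Variable p : set T.
Hypothesis hp : prime_idl p.
Hypothesis hp0 : nonzero_idl p.

Let ip : is_idl p. Proof. by case: hp => -[]. Qed.
Let p1 : ~ p 1. Proof. by case: hp => -[]. Qed.
Let pM a b : p (a * b) -> p a \/ p b. Proof. by case: hp => _; apply. Qed.
Let pmax : maximal_idl p. Proof. by case: hT => _ _; apply. Qed.

Definition dvdr (b x : T) := exists z, x = b * z.

(** Pigeonhole: [T / bT] is finite, so two powers of [x] agree modulo [b]. *)
Lemma periodic_power b x : p b -> b != 0 ->
  exists j l, (0 < l)%N /\ dvdr b (x ^+ j * (1 - x ^+ l)).
Proof.
move=> pb b0.
have idb : is_idl (dvdr b).
  split; first by exists 0; rewrite mulr0.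
    by move=> _ _ [z ->] [z' ->]; exists (z + z'); rewrite mulrDr.
  by move=> a _ [z ->]; exists (a * z); rewrite mulrCA.
have [s hs] : finite_quotient (dvdr b).
  apply: hfin; last by exists b; split=> //; exists 1; rewrite mulr1.
  by split=> // -[z e]; apply: p1; rewrite e; apply: idlMr.
pose y (i : 'I_(size s).+1) := s2val (cid2 (hs (x ^+ i))).
have ys (i : 'I_(size s).+1) : y i \in s by rewrite /y; case: cid2.
have yb (i : 'I_(size s).+1) : dvdr b (x ^+ i - y i) by rewrite /y; case: cid2.
have : ~ injective y.
  move=> inj; have : (size (codom y) <= size s)%N.
    by apply: uniq_leq_size; [apply/injectiveP|move=> _ /codomP[i ->]].
  by rewrite size_codom card_ord ltnn.
move/existsNP => [i /existsNP[i' /not_implyP[e ne]]].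
wlog lt : i i' e ne / (i < i')%N => [H|].
  have := ltngtP i i'; case=> [lt|lt|ee]; first exact: H lt.
    by apply: (H i' i) => // ee; apply: ne.
  by case: ne; apply: val_inj.
exists i, (i' - i)%N; split; first by rewrite subn_gt0.
have -> : x ^+ i * (1 - x ^+ (i' - i)) = (x ^+ i - y i) - (x ^+ i' - y i').
  by rewrite mulrBr mulr1 -exprD subnKC ?(ltnW lt) // e opprB addrA subrK.
exact: idlB.
Qed.

(** For each [x] in turn, [a] is multiplied by the last power of [x] that keeps it outside [bT]; one
    more factor [x] then lands in [bT]. *)
Lemma kill_generators b (r : seq T) a : ~ dvdr b a ->
  (forall x, x \in r -> exists j, dvdr b (a * x ^+ j)) ->
  exists a', ~ dvdr b (a * a') /\ forall x, x \in r -> dvdr b (a * a' * x).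
Proof.
have dvM z w : dvdr b z -> dvdr b (z * w) by move=> [t ->]; exists (t * w); rewrite mulrA.
elim: r a => [|x r IH] a na h; first by exists 1; rewrite mulr1.
have [j0 hj0] := h x (mem_head _ _).
have ex : exists j, `[< dvdr b (a * x ^+ j) >] by exists j0; apply/asboolP.
have [j /asboolP hj jmin] := ex_minnP ex.
case: j hj jmin => [|j] hj jmin; first by case: na; rewrite expr0 mulr1 in hj.
set a1 := a * x ^+ j.
have na1 : ~ dvdr b a1 by move=> /asboolP/jmin; rewrite ltnn.
have ha1 : dvdr b (a1 * x) by rewrite /a1 -mulrA -exprSr.
have [||a' [na' ha']] := IH a1 => //.
  move=> y yr; have [i hi] := h y (@mem_behead _ (x :: r) y yr); exists i.
  by rewrite /a1 mulrAC; apply: dvM.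
exists (x ^+ j * a'); rewrite mulrA; split=> // y; rewrite inE => /orP[/eqP ->|]; last exact: ha'.
by rewrite mulrAC; apply: dvM.
Qed.

(** The product [a0] of the [1 - x ^+ l x] over generators [x] of [p] is outside [p], hence outside
    [bT], yet a power of each generator carries it into [bT]. *)
Lemma associated_element b : p b -> b != 0 ->
  exists a, ~ dvdr b a /\ forall y, p y -> dvdr b (a * y).
Proof.
move=> pb b0; case: hT => noeth _ _; have [g pg] := noeth p ip.
have gp x : x \in g -> p x.
  move=> xg; rewrite pg; have xi : (index x g < size g)%N by rewrite index_mem.
  exists (fun i => (i == Ordinal xi)%:R).
  rewrite (bigD1 (Ordinal xi)) //= eqxx mul1r nth_index // big1 ?addr0 // => i /negbTE ->.
  by rewrite mul0r.
have hl x : exists l, (0 < l)%N /\ exists j, dvdr b (x ^+ j * (1 - x ^+ l)).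
  by have [j [l [l0 h]]] := periodic_power x pb b0; exists l; split=> //; exists j.
pose l x := projT1 (cid (hl x)).
have l0 x : (0 < l x)%N by rewrite /l; case: cid => ? [].
have lj x : exists j, dvdr b (x ^+ j * (1 - x ^+ l x)) by rewrite /l; case: cid => ? [].
pose a0 := \prod_(x <- g) (1 - x ^+ l x).
have na0 : ~ p a0.
  rewrite /a0 big_seq; apply: prime_prod_notin => // x /gp px h.
  apply: p1; rewrite -(subrK (x ^+ l x) 1); apply: idlD => //.
  by case: (l x) (l0 x) => // m _; rewrite exprSr; apply: idlM.
have [||a' [na' ha']] := @kill_generators b g a0.
- by move=> [z e]; apply: na0; rewrite e; apply: idlMr.
- move=> x xg; have [j [z hz]] := lj x; exists j.
  rewrite /a0 (big_rem x) //=; set q := \prod_(_ <- _) _.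
  by exists (q * z); rewrite mulrAC [_ * x ^+ j]mulrC hz mulrAC -mulrA.
exists (a0 * a'); split=> // y; rewrite pg => -[c ->].
have h i : exists z, a0 * a' * (c i * g`_i) = b * z.
  have [z hz] := ha' g`_i (mem_nth 0 (ltn_ord i)).
  by exists (c i * z); rewrite mulrCA hz mulrCA.
exists (\sum_i projT1 (cid (h i))); rewrite !mulr_sumr; apply: eq_bigr => i _.
by case: cid.
Qed.

(* Cayley-Hamilton: multiplication by [a / b] cannot preserve [p], since [T] is integrally
   closed and [a / b] is not in [T]. *)
Lemma not_stable a b : b != 0 -> ~ dvdr b a ->
  ~ (forall y, p y -> exists2 t, p t & a * y = b * t).
Proof.
move=> b0 nab h; case: hT => noeth intcl _; have [g pg] := noeth p ip.
set n := size g in pg.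
have gp (i : 'I_n) : p g`_i.
  rewrite pg; exists (fun j => (j == i)%:R).
  by rewrite (bigD1 i) //= eqxx mul1r big1 ?addr0 // => j /negbTE ->; rewrite mul0r.
have hm (i : 'I_n) : exists m : 'I_n -> T, a * g`_i = b * \sum_j m j * g`_j.
  have [t pt e] := h _ (gp i); move: pt; rewrite pg => -[c tc]; exists c.
  by rewrite e tc.
pose M : 'M[T]_n := \matrix_(i, j) projT1 (cid (hm j)) i.
have ME (j : 'I_n) : a * g`_j = b * \sum_i M i j * g`_i.
  rewrite (eq_bigr (fun i : 'I_n => projT1 (cid (hm j)) i * g`_i)); first by case: cid.
  by move=> i _; rewrite mxE.
pose c : {fraction T} := tofrac a / tofrac b.
have bF : tofrac b != 0 by rewrite tofrac_eq0.
have : root (char_poly (map_mx (@tofrac T) M)) c.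
  rewrite -eigenvalue_root_char; apply/eigenvalueP.
  exists (\row_i tofrac g`_i).
    apply/rowP => j; rewrite !mxE.
    have -> : \sum_i (\row_i0 tofrac g`_i0) 0 i * map_mx (@tofrac T) M i j =
       tofrac (\sum_i M i j * g`_i).
      by rewrite rmorph_sum; apply: eq_bigr => i _; rewrite !mxE rmorphM mulrC.
    by apply: (mulfI bF); rewrite -rmorphM -ME rmorphM mulrA /c; congr (_ * _); rewrite mulrC divfK.
  apply/eqP => /rowP r0; have [x []] := hp0; rewrite pg => -[d ->] /eqP; apply.
  rewrite big1 // => i _; have := r0 i; rewrite !mxE => /eqP.
  by rewrite tofrac_eq0 => /eqP ->; rewrite mulr0.
rewrite /root horner_coef size_char_poly -map_char_poly big_ord_recr /=.
have lead : (char_poly M)`_n = 1.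
  by have := char_poly_monic M; rewrite monicE /lead_coef size_char_poly => /eqP.
rewrite coef_map lead /= rmorph1 mul1r => /eqP e.
apply: nab; suff [t ->] : exists t, a = t * b by exists t; rewrite mulrC.
apply: intcl => //; exists n, (fun i : 'I_n => (char_poly M)`_i).
apply/eqP; rewrite -tofrac_eq0 rmorphD rmorph_sum /= addrC.
have bn : tofrac b ^+ n != 0 by rewrite expf_neq0.
apply/eqP; have := congr1 (fun z => z * tofrac b ^+ n) e; rewrite mul0r mulrDl => e'.
rewrite -[RHS]e'.
congr (_ + _); last by rewrite /c expr_div_n divfK // rmorphXn.
rewrite mulr_suml; apply: eq_bigr => i _; rewrite coef_map /= !rmorphM !rmorphXn -!mulrA.
congr (_ * _); rewrite /c expr_div_n -mulrA; congr (_ * _).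
have -> : tofrac b ^+ n = tofrac b ^+ i * tofrac b ^+ (n - i).
  by rewrite -exprD subnKC // ltnW.
by rewrite mulrA mulVf ?mul1r // expf_neq0.
Qed.

(** In the fraction field, [c = a / b] satisfies [c p] inside [T], but not inside [p] by
    [not_stable]. So [c x = s] is outside [p] for some [x] in [p], and [s y = x (c y)] for all [y]
    in [p]: [x] generates [p] locally. *)
Lemma locally_principal : exists pi s, [/\ p pi, ~ p s, pi != 0 &
  forall y, p y -> exists z, s * y = pi * z].
Proof.
have [b [pb b0]] := hp0; have [a [na ha]] := associated_element pb b0.
have := not_stable b0 na; move/existsNP => [x /not_implyP[px hx]].
have [s e] := ha x px.
have ns : ~ p s by move=> ps; apply: hx; exists s.
exists x, s; split=> //.
  apply/eqP => x0; move: e; rewrite x0 mulr0 => /esym/eqP; rewrite mulf_eq0 (negbTE b0) /=.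
  by move=> /eqP s0; apply: ns; rewrite s0; apply: idl0.
move=> y py; have [z hz] := ha y py; exists z.
by apply: (mulfI b0); rewrite !mulrA -e mulrAC hz mulrAC.
Qed.

(** From [1 = y + z a] with [y] in [p], the truncated geometric series [S] in [y] gives
    [S z a = 1 - y ^+ m]. *)
Lemma inverse_mod_pow a m : ~ p a -> exists t, ideal_pow p m (t * a - 1).
Proof.
move=> pa; pose J : set T := fun x => exists y z, p y /\ x = y + z * a.
have iJ : is_idl J.
  split; first by exists 0, 0; split; [exact: idl0|rewrite mul0r addr0].
    move=> _ _ [y [z [py ->]]] [y' [z' [py' ->]]]; exists (y + y'), (z + z').
    by split; [exact: idlD|rewrite mulrDl addrACA].
  move=> c _ [y [z [py ->]]]; exists (c * y), (c * z); split; first exact: idlM.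
  by rewrite mulrDr mulrA.
case: pmax => _ /(_ J iJ)[|JE|JT].
- by move=> x px; exists x, 0; rewrite mul0r addr0.
- by case: pa; rewrite -JE; exists 0, 1; split; [exact: idl0|rewrite add0r mul1r].
have [y [z [py e]]] : J 1 by rewrite JT.
set S := \sum_(i < m) y ^+ i; exists (S * z).
have za : z * a = 1 - y by rewrite e addrC addKr.
have -> : S * z * a - 1 = - (y ^+ m).
  have -> : S * z * a - 1 = - ((y - 1) * S) - 1 by rewrite -mulrA za; ring.
  by rewrite -subrX1; ring.
by apply: idlN; [apply: is_idl_pow|apply: ideal_pow_exp].
Qed.

Lemma cancel_unit_mod_pow a b m : ~ p a -> ideal_pow p m (a * b) -> ideal_pow p m b.
Proof.
move=> pa h; have [t ht] := inverse_mod_pow m pa; have ipm := is_idl_pow m ip.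
have -> : b = t * (a * b) - b * (t * a - 1) by ring.
by apply: idlB => //; apply: idlM.
Qed.

Section Uniformizer.
Variables (pi s : T).
Hypotheses (ppi : p pi) (ps : ~ p s) (pi0 : pi != 0).
Hypothesis hps : forall y, p y -> exists z, s * y = pi * z.

Lemma pow_principal m y : ideal_pow p m y -> exists z, s ^+ m * y = pi ^+ m * z.
Proof.
elim: m y => [|m IH] y; first by exists y; rewrite !expr0.
move: y; apply: ideal_mul_ind.
- by exists 0; rewrite !mulr0.
- by move=> x y [z hz] [z' hz']; exists (z + z'); rewrite !mulrDr hz hz'.
move=> x y px /IH[w hw]; have [z hz] := hps px; exists (z * w).
have -> : s ^+ m.+1 * (x * y) = (s * x) * (s ^+ m * y) by rewrite exprS; ring.
by rewrite hz hw exprS; ring.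
Qed.

Lemma s_pow_notin m : ~ p (s ^+ m). Proof. by move/(prime_expr hp). Qed.

(** Cancelling [pi] costs one exponent; this is the loss that the spare power in [modulus] pays
    for. *)
Lemma pow_cancel_uniformizer m a : ideal_pow p m.+1 (pi * a) -> ideal_pow p m a.
Proof.
move=> /pow_principal[z]; rewrite mulrCA [pi ^+ _]exprS -mulrA => /(mulfI pi0) h.
apply: (@cancel_unit_mod_pow (s ^+ m.+1)); first exact: s_pow_notin.
rewrite h; apply: idlMr; first exact: is_idl_pow.
exact: ideal_pow_exp.
Qed.

Lemma pow_cancel_uniformizers e m a : ideal_pow p (m + e) (pi ^+ e * a) -> ideal_pow p m a.
Proof.
elim: e m a => [|e IH] m a; first by rewrite addn0 expr0 mul1r.
by rewrite addnS exprS -mulrA => /pow_cancel_uniformizer/IH.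
Qed.

Lemma divide_by_uniformizers e b m : ideal_pow p e b ->
  exists y, ideal_pow p m (b - pi ^+ e * y).
Proof.
move=> /pow_principal[z hz]; have [t ht] := inverse_mod_pow m (@s_pow_notin e).
exists (t * z); have -> : b - pi ^+ e * (t * z) = - (b * (t * s ^+ e - 1)).
  by rewrite mulrCA -hz; ring.
by apply: idlN; [apply: is_idl_pow|apply: idlM => //; apply: is_idl_pow].
Qed.

End Uniformizer.
End LocalUniformizer.

(** * The quotient by a product of prime powers *)

Section FactorMorphism.
Variables (T A K : nzRingType) (r : {rmorphism T -> A}) (g : {rmorphism T -> K}).
Hypothesis r_surj : forall a, exists x, r x = a.
Hypothesis r_g : forall x, r x = 0 -> g x = 0.

Definition factor (a : A) : K := g (projT1 (cid (r_surj a))).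

Lemma factorE x : factor (r x) = g x.
Proof.
rewrite /factor; case: cid => y /= e; apply/eqP; rewrite -subr_eq0 -rmorphB; apply/eqP/r_g.
by rewrite rmorphB e subrr.
Qed.

Lemma factor_zmod : zmod_morphism factor.
Proof.
move=> a b; have [x <-] := r_surj a; have [y <-] := r_surj b.
by rewrite -rmorphB !factorE rmorphB.
Qed.

Lemma factor_monoid : monoid_morphism factor.
Proof.
split=> [|a b]; first by rewrite -(rmorph1 r) factorE rmorph1.
have [x <-] := r_surj a; have [y <-] := r_surj b.
by rewrite -rmorphM !factorE rmorphM.
Qed.

HB.instance Definition _ := GRing.isZmodMorphism.Build A K factor factor_zmod.
HB.instance Definition _ := GRing.isMonoidMorphism.Build A K factor factor_monoid.

Lemma factor_morphism : exists h : {rmorphism A -> K}, forall x, h (r x) = g x.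
Proof. by exists factor => x; apply: factorE. Qed.

End FactorMorphism.

Section ManyPrimeIdeals.
Variable T : idomainType.
Hypothesis hT : dedekind_domain T.
Hypothesis hfin : forall J : set T, proper_idl J -> nonzero_idl J -> finite_quotient J.
Variables (k : nat) (p : 'I_k -> set T).
Hypothesis hp : forall i, prime_idl (p i) /\ nonzero_idl (p i).
Hypothesis hpinj : injective p.

Let pr i : prime_idl (p i). Proof. by case: (hp i). Qed.
Let ip i : is_idl (p i). Proof. by case: (pr i) => -[]. Qed.
Let ipw i m : is_idl (ideal_pow (p i) m). Proof. exact: is_idl_pow. Qed.

Lemma separate_primes i j : j != i -> exists2 x, p j x & ~ p i x.
Proof.
move=> ji; apply: contrapT => no.
have sub : (p j `<=` p i)%classic.
  by move=> x px; apply: contrapT => nx; apply: no; exists x.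
have [_ _ /(_ _ (pr j) (proj2 (hp j)))[_ pmax]] := hT.
have [e|e] := pmax (p i) (ip i) sub.
- by case/eqP: ji; apply: hpinj; rewrite e.
- by case: (pr i) => -[_ n1] _; apply: n1; rewrite e.
Qed.

Lemma separators i : exists x : 'I_k -> T, forall j, j != i -> p j (x j) /\ ~ p i (x j).
Proof.
have H j : exists x, j != i -> p j x /\ ~ p i x.
  have [->|ji] := eqVneq j i; first by exists 0.
  by have [x h1 h2] := separate_primes ji; exists x.
by exists (fun j => projT1 (cid (H j))) => j; case: cid.
Qed.

Lemma crt_idempotent (E : 'I_k -> nat) i : exists x, ideal_pow (p i) (E i) (x - 1) /\
  forall j, j != i -> ideal_pow (p j) (E j) x.
Proof.
have [x xP] := separators i.
pose w := \prod_(j | j != i) (x j ^+ E j).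
have nw : ~ p i w.
  by apply: prime_prod_notin => // j /xP[_ h] /(prime_expr (pr i)).
have [t ht] := inverse_mod_pow hT (pr i) (proj2 (hp i)) (E i) nw.
exists (t * w); split=> // j ji; apply: idlM => //.
rewrite /w (bigD1 j) //=; apply: idlMr => //.
by apply: ideal_pow_exp; case: (xP j ji).
Qed.

(** [N] is given as killed by a product, while the sequel works with intersections. In the
    induction, [t * w] is 1 modulo the first power and lies in the product of the others, so both
    terms of [x = x (t w) - (t w - 1) x] are in the full product. *)
Lemma mem_ideal_prod (e : 'I_k -> nat) x : (forall i, ideal_pow (p i) (e i) x) ->
  ideal_prod (fun i => ideal_pow (p i) (e i)) x.
Proof.
rewrite /ideal_prod => hx; set f := fun i => ideal_pow (p i) (e i).
pose F (l : seq 'I_k) := foldr ideal_mul [set: T]%classic [seq f i | i <- l].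
have iF l : is_idl (F l).
  by elim: l => [|i l IH] //=; apply: is_idl_mul => //; apply: ipw.
have Fprod (y : 'I_k -> T) l : (forall j, j \in l -> f j (y j)) -> F l (\prod_(j <- l) y j).
  elim: l => [|j l IH] // hy; rewrite big_cons; apply: ideal_mul_mem.
    by apply: hy; apply: mem_head.
  by apply: IH => j' j'l; apply: hy; rewrite inE j'l orbT.
suff : forall l : seq 'I_k, uniq l -> F l x by apply; apply: enum_uniq.
elim=> [|i l IH] //= /andP[il /IH xl].
have [y yP] := separators i; set w := \prod_(j <- l) (y j ^+ e j).
have jl_i j : j \in l -> j != i by move=> jl; apply: contraNneq il => <-.
have Fw : F l w.
  by apply: Fprod => j /jl_i ji; apply: ideal_pow_exp; case: (yP j ji).
have nw : ~ p i w.
  rewrite /w big_seq; apply: prime_prod_notin => // j /jl_i /yP[_ h].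
  by move/(prime_expr (pr i)).
have [t ht] := inverse_mod_pow hT (pr i) (proj2 (hp i)) (e i) nw.
have -> : x = x * (t * w) - (t * w - 1) * x by ring.
have iP : is_idl (ideal_mul (f i) (F l)) by apply: is_idl_mul => //; apply: ipw.
apply: idlB => //; apply: ideal_mul_mem => //.
by apply: idlM => //; apply: iF.
Qed.

Lemma is_idl_inter (E : 'I_k -> nat) : is_idl (fun x => forall i, ideal_pow (p i) (E i) x).
Proof.
split=> [i|x y hx hy i|a x hx i]; first exact: idl0.
  by apply: idlD.
by apply: idlM.
Qed.

Lemma choose_uniformizers : exists (pi s : 'I_k -> T), forall i,
  [/\ p i (pi i), ~ p i (s i), pi i != 0 & forall y, p i y -> exists z, s i * y = pi i * z].
Proof.
have H i := locally_principal hT hfin (pr i) (proj2 (hp i)).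
exists (fun i => projT1 (cid (H i))), (fun i => projT1 (cid (projT2 (cid (H i))))) => i.
by case: (cid (projT2 (cid (H i)))).
Qed.

Lemma residue_field i : exists (K : finFieldType) (r : {rmorphism T -> K}),
  (forall c, exists x, r x = c) /\ forall x, r x = 0 <-> p i x.
Proof.
have [s hs] : finite_quotient (p i).
  by apply: hfin; [case: (pr i)|case: (hp i)].
have n1 : ~ p i 1 by case: (pr i) => -[].
have [B [r [rs rk]]] := finite_quotient_ring (idl0 (ip i)) (fun x y => @idlD _ _ x y (ip i))
  (fun a x => @idlM _ _ a x (ip i)) n1 hs.
have hB (b : B) : b != 0 -> exists c, c * b = 1.
  have [a <-] := rs b => ra; have na : ~ p i a by move/rk => e; rewrite e eqxx in ra.
  have [t ht] := inverse_mod_pow hT (pr i) (proj2 (hp i)) 1 na.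
  exists (r t); apply/eqP; rewrite -subr_eq0 -rmorphM -[X in _ - X](rmorph1 r) -rmorphB.
  by apply/eqP/rk/(ideal_pow1 _ (ip i)).
have [K [g [g' gK Kg]]] := finite_field_of hB.
exists K, (g \o r : {rmorphism T -> K}); split=> [c|x].
  by have [x hx] := rs (g' c); exists x; rewrite /= hx Kg.
rewrite /= -rk -(rmorph0 g); split=> [/(can_inj gK)|->] //.
Qed.

Lemma card_residue_field i (K : finFieldType) (r : {rmorphism T -> K}) q :
  (forall c, exists x, r x = c) -> (forall x, r x = 0 <-> p i x) ->
  quotient_card (p i) q -> #|K| = q.
Proof.
move=> rs rk [s [<- h1 h2]].
have e : perm_eq (enum K) [seq r x | x <- s].
  apply: uniq_perm; first exact: enum_uniq.
    apply/(uniqP 0) => a b; rewrite !inE !size_map => ha hb.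
    rewrite !(nth_map 0) // => /eqP; rewrite -subr_eq0 -rmorphB => /eqP/rk h.
    by have /(congr1 val) := h2 (Ordinal ha) (Ordinal hb) h.
  move=> c; rewrite mem_enum inE; apply/esym/mapP; have [x <-] := rs c.
  have [y ys h] := h1 x; exists y => //.
  by apply/eqP; rewrite -subr_eq0 -rmorphB; apply/eqP/rk.
by rewrite cardE (perm_size e) size_map.
Qed.

End ManyPrimeIdeals.

Section Reduction.
Variable T : idomainType.
Hypothesis hT : dedekind_domain T.
Hypothesis hfin : forall J : set T, proper_idl J -> nonzero_idl J -> finite_quotient J.
Variables (k : nat) (p : 'I_k -> set T).
Hypothesis hp : forall i, prime_idl (p i) /\ nonzero_idl (p i).
Hypothesis hpinj : injective p.
Variables (e : 'I_k -> nat) (q : 'I_k -> nat).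
Hypothesis hq : forall i, quotient_card (p i) (q i).
Hypothesis k0 : (0 < k)%N.

Let pr i : prime_idl (p i). Proof. by case: (hp i). Qed.
Let ip i : is_idl (p i). Proof. by case: (pr i) => -[]. Qed.
Let ipw i m : is_idl (ideal_pow (p i) m). Proof. exact: is_idl_pow. Qed.

Definition modulus : set T := fun x => forall i, ideal_pow (p i) (e i).+1 x.

Lemma is_idl_modulus : is_idl modulus.
Proof. exact: (is_idl_inter hp (fun i => (e i).+1)). Qed.

Lemma modulus_nonzero : nonzero_idl modulus.
Proof.
have [pi [s h]] := choose_uniformizers hT hfin hp.
exists (\prod_i pi i ^+ (e i).+1); split; last first.
  by apply/prodf_neq0 => i _; rewrite expf_neq0 //; case: (h i).
move=> i; rewrite (bigD1 i) //; apply: (idlMr _ (ipw _ _)); apply: ideal_pow_exp.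
by case: (h i).
Qed.

Lemma modulus_finite : finite_quotient modulus.
Proof.
apply: hfin modulus_nonzero; split; first exact: is_idl_modulus.
move=> /(_ (Ordinal k0)); set i := Ordinal k0 => /(ideal_pow_sub (ip i) (ltn0Sn _)).
by case: (pr i) => -[].
Qed.

Theorem reduction_data :
  exists (A : finComNzRingType) (r : {rmorphism T -> A}) (K : 'I_k -> finFieldType)
    (h : forall i, {rmorphism A -> K i}) (pi : 'I_k -> A),
  [/\ forall a, exists x, r x = a, forall x, r x = 0 <-> modulus x &
      forall i a, pi i * r a = 0 -> forall j, ideal_pow (p j) (e j) a] /\
  [/\ forall i c, exists a, h i a = c, forall i a, h i a = 0 <-> exists b, a = pi i * b,
      forall i, exists a, h i a = 1 /\ forall j, j != i -> h j a = 0,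
      exists s : seq 'I_k, \prod_(i <- s) pi i = 0 & forall i, #|K i| = q i].
Proof.
have iJ := is_idl_modulus.
have [sJ hsJ] := modulus_finite.
have nJ : ~ modulus 1.
  move=> /(_ (Ordinal k0)); set i := Ordinal k0 => /(ideal_pow_sub (ip i) (ltn0Sn _)).
  by case: (pr i) => -[].
have [A [r [rs rk]]] := finite_quotient_ring (idl0 iJ) (fun x y => @idlD _ _ x y iJ)
  (fun a x => @idlM _ _ a x iJ) nJ hsJ.
have F i := residue_field hT hfin hp i.
pose K i := projT1 (cid (F i)).
pose g i : {rmorphism T -> K i} := projT1 (cid (projT2 (cid (F i)))).
have gP i : (forall c, exists x, g i x = c) /\ forall x, g i x = 0 <-> p i x.
  exact: (projT2 (cid (projT2 (cid (F i))))).
have rg i x : r x = 0 -> g i x = 0.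
  by move/rk/(_ i)/(ideal_pow_sub (ip i) (ltn0Sn _)) => h; apply/(gP i).2.
have H i := factor_morphism rs (rg i).
pose h i : {rmorphism A -> K i} := projT1 (cid (H i)).
have hE i x : h i (r x) = g i x by exact: (projT2 (cid (H i)) x).
have [pi [s up]] := choose_uniformizers hT hfin hp.
have C i := crt_idempotent hT hp hpinj (fun i => (e i).+1) i.
pose ep i := projT1 (cid (C i)).
have ep1 i : ideal_pow (p i) (e i).+1 (ep i - 1) by rewrite /ep; case: cid => ? [].
have ep0 i j : j != i -> ideal_pow (p j) (e j).+1 (ep i).
  by have [_] := projT2 (cid (C i)); apply.
(* Chinese remainders: [Pi i] behaves like [pi i] at [p i] and like 1 at the other primes. Its class
   generates the kernel of [h i] in [A], although [p i] need not be principal in [T]. *)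
pose Pi i := ep i * pi i + (1 - ep i).
have Pi_i i : ideal_pow (p i) (e i).+1 (Pi i - pi i).
  have -> : Pi i - pi i = (pi i - 1) * (ep i - 1) by rewrite /Pi; ring.
  exact: idlM.
have Pi_j i j : j != i -> ideal_pow (p j) (e j).+1 (Pi i - 1).
  move=> ji; have -> : Pi i - 1 = (pi i - 1) * ep i by rewrite /Pi; ring.
  by apply: idlM => //; apply: ep0.
have Pip i : p i (Pi i).
  apply/(idl_cong (ip i) (ideal_pow_sub (ip i) (ltn0Sn _) (Pi_i i))).2.
  by case: (up i).
exists A, r, K, h, (fun i => r (Pi i)); split; split=> //.
- move=> i a; rewrite -rmorphM => /rk hJ j; have [ji|ji] := eqVneq j i.
    rewrite ji; have [h1 h2 h3 h4] := up i.
    apply: (pow_cancel_uniformizer hT (pr i) (proj2 (hp i)) h1 h2 h3 h4).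
    apply/(idl_cong (ipw i _) _).2/(hJ i).
    by have := idlMr (-a) (ipw i _) (Pi_i i); congr (ideal_pow _ _ _); ring.
  apply: (ideal_powW (ip j) (leqnSn _)).
  apply/(idl_cong (ipw j _) _).1/(hJ j).
  by have := idlMr a (ipw j _) (Pi_j i j ji); congr (ideal_pow _ _ _); ring.
- by move=> i c; have [x <-] := (gP i).1 c; exists (r x).
- move=> i a; split=> [|[b ->]]; last first.
    by rewrite rmorphM hE; have -> : g i (Pi i) = 0; [apply/(gP i).2|rewrite mul0r].
  have [x <-] := rs a; rewrite hE => /(gP i).2/(ideal_pow1 _ (ip i)) px.
  have [h1 h2 h3 h4] := up i.
  have [y hy] := divide_by_uniformizers hT (pr i) (proj2 (hp i)) h2 h4 (e i).+1 px.
  (* The quotient of [x] by [Pi i] is [y] at [p i], and [x] itself at the other primes, where [Pi i]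
     is 1. *)
  exists (r (ep i * y + (1 - ep i) * x)); rewrite -rmorphM; apply/eqP.
  rewrite -subr_eq0 -rmorphB; apply/eqP/rk => j; have [ji|ji] := eqVneq j i.
    rewrite ji expr1 in hy *.
    have -> : x - Pi i * (ep i * y + (1 - ep i) * x) =
      (x - pi i * y) - (Pi i - pi i) * y - (Pi i * (y - x)) * (ep i - 1) by ring.
    by apply: idlB => //; [apply: idlB => //; apply: idlMr|apply: idlM].
  have -> : x - Pi i * (ep i * y + (1 - ep i) * x) =
    Pi i * (x - y) * ep i - (Pi i - 1) * x by ring.
  by apply: idlB => //; [apply: idlM => //; apply: ep0|apply: idlMr => //; apply: Pi_j].
- move=> i; exists (r (ep i)); rewrite hE; split.
    apply/eqP; rewrite -subr_eq0 -[X in _ - X](rmorph1 (g i)) -rmorphB; apply/eqP/(gP i).2.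
    exact: (ideal_pow_sub (ip i) (ltn0Sn _) (ep1 i)).
  by move=> j ji; rewrite hE; apply/(gP j).2/(ideal_pow_sub (ip j) (ltn0Sn _))/ep0.
(* Each round over all primes gains a power of every [p i], and [m] is at least each exponent of the
   modulus. *)
- pose m := (\sum_i (e i).+1)%N.
  exists (flatten (nseq m (enum 'I_k))).
  have -> : \prod_(i <- flatten (nseq m (enum 'I_k))) r (Pi i) = r ((\prod_i Pi i) ^+ m).
    rewrite rmorphXn rmorph_prod; elim: m => [|m IH] /=; first by rewrite big_nil expr0.
    by rewrite big_cat /= IH exprS big_enum.
  apply/rk => i; apply: (@ideal_powW _ _ _ m) => //.
    by rewrite /m (bigD1 i) //= leq_addr.
  by rewrite (bigD1 i) //; apply: ideal_pow_exp; apply: idlMr.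
- by move=> i; apply: (card_residue_field (gP i).1 (gP i).2).
Qed.

End Reduction.

(** * The tensor product *)

Lemma ideal_pow_addn (T : comNzRingType) (I : set T) a b x : is_idl I ->
  ideal_pow I (a + b) x -> ideal_mul (ideal_pow I a) (ideal_pow I b) x.
Proof.
move=> iI; elim: a x => [|a IH] x h.
  by rewrite -[x]mul1r; apply: ideal_mul_mem.
have iM := is_idl_mul (is_idl_pow a.+1 iI) (is_idl_pow b iI).
move: x h; rewrite addSn; apply: ideal_mul_ind; [exact: idl0|by move=> *; apply: idlD|].
move=> x y Ix /IH; move: y; apply: ideal_mul_ind.
- by rewrite mulr0; apply: idl0.
- by move=> y z; rewrite mulrDr; apply: idlD.
by move=> y z hy hz; rewrite mulrA; apply: ideal_mul_mem => //; apply: ideal_mul_mem.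
Qed.

Section Tensor.
Variable T : idomainType.
Hypothesis hT : dedekind_domain T.
Hypothesis hfin : forall J : set T, proper_idl J -> nonzero_idl J -> finite_quotient J.
Variables (k : nat) (p : 'I_k -> set T).
Hypothesis hp : forall i, prime_idl (p i) /\ nonzero_idl (p i).
Hypothesis hpinj : injective p.
Variable e : 'I_k -> nat.
Variable N : lmodType T.
Hypothesis hN : forall x : T, (forall i, ideal_pow (p i) (e i) x) -> forall v : N, x *: v = 0.

Let pr i : prime_idl (p i). Proof. by case: (hp i). Qed.
Let ip i : is_idl (p i). Proof. by case: (pr i) => -[]. Qed.
Let ipw i m : is_idl (ideal_pow (p i) m). Proof. exact: is_idl_pow. Qed.
Local Notation J := (modulus p e).
Let iJ : is_idl J. Proof. exact: is_idl_modulus. Qed.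

Let inter (a : 'I_k -> nat) : set T := fun x => forall i, ideal_pow (p i) (a i) x.

Lemma modulus_kills x (v : N) : J x -> x *: v = 0.
Proof. by move=> Jx; apply: hN => i; apply: (ideal_powW (ip i) (leqnSn _)). Qed.

Lemma inter_factor (a b : 'I_k -> nat) x : inter (fun i => (a i + b i)%N) x ->
  ideal_mul (inter a) (inter b) x.
Proof.
move=> hx; set F := fun i => (a i + b i)%N.
have C i := crt_idempotent hT hp hpinj F i.
pose ep i := projT1 (cid (C i)).
have ep1 i : ideal_pow (p i) (F i) (ep i - 1) by rewrite /ep; case: cid => ? [].
have ep0 i j : j != i -> ideal_pow (p j) (F j) (ep i) by have [_] := projT2 (cid (C i)); apply.
have iI := is_idl_inter hp.
have iM : is_idl (ideal_mul (inter a) (inter b)) by apply: is_idl_mul; apply: iI.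
(* The square provides one copy of [ep i] for each of the two ideals, which settles the primes other
   than [p i]. The factor [1 - \sum_i ep i * ep i] lies in every [p j ^ F j]. *)
have -> : x = \sum_i x * (ep i * ep i) + x * (1 - \sum_i ep i * ep i).
  by rewrite -mulr_sumr -mulrDr addrC subrK mulr1.
apply: idlD => //.
  apply: idl_sum => // i; have := ideal_pow_addn (ip i) (hx i); move: x {hx}.
  apply: ideal_mul_ind.
  - by rewrite mul0r; apply: idl0.
  - by move=> x y; rewrite mulrDl; apply: idlD.
  move=> x y hx hy; have -> : x * y * (ep i * ep i) = (x * ep i) * (y * ep i) by ring.
  apply: ideal_mul_mem => j; have [->|ji] := eqVneq j i; try exact: idlMr.
    by apply: idlM => //; apply: (ideal_powW (ip j) (leq_addr _ _)); apply: ep0.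
  by apply: idlM => //; apply: (ideal_powW (ip j) (leq_addl _ _)); apply: ep0.
apply: ideal_mul_mem => j; first exact: (ideal_powW (ip j) (leq_addr _ _) (hx j)).
apply: (ideal_powW (ip j) (leq_addl (a j) _)); rewrite -/(F j) (bigD1 j) //=.
have -> : 1 - (ep j * ep j + \sum_(i | i != j) ep i * ep i) =
  - (ep j + 1) * (ep j - 1) - \sum_(i | i != j) ep i * ep i by ring.
apply: idlB => //; first exact: idlM.
rewrite big_mkcond /=; apply: idl_sum => // i; case: eqVneq => [_|ij] /=; first exact: idl0.
by apply: idlM => //; apply: ep0; rewrite eq_sym.
Qed.

Section Matrix.
Variables (n u : nat) (M : 'M[T]_(n, n + u)).
Local Notation V := ('cV[T]_n).

(** This is [im M + J T^n]; thus [reduced_iso] says that the cokernel of [M] modulo [J] is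
    isomorphic to [N]. *)
Definition reduced_ker (v : V) : Prop :=
  exists (w : 'cV[T]_(n + u)) (v' : V), v = M *m w + v' /\ forall a, J (v' a 0).

Definition reduced_iso : Prop := exists phi : V -> N,
  [/\ forall a x y, phi (a *: x + y) = a *: phi x + phi y,
      forall y, exists x, phi x = y & forall v, phi v = 0 <-> reduced_ker v].

(* Nakayama: the determinant trick gives [d = 1] modulo every [p i]. *)
Lemma nakayama (phi : V -> N) : (forall a x y, phi (a *: x + y) = a *: phi x + phi y) ->
  (forall v, phi v = 0 -> reduced_ker v) ->
  exists d, (forall i, p i (d - 1)) /\
   forall v : V, (forall a, J (v a 0)) -> exists w, d *: v = M *m w.
Proof.
move=> lin ker; have [noeth _ _] := hT; have [g Jg] := noeth J iJ.
have phiZ a v : phi (a *: v) = a *: phi v.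
  have phi0 : phi 0 = 0.
    by have := lin 1 0 0; rewrite !scale1r addr0 => /eqP; rewrite -subr_eq subrr => /eqP.
  by have := lin a v 0; rewrite phi0 !addr0.
pose I := ('I_(size g) * 'I_n)%type; pose R := #|{: I}|.
pose gv (l : 'I_R) : V := g`_(enum_val l).1 *: delta_mx (enum_val l).2 0.
have gJ (t : 'I_(size g)) : J g`_t.
  rewrite Jg; exists (fun j => (j == t)%:R).
  by rewrite (bigD1 t) //= eqxx mul1r big1 ?addr0 // => j /negbTE ->; rewrite mul0r.
have span (v : V) : (forall a, J (v a 0)) -> exists x : 'I_R -> T, v = \sum_l x l *: gv l.
  move=> vJ.
  have hc a : exists c : 'I_(size g) -> T, v a 0 = \sum_t c t * g`_t.
    by have := vJ a; rewrite Jg.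
  pose c a := projT1 (cid (hc a)).
  have cE a : v a 0 = \sum_t c a t * g`_t by exact: (projT2 (cid (hc a))).
  exists (fun l => c (enum_val l).2 (enum_val l).1).
  transitivity (\sum_(ta : I) (c ta.2 ta.1 * g`_ta.1) *: (delta_mx ta.2 0 : V)).
    rewrite (eq_bigr (fun ta : I => (fun t a => (c a t * g`_t) *: (delta_mx a 0 : V)) ta.1 ta.2)) //.
    rewrite -(pair_big xpredT xpredT (fun t a => (c a t * g`_t) *: (delta_mx a 0 : V))) /=.
    rewrite exchange_big /=; apply/colP => b; rewrite summxE (bigD1 b) //=.
    rewrite [X in _ + X]big1 ?addr0.
      by rewrite summxE cE; apply: eq_bigr => t _; rewrite !mxE !eqxx mulr1.
    move=> a ab; rewrite summxE big1 // => t _.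
    by rewrite !mxE eq_sym (negbTE ab) mulr0.
  rewrite (reindex (@enum_val I predT)) /=; last first.
    by apply: onW_bij; apply: enum_val_bij.
  by apply: eq_bigr => l _; rewrite /gv scalerA.
have rel l : exists (w : 'cV[T]_(n + u)) (b : 'I_R -> T),
    (forall l', inter (fun=> 1%N) (b l')) /\ gv l = M *m w + \sum_l' b l' *: gv l'.
  rewrite /gv; set t := (enum_val l).1; set a := (enum_val l).2.
  (* The spare exponent factors [J] through [inter e]. For [y] in [inter e], [phi] kills [y e_a], so
     [y e_a] is in [im M + J T^n]; each generator of [J T^n] is thus in [im M] plus multiples of
     generators by elements common to all [p i]. *)
  have : ideal_mul (inter (fun=> 1%N)) (inter e) g`_t.
    by apply: inter_factor => i; apply: (gJ t).
  have iI := is_idl_inter hp (fun=> 1%N).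
  move: (g`_t); apply: ideal_mul_ind.
  - exists 0, (fun=> 0); split; first by move=> _; exact: (idl0 iI).
    by rewrite scale0r mulmx0 add0r big1 // => l' _; rewrite scale0r.
  - move=> x y [w [b [hb ex]]] [w' [b' [hb' ey]]].
    exists (w + w'), (fun l => b l + b' l); split; first by move=> l'; apply: (idlD iI); [apply: hb|apply: hb'].
    rewrite scalerDl ex ey mulmxDr addrACA -big_split /=; congr (_ + _).
    by apply: eq_bigr => l' _; rewrite scalerDl.
  move=> x y hx hy.
  have [w [v' [ev v'J]]] : reduced_ker (y *: delta_mx a 0) by apply: ker; rewrite phiZ hN.
  have [c cE] := span v' v'J.
  exists (x *: w), (fun l' => x * c l'); split; first by move=> l'; apply: (idlMr _ iI hx).
  rewrite -scalerA ev scalerDr -scalemxAr cE scaler_sumr; congr (_ + _).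
  by apply: eq_bigr => l' _; rewrite scalerA.
pose W := \matrix_(a, l) (projT1 (cid (rel l))) a 0 : 'M[T]_(n + u, R).
pose Bm := \matrix_(l', l) (projT1 (cid (projT2 (cid (rel l))))) l' : 'M[T]_R.
have BI l' l : inter (fun=> 1%N) (Bm l' l).
  by rewrite mxE; have [h _] := projT2 (cid (projT2 (cid (rel l)))); apply: h.
pose G := \matrix_(a, l) gv l a 0 : 'M[T]_(n, R).
have GE : G *m (1%:M - Bm) = M *m W.
  rewrite mulmxBr mulmx1; apply/eqP; rewrite subr_eq; apply/eqP/matrixP => a l.
  have [_ h] := projT2 (cid (projT2 (cid (rel l)))).
  have -> : G a l = gv l a 0 by rewrite mxE.
  rewrite h [LHS]mxE [RHS]mxE; congr (_ + _).
    by rewrite !mxE; apply: eq_bigr => b _; rewrite !mxE.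
  by rewrite summxE mxE; apply: eq_bigr => l' _; rewrite !mxE mulrC.
pose d := \det (1%:M - Bm).
have Gd : d *: G = M *m (W *m \adj (1%:M - Bm)).
  by rewrite mulmxA -GE -mulmxA mul_mx_adj mul_mx_scalar.
exists d; split=> [i|v vJ].
  have [K [r [rs rk]]] := residue_field hT hfin hp i.
  apply/rk; rewrite rmorphB rmorph1 -det_map_mx.
  have -> : map_mx r (1%:M - Bm) = 1%:M.
    rewrite map_mxB map_mx1; have -> : map_mx r Bm = 0; last by rewrite subr0.
    apply/matrixP => l' l; rewrite [LHS]mxE [RHS]mxE; apply/rk/(ideal_pow1 _ (ip i)).
    exact: BI.
  by rewrite det1 subrr.
have [x ->] := span v vJ.
exists (W *m \adj (1%:M - Bm) *m \col_l x l); rewrite mulmxA -Gd -scalemxAl; congr (_ *: _).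
apply/colP => a; rewrite summxE !mxE; apply: eq_bigr => l _; rewrite !mxE mulrC //.
Qed.

End Matrix.
End Tensor.

(** * The tensor product condition is equivalent to the one on the cokernel modulo [J] *)

Section TensorEvent.
Variable T : idomainType.
Hypothesis hT : dedekind_domain T.
Hypothesis hfin : forall J : set T, proper_idl J -> nonzero_idl J -> finite_quotient J.
Variables (k : nat) (p : 'I_k -> set T).
Hypothesis hp : forall i, prime_idl (p i) /\ nonzero_idl (p i).
Hypothesis hpinj : injective p.
Variable e : 'I_k -> nat.
Variable N : lmodType T.
Hypothesis hN : forall x : T, (forall i, ideal_pow (p i) (e i) x) -> forall v : N, x *: v = 0.

Let pr i : prime_idl (p i). Proof. by case: (hp i). Qed.
Let ip i : is_idl (p i). Proof. by case: (pr i) => -[]. Qed.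
Let ipw i m : is_idl (ideal_pow (p i) m). Proof. exact: is_idl_pow. Qed.
Local Notation J := (modulus p e).
Let iJ : is_idl J. Proof. exact: is_idl_modulus. Qed.
Let E i := (e i).+1.

Implicit Type b : 'I_k -> nat -> T.

Lemma compat_le b i m m' : compat_seq p b -> (m <= m')%N ->
  ideal_pow (p i) m (b i m' - b i m).
Proof.
move=> cb; elim: m' => [|m' IH].
  by rewrite leqn0 => /eqP ->; rewrite subrr; apply: idl0.
rewrite leq_eqVlt => /orP[/eqP ->|mm']; first by rewrite subrr; apply: idl0.
have -> : b i m'.+1 - b i m = (b i m'.+1 - b i m') + (b i m' - b i m) by ring.
by apply: idlD => //; [apply: (ideal_powW (ip i) _ (cb i m'))|apply: IH].
Qed.

(** The precision is one power beyond [J], so that [Pi] in [common_uniformizer] has valuation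
    exactly [E i] at [p i]. *)
Lemma idempotents : exists ep : 'I_k -> T, forall i,
  ideal_pow (p i) (E i).+1 (ep i - 1) /\ forall j, j != i -> ideal_pow (p j) (E j).+1 (ep i).
Proof.
have C i := crt_idempotent hT hp hpinj (fun i => (E i).+1) i.
by exists (fun i => projT1 (cid (C i))) => i; exact: (projT2 (cid (C i))).
Qed.

Definition ep : 'I_k -> T := projT1 (cid idempotents).

Lemma ep1 i : ideal_pow (p i) (E i).+1 (ep i - 1).
Proof. by have [] := projT2 (cid idempotents) i. Qed.

Lemma ep0 i j : j != i -> ideal_pow (p j) (E j).+1 (ep i).
Proof. by have [_] := projT2 (cid idempotents) i; apply. Qed.

Lemma glue (x : 'I_k -> T) i : ideal_pow (p i) (E i).+1 (\sum_j ep j * x j - x i).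
Proof.
rewrite (bigD1 i) //=.
have -> : ep i * x i + \sum_(j | j != i) ep j * x j - x i =
  x i * (ep i - 1) + \sum_(j | j != i) ep j * x j by ring.
have iI := ipw i (E i).+1.
apply: (idlD iI); first by apply: (idlM _ iI); apply: ep1.
rewrite big_mkcond /=; apply: (idl_sum _ iI) => j; case: eqVneq => [_|ij] /=; first exact: (idl0 iI).
by apply: (idlMr _ iI); apply: ep0; rewrite eq_sym.
Qed.

(** For a compatible family, this represents its image under [\prod T_(p_i) -> T / J]. *)
Definition approx b : T := \sum_i ep i * b i (E i).

Lemma approx_lin a b b' : approx (scale_add_seq a b b') = a * approx b + approx b'.
Proof.
rewrite /approx mulr_sumr -big_split /=; apply: eq_bigr => i _.
by rewrite /scale_add_seq mulrDr mulrCA.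
Qed.

Lemma approx_cong b i : ideal_pow (p i) (E i) (approx b - b i (E i)).
Proof. by apply: (ideal_powW (ip i) (leqnSn _)); apply: glue. Qed.

Lemma approx_equiv b b' : equiv_seq p b b' -> J (approx b - approx b').
Proof.
move=> bb i; have h := bb i (E i).
have -> : approx b - approx b' = (approx b - b i (E i)) - (approx b' - b' i (E i)) +
  (b i (E i) - b' i (E i)) by ring.
by apply: (idlD (ipw i _)) => //; apply: (idlB (ipw i _)); apply: approx_cong.
Qed.

Definition oneseq : 'I_k -> nat -> T := fun _ _ => 1.
Definition zeroseq : 'I_k -> nat -> T := fun _ _ => 0.

Lemma compat_one : compat_seq p oneseq.
Proof. by move=> i m; rewrite subrr; apply: idl0. Qed.

Lemma compat_zero : compat_seq p zeroseq.
Proof. by move=> i m; rewrite subrr; apply: idl0. Qed.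

Lemma compat_scale_add a b b' : compat_seq p b -> compat_seq p b' ->
  compat_seq p (scale_add_seq a b b').
Proof.
move=> cb cb' i m; rewrite /scale_add_seq.
have -> : a * b i m.+1 + b' i m.+1 - (a * b i m + b' i m) =
  a * (b i m.+1 - b i m) + (b' i m.+1 - b' i m) by ring.
by apply: idlD => //; apply: idlM.
Qed.

Lemma approx_one : J (approx oneseq - 1).
Proof. by move=> i; apply: (approx_cong oneseq i). Qed.

(** [Pi] agrees with [pi i ^+ E i] modulo one more power of [p i], hence is associated to it
    locally, as [as_] makes explicit; division and cancellation are then inherited from [pi i]. *)
Lemma common_uniformizer : exists Pi, [/\ J Pi,
  forall i x m, ideal_pow (p i) (E i) x -> exists y, ideal_pow (p i) m (x - Pi * y) &
  forall i y m, ideal_pow (p i) (m + E i) (Pi * y) -> ideal_pow (p i) m y].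
Proof.
have [pi [s up]] := choose_uniformizers hT hfin hp.
pose Pi := \sum_i ep i * pi i ^+ E i.
have Pi_i i : ideal_pow (p i) (E i).+1 (Pi - pi i ^+ E i) := glue (fun i => pi i ^+ E i) i.
have as_ i : exists a c, [/\ ~ p i a, ~ p i c & a * Pi = c * pi i ^+ E i].
  have [h1 h2 h3 h4] := up i.
  have [z hz] := pow_principal h4 (Pi_i i).
  exists (s i ^+ (E i).+1), (s i ^+ (E i).+1 + pi i * z).
  have ns : ~ p i (s i ^+ (E i).+1) by move/(prime_expr (pr i)).
  split=> //.
    move=> h; apply: ns; have -> : s i ^+ (E i).+1 = s i ^+ (E i).+1 + pi i * z - pi i * z by ring.
    by apply: idlB => //; apply: idlMr.
  have -> : s i ^+ (E i).+1 * Pi = s i ^+ (E i).+1 * (Pi - pi i ^+ E i) + s i ^+ (E i).+1 * pi i ^+ E i.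
    by ring.
  by rewrite hz [pi i ^+ (E i).+1]exprS; ring.
exists Pi; split.
- move=> i; apply/(idl_cong (ipw i _) (ideal_powW (ip i) (leqnSn _) (Pi_i i))).2.
  by apply: ideal_pow_exp; case: (up i).
- move=> i x m hx; have [h1 h2 h3 h4] := up i; have [a [c [na nc ac]]] := as_ i.
  have [y0 hy0] := divide_by_uniformizers hT (pr i) (proj2 (hp i)) h2 h4 m hx.
  have [t ht] := inverse_mod_pow hT (pr i) (proj2 (hp i)) m nc.
  exists (t * a * y0).
  have -> : x - Pi * (t * a * y0) = (x - pi i ^+ E i * y0) - (pi i ^+ E i * y0) * (t * c - 1).
    have -> : Pi * (t * a * y0) = (a * Pi) * t * y0 by ring.
    by rewrite ac; ring.
  by apply: idlB => //; apply: idlM.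
move=> i y m hy; have [h1 h2 h3 h4] := up i; have [a [c [na nc ac]]] := as_ i.
apply: (pow_cancel_uniformizers hT (pr i) (proj2 (hp i)) h1 h2 h3 h4 (e := E i)).
apply: (cancel_unit_mod_pow hT (pr i) (proj2 (hp i)) nc).
by rewrite mulrA -ac -mulrA; apply: idlM.
Qed.

(** What vanishes modulo [J] in the completions is divisible there by [Pi]. The [m]-th term of the
    quotient is read at level [m + E i], because cancelling [Pi] loses [E i] exponents. *)
Lemma divide_seq b : compat_seq p b -> (forall i, ideal_pow (p i) (E i) (b i (E i))) ->
  exists Pi z, [/\ J Pi, compat_seq p z & equiv_seq p b (scale_add_seq Pi z zeroseq)].
Proof.
move=> cb hb; have [Pi [JPi div can]] := common_uniformizer.
have H i m : exists y, ideal_pow (p i) (m + E i) (b i (m + E i)%N - Pi * y).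
  apply: div; apply/(idl_cong (ipw i _) _).2/(hb i).
  by apply: compat_le => //; apply: leq_addl.
pose z i m := projT1 (cid (H i m)).
have hz i m : ideal_pow (p i) (m + E i) (b i (m + E i)%N - Pi * z i m).
  exact: (projT2 (cid (H i m))).
exists Pi, z; split=> //.
  move=> i m; apply: can.
  have -> : Pi * (z i m.+1 - z i m) = (b i (m.+1 + E i)%N - b i (m + E i)%N) -
    (b i (m.+1 + E i)%N - Pi * z i m.+1) + (b i (m + E i)%N - Pi * z i m) by ring.
  have iI := ipw i (m + E i).
  apply: (idlD iI) => //; apply: (idlB iI); first exact: cb.
  by apply: (ideal_powW (ip i) _ (hz i m.+1)); rewrite addSn.
move=> i m; rewrite /scale_add_seq /zeroseq addr0.
have -> : b i m - Pi * z i m = - (b i (m + E i)%N - b i m) + (b i (m + E i)%N - Pi * z i m) by ring.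
have iI := ipw i m; apply: (idlD iI).
  by apply: (idlN iI); apply: compat_le => //; apply: leq_addr.
by apply: (ideal_powW (ip i) _ (hz i m)); apply: leq_addr.
Qed.

(** [d] is a unit in the completions: its inverse is the geometric series in [1 - d], cut at order
    [m] in the [m]-th term. *)
Lemma inverse_seq d b : (forall i, p i (d - 1)) -> compat_seq p b ->
  exists y, compat_seq p y /\ equiv_seq p b (scale_add_seq d y zeroseq).
Proof.
move=> hd cb; pose c := 1 - d.
have pc i : p i c by rewrite /c -opprB; apply: idlN.
pose S m := \sum_(t < m) c ^+ t.
have dS m : d * S m = 1 - c ^+ m.
  have -> : d = - (c - 1) by rewrite /c; ring.
  by rewrite mulNr -subrX1; ring.
exists (fun i m => S m * b i m); split=> i m.
  have -> : S m.+1 * b i m.+1 - S m * b i m = S m * (b i m.+1 - b i m) + b i m.+1 * c ^+ m.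
    by rewrite /S big_ord_recr /=; ring.
  apply: (idlD (ipw i m)); first by apply: (idlM _ (ipw i m)).
  by apply: (idlM _ (ipw i m)); apply: ideal_pow_exp.
rewrite /scale_add_seq /zeroseq addr0 mulrA dS.
have -> : b i m - (1 - c ^+ m) * b i m = b i m * c ^+ m by ring.
by apply: (idlM _ (ipw i m)); apply: ideal_pow_exp.
Qed.

Section Matrix.
Variables (n u : nat) (M : 'M[T]_(n, n + u)).
Local Notation V := ('cV[T]_n).

Section Bilinear.
Variables (Q : lmodType T) (g : V -> ('I_k -> nat -> T) -> Q).
Hypothesis hg : cok_bilinear p M g.

Lemma bil_l b a v v' : compat_seq p b -> g (a *: v + v') b = a *: g v b + g v' b.
Proof. by move=> cb; case: hg => h _ _ _; apply: h. Qed.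

Lemma bil_0l b : compat_seq p b -> g 0 b = 0.
Proof.
by move=> cb; have := bil_l 1 0 0 cb; rewrite !scale1r addr0 => /eqP; rewrite -subr_eq subrr => /eqP.
Qed.

Lemma bil_Zl b a v : compat_seq p b -> g (a *: v) b = a *: g v b.
Proof. by move=> cb; have := bil_l a v 0 cb; rewrite bil_0l // !addr0. Qed.

Lemma bil_r v a b b' : compat_seq p b -> compat_seq p b' ->
  g v (scale_add_seq a b b') = a *: g v b + g v b'.
Proof. by case: hg => _ h _ _; apply: h. Qed.

Lemma bil_equiv v b b' : compat_seq p b -> compat_seq p b' -> equiv_seq p b b' -> g v b = g v b'.
Proof. by case: hg => _ _ h _; apply: h. Qed.

Lemma bil_mx w b : compat_seq p b -> g (M *m w) b = 0.
Proof. by case: hg => _ _ _ h; apply: h. Qed.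

Lemma bil_zero v : g v zeroseq = 0.
Proof.
have c0 := compat_zero; have := bil_r v 1 c0 c0.
have -> : scale_add_seq 1 zeroseq zeroseq = zeroseq.
  by apply/funext => i; apply/funext => m; rewrite /scale_add_seq /zeroseq mulr0 addr0.
by rewrite scale1r => /eqP; rewrite -subr_eq subrr => /eqP.
Qed.

Lemma bil_scale v a b : compat_seq p b -> g v (scale_add_seq a b zeroseq) = a *: g v b.
Proof. by move=> cb; rewrite bil_r ?bil_zero ?addr0 //; apply: compat_zero. Qed.

(** In the completions, [b] is [approx b] plus a multiple of some [Pi] in [J]. A bilinear map is
    thus known from its values at [oneseq], up to a term [Pi *: g v z] that each direction shows to
    vanish. *)
Lemma bil_expand v b : compat_seq p b -> exists Pi z, [/\ J Pi, compat_seq p z &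
  g v b = approx b *: g v oneseq + Pi *: g v z].
Proof.
move=> cb; pose b' : 'I_k -> nat -> T := fun i m => b i m - approx b.
have cb' : compat_seq p b'.
  by move=> i m; rewrite /b' opprB addrA subrK; apply: cb.
have hb' i : ideal_pow (p i) (E i) (b' i (E i)).
  by rewrite /b' -opprB; apply: (idlN (ipw i _)); apply: approx_cong.
have [Pi [z [JPi cz ez]]] := divide_seq cb' hb'.
exists Pi, z; split=> //.
have -> : b = scale_add_seq (approx b) oneseq b'.
  apply/funext => i; apply/funext => m; rewrite /scale_add_seq /oneseq /b' mulr1.
  by rewrite addrC subrK.
have c1 := compat_one; rewrite bil_r //.
have -> : approx (scale_add_seq (approx b) oneseq b') = approx b.
  congr approx; apply/funext => i; apply/funext => m.
  by rewrite /scale_add_seq /oneseq /b' mulr1 addrC subrK.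
congr (_ + _); rewrite -(bil_scale v Pi cz).
apply: bil_equiv => //; apply: compat_scale_add => //; exact: compat_zero.
Qed.

End Bilinear.

Lemma tensor_event_direct : cok_tensor_iso p M N -> reduced_iso p e N M.
Proof.
move=> [beta [hb univ]]; have c1 := compat_one.
pose phi v := beta v oneseq.
have lin a x y : phi (a *: x + y) = a *: phi x + phi y by apply: (bil_l hb).
have phi0 : phi 0 = 0 by apply: (bil_0l hb).
have phiZ a x : phi (a *: x) = a *: phi x by apply: (bil_Zl hb).
have betaE v b : compat_seq p b -> beta v b = phi (approx b *: v).
  move=> cb; have [Pi [z [JPi cz ->]]] := bil_expand hb v cb.
  by rewrite phiZ (modulus_kills hp hN _ JPi) addr0.
have phi_sum (S : seq 'I_n) (F : 'I_n -> V) : phi (\sum_(i <- S) F i) = \sum_(i <- S) phi (F i).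
  rewrite (big_morph phi (id1 := 0) (op1 := +%R)) // => x y.
  by have := lin 1 x y; rewrite !scale1r.
have phiJ (v : V) : (forall a, J (v a 0)) -> phi v = 0.
  move=> vJ; have -> : v = \sum_a v a 0 *: delta_mx a 0.
    apply/colP => c; rewrite summxE (bigD1 c) //= !mxE !eqxx mulr1 big1 ?addr0 // => a ac.
    by rewrite !mxE eq_sym (negbTE ac) mulr0.
  by rewrite phi_sum big1 // => a _; rewrite phiZ (modulus_kills hp hN).
have phiC (v : V) : reduced_ker p e M v -> phi v = 0.
  move=> [w [v' [-> v'J]]]; have := lin 1 (M *m w) v'; rewrite !scale1r => ->.
  by rewrite /phi (bil_mx hb) // add0r; apply: phiJ.
exists phi; split=> // [y|v].
  (* Surjectivity: the zero map and the projection of [N] onto [N / im phi] both factor the zero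
     bilinear map, so uniqueness identifies them. *)
  pose S (y : N) := exists x, phi x = y.
  have [||Q [g [gl gs gk]]] := @quotient_module T N S.
  - by exists 0.
  - by move=> a _ _ [x <-] [y' <-]; exists (a *: x + y').
  have hz : cok_bilinear p M (fun (_ : V) (_ : 'I_k -> nat -> T) => (0 : Q)).
    by split=> *; rewrite ?scaler0 ?addr0.
  have [h [hl h1 h2]] := univ Q _ hz.
  have z0 : (fun=> 0 : Q) =1 h by apply: h2 => [a x y'|*]; rewrite ?scaler0 ?addr0.
  have gh : g =1 h.
    apply: h2 => // v b cb; rewrite betaE //; apply/esym/gk.
    by exists (approx b *: v).
  by apply/gk; rewrite gh -z0.
split=> [pv|]; last exact: phiC.
(* Kernel: the projection to [T^n / (im M + J T^n)], twisted by [approx], is bilinear and factors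
   through [beta]; so [phi v = 0] forces the class of [v] to vanish. *)
have [||Q [g [gl gs gk]]] := @quotient_module T V (reduced_ker p e M).
- by exists 0, 0; split; [rewrite mulmx0 addr0|move=> a; rewrite mxE; exact: (idl0 iJ)].
- move=> a _ _ [w [v' [-> h]]] [w' [v'' [-> h']]].
  exists (a *: w + w'), (a *: v' + v''); split.
    by rewrite mulmxDr -scalemxAr scalerDr addrACA.
  by move=> c; rewrite !mxE; apply: (idlD iJ) => //; apply: (idlM _ iJ).
have g0 : g 0 = 0.
  by have := gl 1 0 0; rewrite !scale1r addr0 => /eqP; rewrite -subr_eq subrr => /eqP.
have gZ a x : g (a *: x) = a *: g x by have := gl a x 0; rewrite g0 !addr0.
have gJ a x : J a -> g (a *: x) = 0.
  move=> Ja; apply/gk; exists 0, (a *: x); split; first by rewrite mulmx0 add0r.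
  by move=> c; rewrite mxE; apply: (idlMr _ iJ).
have gjj a a' x : J (a - a') -> g (a *: x) = g (a' *: x).
  move=> Jaa; apply/eqP; rewrite -subr_eq0 -(subrK a' a) scalerDl.
  by have := gl 1 ((a - a') *: x) (a' *: x); rewrite !scale1r => ->; rewrite gJ // add0r subrr.
have hg : cok_bilinear p M (fun v b => g (approx b *: v)).
  split=> [b cb a x y|x a b b' cb cb'|x b b' cb cb' bb|w b cb].
  - by rewrite -gl scalerDr !scalerA mulrC.
  - by rewrite approx_lin -gl scalerDl scalerA.
  - by apply: gjj; apply: approx_equiv.
  - by apply/gk; exists (approx b *: w), 0; rewrite -scalemxAr addr0; split=> // a; rewrite mxE; exact: (idl0 iJ).
have [h [hl h1 h2]] := univ Q _ hg.
apply/gk; rewrite -[v]scale1r.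
have <- : g (approx oneseq *: v) = g (1 *: v) by apply: gjj; apply: approx_one.
rewrite (h1 v oneseq c1) -/(phi v) pv.
by have := hl 1 0 0; rewrite !scale1r addr0 => /eqP; rewrite -subr_eq subrr => /eqP.
Qed.

Lemma tensor_event_converse : reduced_iso p e N M -> cok_tensor_iso p M N.
Proof.
move=> [phi [lin sur ker]]; have c1 := compat_one.
have phi0 : phi 0 = 0.
  by have := lin 1 0 0; rewrite !scale1r addr0 => /eqP; rewrite -subr_eq subrr => /eqP.
have phiZ a x : phi (a *: x) = a *: phi x by have := lin a x 0; rewrite phi0 !addr0.
have phiB x y : phi (x - y) = phi x - phi y.
  by have := lin (-1) y x; rewrite !scaleN1r addrC => ->; rewrite addrC.
have [d [hd dC]] := nakayama hT hfin hp hpinj hN lin (fun v => (ker v).1).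
have actJ a a' v : J (a - a') -> a *: v = a' *: v :> N.
  by move=> Jaa; apply/eqP; rewrite -subr_eq0 -scalerBl (modulus_kills hp hN).
exists (fun v b => phi (approx b *: v)); split.
  split=> [b cb a x y|x a b b' cb cb'|x b b' cb cb' bb|w b cb].
  - by rewrite -lin scalerDr !scalerA mulrC.
  - by rewrite approx_lin -lin scalerDl scalerA.
  - by rewrite !phiZ; apply: actJ; apply: approx_equiv.
  - by apply/ker; exists (approx b *: w), 0; rewrite -scalemxAr addr0; split=> // a; rewrite mxE; exact: (idl0 iJ).
move=> Q g hg.
(* Write [b = d y] in the completions, with [d] from [nakayama]: then [g v b = g (d *: v) y], and
   [d *: v] is in the image of [M]. *)
have gJ (v : V) b : (forall a, J (v a 0)) -> compat_seq p b -> g v b = 0.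
  move=> vJ cb; have [y [cy ey]] := inverse_seq hd cb.
  rewrite (bil_equiv hg v cb _ ey); last by apply: compat_scale_add => //; apply: compat_zero.
  rewrite (bil_scale hg) // -(bil_Zl hg) //; have [w ->] := dC v vJ.
  exact: (bil_mx hg).
have gker (v : V) b : phi v = 0 -> compat_seq p b -> g v b = 0.
  move=> /ker[w [v' [-> v'J]]] cb; have := bil_l hg 1 (M *m w) v' cb; rewrite !scale1r => ->.
  by rewrite (bil_mx hg) // gJ // addr0.
have gB (v v' : V) b : compat_seq p b -> g (v - v') b = g v b - g v' b.
  by move=> cb; have := bil_l hg (-1) v' v cb; rewrite !scaleN1r addrC => ->; rewrite addrC.
pose pre y := projT1 (cid (sur y)).
have preP y : phi (pre y) = y by exact: (projT2 (cid (sur y))).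
have hphi (v : V) b : compat_seq p b -> g (pre (phi v)) b = g v b.
  by move=> cb; apply/eqP; rewrite -subr_eq0 -gB // gker // phiB preP subrr.
have gE (v : V) b : compat_seq p b -> g v b = g (approx b *: v) oneseq.
  move=> cb; have [Pi [z [JPi cz ->]]] := bil_expand hg v cb.
  rewrite (bil_Zl hg (approx b) v c1); have -> : Pi *: g v z = 0; last by rewrite addr0.
  rewrite -(bil_Zl hg Pi v cz); apply: gker => //.
  by rewrite phiZ (modulus_kills hp hN _ JPi).
exists (fun y => g (pre y) oneseq); split.
- move=> a x y; rewrite -(bil_l hg) //.
  rewrite -(hphi (a *: pre x + pre y)) //; congr (g (pre _) _).
  by rewrite lin !preP.
- by move=> v b cb; rewrite hphi // gE.
move=> h' h'l h'g y; rewrite (h'g (pre y) oneseq c1); congr h'.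
by rewrite phiZ preP -[LHS]scale1r; apply/esym/actJ/approx_one.
Qed.

End Matrix.
End TensorEvent.

(** * Balancedness of the reduced entries *)

Lemma mulrn_card (A : finZmodType) (x : A) : x *+ #|A| = 0.
Proof.
have e : \sum_(y : A) y = \sum_(y : A) (y + x) by rewrite [LHS](reindex_inj (addIr x)).
move: e; rewrite big_split /= sumr_const -[LHS]addr0 => /addrI <-.
by [].
Qed.

Section Subgroups.
Variable A : finComNzRingType.

(* Otherwise [A = K + l A] for all primes [l] up to [#|A|], hence [A = K + #|A| A = K]. *)
Lemma subgroup_prime (K : {set A}) : additive_subgroup K -> K != [set: A]%SET ->
  exists l, [/\ prime l, (l <= #|A|)%N & exists a, forall c b, c \in K -> a != c + b *+ l].
Proof.
move=> [K0 KB] KT; apply: contrapT => no.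
have KN x : x \in K -> - x \in K by move=> xK; rewrite -sub0r; apply: KB.
have KD x y : x \in K -> y \in K -> x + y \in K.
  by move=> xK yK; rewrite -[y]opprK; apply: KB => //; apply: KN.
have KM x m : x \in K -> x *+ m \in K.
  by move=> xK; elim: m => [|m IH]; rewrite ?mulr0n // mulrS; apply: KD.
have H l a : prime l -> (l <= #|A|)%N -> exists c b, c \in K /\ a = c + b *+ l.
  move=> pl lA; apply: contrapT => nn; apply: no; exists l; split=> //; exists a => c b cK.
  by apply/eqP => e; apply: nn; exists c, b.
have G m : (0 < m)%N -> (m <= #|A|)%N -> forall a, exists c b, c \in K /\ a = c + b *+ m.
  elim/ltn_ind: m => m IH m0 mA a.
  have [m1|m1] := leqP m 1.
    have -> : m = 1%N by lia.
    by exists 0, a; split=> //; rewrite add0r mulr1n.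
  have pl := pdiv_prime m1; set l := pdiv m in pl.
  have [m' mE] : exists m', m = (m' * l)%N by exists (m %/ l)%N; rewrite divnK // pdiv_dvd.
  have l1 := prime_gt1 pl.
  have m'0 : (0 < m')%N by move: m0; rewrite mE muln_gt0 => /andP[].
  have m'm : (m' < m)%N by rewrite mE -{1}[m']muln1 ltn_mul2l m'0.
  have [c [b [cK ->]]] := IH m' m'm m'0 (leq_trans (ltnW m'm) mA) a.
  have lm : (l <= #|A|)%N by apply: leq_trans mA; rewrite mE leq_pmull.
  have [c' [b' [cK' ->]]] := H l b pl lm.
  exists (c + c' *+ m'), b'; split; first by apply: KD => //; apply: KM.
  by rewrite mulrnDl addrA -mulrnA mE [(l * m')%N]mulnC.
have A0 : (0 < #|A|)%N by apply/card_gt0P; exists 0.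
case/eqP: KT; apply/setP => a; rewrite inE.
have [c [b [cK ->]]] := G #|A| A0 (leqnn _) a.
by rewrite mulrn_card addr0.
Qed.

End Subgroups.

Section ElementaryQuotient.
Variables (T : comNzRingType) (I : set T) (l : nat).
Hypothesis iI : is_idl I.
Hypothesis pl : prime l.
Hypothesis lI : I l%:R.
Hypothesis fI : finite_quotient I.
Hypothesis nI : ~ I 1.

(** As [l] lies in [I], the integers act on [T / I] through ['F_l], so [residue_coordinates] applies
    with integer scalars. *)
Lemma elem_quot_exists : exists m (f : T -> 'rV['F_l]_m), elem_quot_data I f.
Proof.
pose h : {rmorphism int -> 'F_l} := intr.
have hs c : exists a, h a = c.
  by exists (nat_of_ord c)%:Z; rewrite /h /= -pmulrn natr_Zp.
have hk a : h a = 0 -> exists b, a = l%:Z * b.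
  move=> ha; exists (a %/ l)%Z.
  have : (l %| a)%Z.
    by rewrite (dvdz_pcharf (pchar_Fp pl) a); apply/eqP.
  by move/divzK => {1}<-; rewrite mulrC.
have IZ (a : int) (x : zmodule T) : I x -> I (a *: x).
  by move=> Ix; rewrite scalezrE -mulrzl; apply: (idlM _ iI).
have [||||||m [f [f1 f2 f3]]] := @residue_coordinates int (zmodule T) 'F_l h hs (fun=> True) I.
- by [].
- by [].
- by move=> a x y Ix Iy; apply: (idlD iI) => //; apply: IZ.
- exact: (idl0 iI).
- move=> a x /hk[b ->] _; rewrite scalezrE mulrC mulrzA -pmulrn -mulr_natl.
  exact: (idlMr _ iI).
- by have [s hs'] := fI; exists s => x _; apply: hs'.
exists m, f; split=> //.
- rewrite lt0n; apply/eqP => m0; apply: nI; apply/(f3 1 Logic.I).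
  by move: (f 1); rewrite m0 => v; apply/rowP => -[].
- by move=> x y; have := f1 1 x y Logic.I Logic.I; rewrite rmorph1 !scale1r.
- by move=> v; have [x _ <-] := f2 v; exists x.
- by move=> x; apply: f3.
Qed.

End ElementaryQuotient.

Section FiniteLaw.
Variables (R : realType) (d : measure_display) (Omega : measurableType d).
Variables (P : probability Omega R) (B : finType) (Y : Omega -> B).
Hypothesis mY : forall b, measurable [set w | Y w = b]%classic.

Definition law (b : B) : R := fine (P [set w | Y w = b]%classic).

Lemma measurable_mem_seq (s : seq B) : measurable [set w | Y w \in s]%classic.
Proof.
elim: s => [|b s IH].
  have -> : [set w | Y w \in [::]]%classic = set0 by apply/seteqP; split.
  exact: measurable0.
have -> : [set w | Y w \in b :: s]%classic = ([set w | Y w = b] `|` [set w | Y w \in s])%classic.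
  apply/seteqP; split=> w /=; rewrite inE; first by case/orP => [/eqP|]; [left|right].
  by case=> [->|->]; rewrite ?eqxx ?orbT.
exact: measurableU.
Qed.

Lemma prob_mem_seq (s : seq B) : uniq s ->
  P [set w | Y w \in s]%classic = (\sum_(b <- s) law b)%:E.
Proof.
elim: s => [_|b s IH] /=.
  have -> : [set w | Y w \in [::]]%classic = set0 by apply/seteqP; split.
  by rewrite measure0 big_nil.
case/andP => bs us.
have -> : [set w | Y w \in b :: s]%classic = ([set w | Y w = b] `|` [set w | Y w \in s])%classic.
  apply/seteqP; split=> w /=; rewrite inE; first by case/orP => [/eqP|]; [left|right].
  by case=> [->|->]; rewrite ?eqxx ?orbT.
rewrite measureU //; last first.
  by apply/seteqP; split=> // w [/= ->]; rewrite (negbTE bs).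
  exact: measurable_mem_seq.
by rewrite big_cons EFinD -IH // /law fineK // fin_num_measure.
Qed.

Lemma prob_pred (Q : pred B) : P [set w | Q (Y w)]%classic = (\sum_(b | Q b) law b)%:E.
Proof.
have -> : [set w | Q (Y w)]%classic = [set w | Y w \in [seq b <- index_enum B | Q b]]%classic.
  by apply/seteqP; split=> w /=; rewrite mem_filter mem_index_enum andbT.
by rewrite prob_mem_seq ?filter_uniq ?index_enum_uniq // big_filter.
Qed.

Lemma law_ge0 b : 0 <= law b.
Proof. by rewrite /law fine_ge0. Qed.

Lemma law_sum : \sum_b law b = 1.
Proof.
apply/EFin_inj; rewrite -(prob_pred xpredT).
have -> : [set w | xpredT (Y w)]%classic = setT by apply/seteqP; split.
exact: probability_setT.
Qed.

End FiniteLaw.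

Section BalancedTransfer.
Variables (R : realType) (T : comNzRingType) (A : finComNzRingType) (r : {rmorphism T -> A}).
Hypothesis r_surj : forall a, exists x, r x = a.
Hypothesis r_ker : exists2 x, r x = 0 & x != 0.
Hypothesis r_fin : exists s : seq T, forall x, exists2 y, y \in s & r (x - y) = 0.
Variable eps : set T -> R.
Hypothesis heps : forall I : set T, calI I -> 0 < eps I.

(** The preimage of [l A], that is [l T + ker r]. *)
Definition multiples (l : nat) : set T := fun x => exists b, r x = b *+ l.

Lemma is_idl_multiples l : is_idl (multiples l).
Proof.
split=> [|x y [b xb] [c yc]|a x [b xb]].
- by exists 0; rewrite rmorph0 mul0rn.
- by exists (b + c); rewrite rmorphD xb yc mulrnDl.
- by exists (r a * b); rewrite rmorphM xb mulrnAr.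
Qed.

(* Only the ideals [l T + ker r], with [l] a prime at most [#|A|], are needed. *)
Definition balance : R :=
  \big[Num.min/2^-1]_(l < #|A|.+1) (if `[<calI (multiples l)>] then eps (multiples l) else 2^-1).

Lemma balance_gt0 : 0 < balance.
Proof.
rewrite /balance; apply: (big_ind (fun x : R => 0 < x)) => [|x y x0 y0|l _].
- by rewrite invr_gt0.
- by rewrite lt_min x0.
- by case: asboolP => [/heps //|_]; rewrite invr_gt0.
Qed.

Lemma balance_le_half : balance <= 1 / 2.
Proof. by rewrite div1r; apply: bigmin_le_id. Qed.

Lemma balance_le l : (l <= #|A|)%N -> calI (multiples l) -> balance <= eps (multiples l).
Proof.
move=> lA cl; have l' : (l < #|A|.+1)%N by [].
by apply: (bigmin_inf (Ordinal l')) => //=; case: asboolP.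
Qed.

(** A proper subgroup [K] of [A] need not come from an elementary quotient, but [K + l A] is still
    proper for some prime [l]. Modulo [multiples l] the preimage of [K] becomes a proper
    ['F_l]-subspace, to which the hypothesis on [y] applies. *)
Lemma balanced_transfer (d : measure_display) (Omega : measurableType d)
    (P : probability Omega R) (y : Omega -> T) :
  (forall S : set T, measurable [set w | S (y w)]%classic) ->
  balanced_rv P eps y -> balanced_pmf balance (law P (fun w => r (y w))).
Proof.
move=> my hy; have mY b : measurable [set w | r (y w) = b]%classic := my (fun x => r x = b).
split; [exact: law_ge0|exact: law_sum|move=> K a0 sK KT].
have [l [pl lA [a ha]]] := subgroup_prime sK KT.
have [K0 KB] := sK.
have KN x : x \in K -> - x \in K by move=> xK; rewrite -sub0r; apply: KB.
have KD x z : x \in K -> z \in K -> x + z \in K.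
  by move=> xK zK; rewrite -[z]opprK; apply: KB => //; apply: KN.
have KM x m : x \in K -> x *+ m \in K.
  by move=> xK; elim: m => [|m IH]; rewrite ?mulr0n // mulrS; apply: KD.
have iI := is_idl_multiples l.
have nI : ~ multiples l 1.
  by move=> [b]; rewrite rmorph1 => b1; have := ha 0 (a * b) K0; rewrite add0r -mulrnAr -b1 mulr1 eqxx.
have lI : multiples l l%:R by exists 1; rewrite rmorph_nat.
have fI : finite_quotient (multiples l).
  by have [s hs] := r_fin; exists s => x; have [z zs xz] := hs x; exists z => //; exists 0; rewrite mul0rn.
have [m [f hf]] := elem_quot_exists iI pl lI fI nI.
have [_ m0 fD fS fK] := hf.
have cI : calI (multiples l).
  split=> //; last by exists l, m, f.
  by have [x rx x0] := r_ker; exists x; split=> //; exists 0; rewrite mul0rn.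
have f0 : f 0 = 0 by apply/fK; exact: idl0 iI.
have fB x z : f (x - z) = f x - f z by apply/eqP; rewrite eq_sym subr_eq -fD subrK.
have fM x c : f (x *+ c) = f x *+ c.
  by elim: c => [|c IH]; rewrite ?mulr0n // !mulrS fD IH.
pose S : {set 'rV['F_l]_m} := [set v : 'rV['F_l]_m | `[< exists x, r x \in K /\ f x = v >]]%SET.
pose U : 'M['F_l]_m := (\sum_(v in S) <<v>>)%MS.
have SP v : v \in S <-> exists x, r x \in K /\ f x = v.
  by rewrite inE; split => /asboolP.
have SD v w : v \in S -> w \in S -> v + w \in S.
  move=> /SP[x [xK <-]] /SP[z [zK <-]]; apply/SP; exists (x + z).
  by rewrite rmorphD fD; split=> //; apply: KD.
(* Scalars of ['F_l] are classes of integers, so an additive subgroup is already a subspace. *)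
have SZ (c : 'F_l) v : v \in S -> c *: v \in S.
  move=> /SP[x [xK <-]]; apply/SP; exists (x *+ c).
  rewrite rmorphMn fM; split; first exact: KM.
  by rewrite -[in RHS](natr_Zp c); apply: esym; apply: scaler_nat.
have US (v : 'rV['F_l]_m) : (v <= U)%MS -> v \in S.
  case/sub_sumsmxP => w ->; apply: (big_ind (fun v => v \in S)) => [|x z|x xS].
  - by apply/SP; exists 0; rewrite rmorph0.
  - exact: SD.
  - have : (w x *m <<x>> <= x)%MS by apply: submx_trans (submxMl _ _) _; rewrite genmxE.
    by case/sub_rVP => c ->; apply: SZ.
(* If [U] were everything, the element [a] chosen outside [K + l A] would belong to it. *)
have rU : (\rank U < m)%N.
  rewrite ltn_neqAle rank_leq_row andbT; apply/negP => fU.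
  have [x xa] := r_surj a.
  have /US/SP[z [zK fz]] : (f x <= U)%MS by apply: submx_full.
  have /fK[b] : f (x - z) = 0 by rewrite fB fz subrr.
  rewrite rmorphB xa => /eqP; rewrite subr_eq => /eqP e.
  by have := ha (r z) b zK; rewrite {1}e addrC eqxx.
have [x0 x0a] := r_surj a0.
have := hy _ cI _ _ _ hf (f x0) U rU => H.
rewrite -lee_fin -(prob_pred P mY (fun x => x - a0 \in K)).
have H' : ((1 - eps (multiples l))%:E <= (1 - balance)%:E)%E.
  by rewrite lee_fin lerD2l lerN2; apply: balance_le.
apply: le_trans H'; apply: le_trans H.
apply: le_measure; rewrite ?inE.
- exact: (my (fun x => r x - a0 \in K)).
- exact: (my (fun x => (f x - f x0 <= U)%MS)).
- move=> w /= hw; rewrite -fB.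
  have vS : f (y w - x0) \in S by apply/SP; exists (y w - x0); rewrite rmorphB x0a.
  by apply: (submx_trans _ (sumsmx_sup _ vS (submx_refl _))); rewrite genmxE.
Qed.

End BalancedTransfer.

(** * Descent of the event to the finite ring *)

Section Descent.
Variables (T : idomainType) (k : nat) (p : 'I_k -> set T) (e : 'I_k -> nat).
Variables (A : finComNzRingType) (r : {rmorphism T -> A}).
Hypothesis r_surj : forall a, exists x, r x = a.
Hypothesis r_ker : forall x, r x = 0 <-> modulus p e x.
Variables (N : finLmodType T) (N' : finLmodType A) (g : N -> N').
Hypothesis g_bij : bijective g.
Hypothesis gD : forall v w, g (v + w) = g v + g w.
Hypothesis gZ : forall x v, g (x *: v) = r x *: g v.

Lemma desc0 : g 0 = 0.
Proof. by apply: (addIr (g 0)); rewrite -gD !add0r. Qed.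

Lemma desc_card : #|N| = #|N'|.
Proof. exact: (bij_eq_card g_bij). Qed.

Lemma desc_card_aut : card_aut N = #|module_aut N'|.
Proof.
have [g' gK Kg] := g_bij.
pose S : {set {ffun N -> N}} := [set f : {ffun N -> N} |
  `[< bijective f /\ forall a x y, f (a *: x + y) = a *: f x + f y >]]%SET.
have -> : card_aut N = #|S|.
  rewrite /card_aut; apply: eq_card => f; rewrite !inE.
  by apply/idP/idP => [/set_mem /=|h]; [|apply: mem_set].
pose F (f : {ffun N -> N}) : {ffun N' -> N'} := [ffun y => g (f (g' y))].
have Fi : injective F.
  move=> f f' /ffunP e'; apply/ffunP => x; have := e' (g x).
  by rewrite !ffunE gK => /(can_inj gK).
rewrite -(card_imset S Fi); apply: eq_card => f.
have SP f' : f' \in S <-> injective f' /\ forall a x y, f' (a *: x + y) = a *: f' x + f' y.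
  by rewrite inE; split=> [/asboolP[/bij_inj]|[/injF_bij b l]] //; apply/asboolP.
rewrite [RHS]inE; apply/imsetP/idP => [[f' /SP[f'i f'l] ->]|/andP[/injectiveP fi fl]].
  apply/andP; split.
    by apply/injectiveP => x y; rewrite !ffunE => /(can_inj gK)/f'i/(can_inj Kg).
  apply/forallP => a; apply/forallP => x; apply/forallP => y.
  rewrite !ffunE; have [c <-] := r_surj a.
  rewrite -[x in g' (_ *: x + _)]Kg -[y in g' (_ + y)]Kg -gZ -gD gK.
  by rewrite f'l gD gZ.
exists [ffun x => g' (f (g x))].
  apply/SP; split=> [x y|a x y]; rewrite !ffunE.
    by move/(can_inj Kg)/fi/(can_inj gK).
  have /forallP/(_ (g x))/forallP/(_ (g y))/eqP fE := forallP fl (r a).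
  by apply: (can_inj gK); rewrite gD gZ !Kg gD gZ !Kg fE.
by apply/ffunP => y; rewrite !ffunE !Kg.
Qed.

Section Event.
Variables (n u : nat) (M : 'M[T]_(n, n + u)).

Lemma lift_mx m1 m2 (x : 'M[A]_(m1, m2)) : exists v : 'M[T]_(m1, m2), map_mx r v = x.
Proof.
exists (\matrix_(i, j) projT1 (cid (r_surj (x i j)))).
by apply/matrixP => i j; rewrite !mxE; case: cid.
Qed.

Lemma reduced_kerE (v : 'cV[T]_n) :
  reduced_ker p e M v <-> map_mx r v \in mximage (map_mx r M).
Proof.
split=> [[w [v' [-> h]]]|/imsetP[w' _]].
  apply/imsetP; exists (map_mx r w) => //; rewrite map_mxD map_mxM.
  suff -> : map_mx r v' = 0 by rewrite addr0.
  by apply/colP => i; rewrite !mxE; apply/r_ker.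
have [w <-] := lift_mx w'; rewrite -map_mxM => h.
exists w, (v - M *m w); split; first by rewrite addrC subrK.
move=> i; apply/r_ker; have := congr1 (fun x : 'cV[A]_n => x i 0) h; rewrite !mxE => e'.
by rewrite rmorphB e' subrr.
Qed.

Lemma reduced_iso_descend : reduced_iso p e N M <-> cok_iso N' (map_mx r M).
Proof.
have [g' gK Kg] := g_bij.
split=> [[phi [lin sur ker]]|/existsP[f /andP[/fsurjP sf /eqP kf]]].
  have phi0 : phi 0 = 0.
    by have := lin 1 0 0; rewrite !scale1r addr0 => /eqP; rewrite -subr_eq subrr => /eqP.
  pose f : {ffun 'I_n -> N'} := [ffun i => g (phi (delta_mx i 0))].
  have fE (v : 'cV[T]_n) : linext f (map_mx r v) = g (phi v).
    rewrite [v in RHS]matrix_sum_delta.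
    under eq_bigr do rewrite big_ord_recl big_ord0 addr0.
    rewrite (big_morph phi (id1 := 0) (op1 := +%R)) //; last first.
      by move=> x y; have := lin 1 x y; rewrite !scale1r.
    rewrite (big_morph g gD desc0); apply: eq_bigr => i _.
    by rewrite mxE ffunE -gZ; congr g; have := lin (v i 0) (delta_mx i 0) 0; rewrite phi0 !addr0.
  apply/existsP; exists f; apply/andP; split.
    apply/fsurjP => y; have [v hv] := sur (g' y).
    by exists (map_mx r v); rewrite fE hv Kg.
  apply/eqP/setP => x; have [v <-] := lift_mx x; rewrite inE fE.
  apply/eqP/idP => [h|/reduced_kerE/ker ->]; last exact: desc0.
  by apply/reduced_kerE/ker; apply: (can_inj gK); rewrite h desc0.
exists (fun v => g' (linext f (map_mx r v))); split.
- move=> a x y; apply: (can_inj gK).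
  by rewrite gD gZ !Kg map_mxD map_mxZ linext_lin.
- move=> y; have [x hx] := sf (g y); have [v hv] := lift_mx x.
  by exists v; rewrite hv hx gK.
- move=> v; rewrite reduced_kerE -kf inE; split=> [h|/eqP->]; first by rewrite -[linext _ _]Kg h desc0.
  by rewrite -desc0 gK.
Qed.

End Event.
End Descent.

Section Surjections.
Variables (A : finComNzRingType) (N : finLmodType A).

(** A map [f] that is not surjective takes its values in the proper submodule [H f], which has at
    most half the elements of [N]; there are at most [2 ^ #|N|] such subsets. *)
Lemma nonsurj_card n :
  (#|N| ^ n <= #|[set f : {ffun 'I_n -> N} | fsurj f]%SET| + 2 ^ #|N| * (#|N| %/ 2) ^ n)%N.
Proof.
pose H (f : {ffun 'I_n -> N}) := [set linext f v | v : 'cV[A]_n]%SET.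
have sH f : submod (H f).
  split; first by apply/imsetP; exists 0; rewrite ?linext0.
    by move=> _ _ /imsetP[x _ ->] /imsetP[y _ ->]; rewrite -linextD; apply: imset_f.
  by move=> a _ /imsetP[x _ ->]; rewrite -linextZ; apply: imset_f.
pose B (W : {set N}) := [set f : {ffun 'I_n -> N} | H f == W & ~~ fsurj f]%SET.
have cB W : (#|B W| <= (#|N| %/ 2) ^ n)%N.
  have [->|[f0]] := set_0Vmem (B W); first by rewrite cards0.
  rewrite inE => /andP[/eqP HW ns].
  have W2 : (#|W| <= #|N| %/ 2)%N.
    rewrite leq_divRL // mulnC -cardsT; apply: submod_proper_double.
    - by rewrite -HW.
    - exact: submodT.
    - rewrite finset.properEneq finset.subsetT andbT; apply: contra ns => /eqP WT.
      apply/fsurjP => y; have : y \in W by rewrite WT inE.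
      by rewrite -HW => /imsetP[v _ ->]; exists v.
  apply: (@leq_trans #|[set f : {ffun 'I_n -> N} | f \in ffun_on (mem W)]%SET|).
    apply/subset_leq_card/fintype.subsetP => f; rewrite !inE => /andP[/eqP <- _].
    by apply/ffun_onP => i; rewrite -(linext_unitv f); apply: imset_f.
  rewrite cardsE card_ffun_on card_ord; have [->|n0] := posnP n; first by rewrite !expn0.
  by rewrite leq_exp2r.
rewrite -{1}(card_ord n) -card_ffun -(cardsC [set f : {ffun 'I_n -> N} | fsurj f]%SET) leq_add2l.
apply: (@leq_trans (\sum_(W : {set N}) #|B W|)).
  rewrite -sum1_card (partition_big H xpredT) //; apply: leq_sum => W _.
  rewrite -sum1_card; apply: eq_leq; apply: eq_bigl => f.
  by rewrite !inE andbC.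
apply: leq_trans (leq_sum _ (fun W _ => cB W)) _.
by rewrite sum_nat_const -cardsT -powersetT card_powerset cardsT.
Qed.

End Surjections.

Import numFieldNormedType.Exports.
Local Open Scope classical_set_scope.

(** * Limits *)

Lemma cvg_prod_seq (R : realType) I (s : seq I) (f : I -> nat -> R) (l : I -> R) :
  (forall i, f i n @[n --> \oo] --> l i) ->
  \prod_(i <- s) f i n @[n --> \oo] --> \prod_(i <- s) l i.
Proof.
move=> h; elim: s => [|i s IH].
  by rewrite big_nil; under eq_cvg do rewrite big_nil; apply: cvg_cst.
by rewrite big_cons; under eq_cvg do rewrite big_cons; apply: cvgM.
Qed.

Lemma euler_prod_cvg (R : realType) (q u : nat) : (0 < q)%N ->
  \prod_(1 <= j < J.+1) (1 - ((q%:R : R) ^+ (u + j))^-1) @[J --> \oo] --> euler_prod R q u.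
Proof.
move=> q0; pose a j : R := 1 - ((q%:R : R) ^+ (u + j))^-1.
have a01 j : 0 <= a j <= 1.
  have h : 1 <= (q%:R : R) ^+ (u + j) by apply: exprn_ege1; rewrite ler1n.
  have h0 : 0 < (q%:R : R) ^+ (u + j) by apply: lt_le_trans h.
  by rewrite /a subr_ge0 invf_le1 // h gerBl invr_ge0 ltW.
have P0 J : 0 <= \prod_(1 <= j < J.+1) a j.
  by apply: prodr_ge0 => j _; have /andP[] := a01 j.
apply: nonincreasing_is_cvgn; last by exists 0 => _ [J _ <-]; apply: P0.
apply/nonincreasing_seqP => J; rewrite [leLHS]big_nat_recr //=.
by apply: ler_piMr; [apply: P0|have /andP[] := a01 J.+1].
Qed.

Lemma surj_ratio_cvg (R : realType) (A : finComNzRingType) (N : finLmodType A) :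
  (surj_count N n)%:R / (#|N| ^ n)%:R @[n --> \oo] --> (1 : R).
Proof.
have N0 : (0 < #|N|)%N by apply/card_gt0P; exists 0.
have D n : 0 < (#|N| ^ n)%:R :> R by rewrite ltr0n expn_gt0 N0.
pose C : R := (2 ^ #|N|)%:R.
apply: (@squeeze_cvgr _ _ _ _ (fun n => 1 - C * (2^-1) ^+ n) (fun=> 1)); last exact: cvg_cst.
  apply: nearW => n; apply/andP; split; last first.
    rewrite ler_pdivrMr // mul1r ler_nat /surj_count.
    by apply: leq_trans (max_card _) _; rewrite card_ffun card_ord.
  have h1 : (#|N| ^ n)%:R <= (surj_count N n)%:R + C * (#|N| %/ 2)%:R ^+ n :> R.
    by rewrite -natrX -natrM -natrD ler_nat; apply: nonsurj_card.
  have h2 : (#|N| %/ 2)%:R ^+ n <= (2^-1) ^+ n * (#|N| ^ n)%:R :> R.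
    rewrite natrX -exprMn; apply: lerXn2r; rewrite ?nnegrE ?mulr_ge0 ?invr_ge0 //.
    by rewrite mulrC ler_pdivlMr // -natrM ler_nat leq_trunc_div.
  have C0 : 0 <= C by rewrite /C.
  rewrite ler_pdivlMr // mulrBl mul1r -mulrA.
  by have := ler_wpM2l C0 h2; lra.
rewrite -[X in _ --> X]subr0; apply: cvgB; first exact: cvg_cst.
rewrite -[X in _ --> X](mulr0 C); apply: cvgM; first exact: cvg_cst.
by apply: cvg_expr; rewrite ger0_norm ?invr_ge0 // invf_lt1 // ltr1n.
Qed.

Section MatrixLaw.
Variables (R : realType) (T : nzRingType) (A : finNzRingType) (r : T -> A).
Variables (d : measure_display) (Omega : measurableType d) (P : probability Omega R).
Variables (n m : nat) (M : Omega -> 'M[T]_(n, m)).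
Hypothesis hmeas : forall (i : 'I_n) (j : 'I_m) (B : set T), measurable [set w | B (M w i j)].
Hypothesis hind : forall B : 'I_n -> 'I_m -> set T,
  P [set w | forall i j, B i j (M w i j)] =
  (\prod_(i < n) \prod_(j < m) P [set w | B i j (M w i j)])%E.

Let red w : 'M[A]_(n, m) := map_mx r (M w).

Let redE b : [set w | red w = b] = [set w | forall i j, r (M w i j) = b i j].
Proof.
apply/seteqP; split=> w /= => [<- i j|h]; first by rewrite mxE.
by apply/matrixP => i j; rewrite mxE.
Qed.

Lemma measurable_reduction b : measurable [set w | red w = b].
Proof.
rewrite redE; have -> : [set w | forall i j, r (M w i j) = b i j] =
    \bigcap_(i in [set: 'I_n]) \bigcap_(j in [set: 'I_m]) [set w | r (M w i j) = b i j].
  by apply/seteqP; split=> w h; [move=> i _ j _; apply: h|move=> i j; apply: h].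
apply: fin_bigcap_measurable => [|i _]; first exact: finite_finset.
apply: fin_bigcap_measurable => [|j _]; first exact: finite_finset.
exact: (hmeas i j (fun x => r x = b i j)).
Qed.

Lemma law_reduction (b : 'M[A]_(n, m)) :
  law P red b = \prod_i \prod_j law P (fun w => r (M w i j)) (b i j).
Proof.
apply/EFin_inj; rewrite /law fineK ?fin_num_measure //; last exact: measurable_reduction.
rewrite redE (hind (fun i j x => r x = b i j)) -prodEFin; apply: eq_bigr => i _.
rewrite -prodEFin; apply: eq_bigr => j _.
by rewrite fineK // fin_num_measure //; exact: (hmeas i j (fun x => r x = b i j)).
Qed.

Lemma prob_reduction (Q : pred 'M[A]_(n, m)) :
  P [set w | Q (red w)] =
  (\sum_(b : 'M[A]_(n, m)) \prod_i \prod_j law P (fun w => r (M w i j)) (b i j) * (Q b)%:R)%:E.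
Proof.
rewrite (prob_pred P measurable_reduction); congr EFin; rewrite big_mkcond /=.
apply: eq_bigr => b _; rewrite -law_reduction.
by case: (Q b); rewrite ?mulr1 ?mulr0.
Qed.

End MatrixLaw.

Theorem theorem3p2
  (R : realType) (T : countIdomainType)
  (hT : dedekind_domain T)
  (hfin : forall J : set T, proper_idl J -> nonzero_idl J -> finite_quotient J)
  (eps : set T -> R) (heps : forall I : set T, calI I -> 0 < eps I)
  (k : nat) (p : 'I_k -> set T)
  (hp : forall i, prime_idl (p i) /\ nonzero_idl (p i))
  (hpinj : injective p)
  (q : 'I_k -> nat) (hq : forall i, quotient_card (p i) (q i))
  (N : finLmodType T)
  (hN : exists e : 'I_k -> nat,
     forall x : T, ideal_prod (fun i => ideal_pow (p i) (e i)) x ->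
     forall v : N, x *: v = 0)
  (u : nat) (hu : (0 < u)%N)
  (d : measure_display) (Omega : nat -> measurableType d)
  (P : forall n, probability (Omega n) R)
  (M : forall n, Omega n -> 'M[T]_(n, n + u))
  (hmeas : forall n (i : 'I_n) (j : 'I_(n + u)) (A : set T),
     measurable [set w | A (M n w i j)])
  (hind : forall n (A : 'I_n -> 'I_(n + u) -> set T),
     P n [set w | forall i j, A i j (M n w i j)] =
     (\prod_(i < n) \prod_(j < n + u) P n [set w | A i j (M n w i j)])%E)
  (hbal : forall n (i : 'I_n) (j : 'I_(n + u)),
     balanced_rv (P n) eps (fun w => M n w i j)) :
  P n [set w | cok_tensor_iso p (M n w) N] @[n --> \oo] -->
  (((#|N| ^ u * card_aut N)%:R : R)^-1 *
   \prod_(i < k) euler_prod R (q i) u)%:E.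

Proof.
have [e he] := hN.
have {}hN : forall x : T, (forall i, ideal_pow (p i) (e i) x) -> forall v : N, x *: v = 0.
  by move=> x /(mem_ideal_prod hT hp hpinj)/he.
have event n w : cok_tensor_iso p (M n w) N <-> reduced_iso p e N (M n w).
  split; first exact: (tensor_event_direct hT hfin hp hpinj hN).
  exact: (tensor_event_converse hT hfin hp hpinj hN).
(* [k = 0] is apart: the quotient ring [A] would be zero. *)
have [k0|k0] := posnP k.
  have noi (i : 'I_k) : False by case: i => j; rewrite k0.
  have N0 (v : N) : v = 0 by rewrite -[v]scale1r; apply: hN => i; case: (noi i).
  have all_iso n w : cok_tensor_iso p (M n w) N.
    apply/event; exists (fun=> 0); split=> [a x y|y|v]; rewrite ?scaler0 ?addr0 //.
      by exists 0; rewrite (N0 y).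
    split=> // _; exists 0, v; split; first by rewrite mulmx0 add0r.
    by move=> a i; case: (noi i).
  have cN : #|N| = 1%N by apply/eqP/fintype1P; exists 0 => v; rewrite (N0 v).
  have cA : card_aut N = 1%N.
    apply/eqP/fintype.card1P; exists [ffun x => x] => f; rewrite !inE.
    have -> : f = [ffun x => x] by apply/ffunP => x; rewrite (N0 (f x)) (N0 x) ffunE.
    rewrite eqxx; apply/idP/mem_set/asboolP; split; first by exists id => x; rewrite ffunE.
    by move=> a x y; rewrite !ffunE.
  rewrite cN cA exp1n muln1 invr1 mul1r big1 => [|i _]; last by case: (noi i).
  have -> : (fun n => P n [set w | cok_tensor_iso p (M n w) N]) = (fun=> 1%:E).
    apply/funext => n; rewrite -(probability_setT (P n)); congr (P n _).
    by apply/seteqP; split=> w /= _ //; apply: all_iso.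
  exact: cvg_cst.
have [A [r [K [h [pi [[r_surj r_ker pi_ann] [h_surj h_ker idem nil cK]]]]]]] :=
  reduction_data hT hfin hp hpinj e hq k0.
have [N' [g [g_bij gD gZ]]] := module_over_quotient r_surj
  (fun x hx v => modulus_kills hp hN v ((r_ker x).1 hx)).
have ann i (a : A) : pi i * a = 0 -> forall v : N', a *: v = 0.
  have [x <-] := r_surj a => /pi_ann hx v; have [g' _ Kg] := g_bij.
  by rewrite -[v]Kg -gZ (hN _ hx) (desc0 gD).
have rn : exists2 x, r x = 0 & x != 0.
  by have [x [/r_ker rx x0]] := modulus_nonzero hT hfin hp e; exists x.
have rf : exists s : seq T, forall x, exists2 y, y \in s & r (x - y) = 0.
  have [s hs] := modulus_finite hT hfin hp e k0.
  by exists s => x; have [y ys /r_ker xy] := hs x; exists y.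
have U := finite_universality h_surj h_ker ann idem nil u (balance_gt0 r heps) (balance_le_half r eps).
pose mu n i j := law (P n) (fun w => r (M n w i j)).
pose F n := \sum_b mxprob (mu n) b * (cok_iso N' b)%:R.
have PE n : P n [set w | cok_tensor_iso p (M n w) N] = (F n)%:E.
  have -> : [set w | cok_tensor_iso p (M n w) N] = [set w | cok_iso N' (map_mx r (M n w))].
    by apply/seteqP; split=> w /= => [/event|] /(reduced_iso_descend r_surj r_ker g_bij gD gZ) // /event.
  exact: (prob_reduction r (hmeas n) (hind n) (fun b => cok_iso N' b)).
have bal n i j : balanced_pmf (balance r eps) (mu n i j).
  exact: (balanced_transfer r_surj rn rf (hmeas n i j) (hbal n i j)).
pose s n : R := (surj_count N' n)%:R / (#|N'| ^ (n + u))%:R.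
(* The error of [finite_universality]. The probability is recovered as [c n] plus the main term,
   divided by the number of automorphisms, and [s n] tends to [#|N'| ^ -u]. *)
pose c n : R := #|module_aut N'|%:R * F n - s n * euler_partial R K u n.
have c0 : c n @[n --> \oo] --> 0.
  apply/cvgr0Pnorm_le => t t0; have [n0 H] := U t t0.
  by exists n0 => // n /= hn; apply: H => //; apply: bal.
have aut0 : (#|module_aut N'|%:R : R) != 0.
  rewrite pnatr_eq0 -lt0n; apply/card_gt0P; exists [ffun x => x]; rewrite inE; apply/andP; split.
    by apply/injectiveP => x y; rewrite !ffunE.
  by apply/forallP => a; apply/forallP => x; apply/forallP => y; rewrite !ffunE.
have N0 : (0 < #|N'|)%N by apply/card_gt0P; exists 0.
have sE n : s n = (surj_count N' n)%:R / (#|N'| ^ n)%:R * ((#|N'| ^ u)%:R)^-1.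
  by rewrite /s expnD natrM invfM mulrA.
rewrite (desc_card_aut r_surj g_bij gD gZ) (desc_card g_bij).
have -> : (fun n => P n [set w | cok_tensor_iso p (M n w) N]) =
   (fun n => (((#|module_aut N'|%:R)^-1 * (c n + s n * euler_partial R K u n)))%:E).
  by apply/funext => n; rewrite PE /c subrK mulKf.
apply: cvg_EFin; first exact: nearW.
rewrite natrM invfM [_ / _]mulrC -mulrA; apply: cvgM; first exact: cvg_cst.
rewrite -[X in _ --> X]add0r; apply: cvgD => //; apply: cvgM.
  rewrite -[X in _ --> X]mul1r; under eq_cvg do rewrite sE.
  by apply: cvgM; [exact: surj_ratio_cvg|exact: cvg_cst].
apply: cvg_prod_seq => i; rewrite -cK; apply: euler_prod_cvg.
by apply/card_gt0P; exists 0.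
Qed.
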